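(* Let $\Sigma$ be a cyclic anisotropic minimal surface of the Dirichlet energy in $\mathbb{R}^3$ (that is, with anisotropic mean curvature $\Lambda=0$). Then $\Sigma$ is a surface of revolution about an axis parallel to the $z$-axis, or it is a member of the following family of surfaces: after translations of $\mathbb{R}^3$, the surfaces parametrized by $$X(s,\theta)=(a(s),b(s),s)+r(s)(\cos\theta,\sin\theta,0),$$ where $c,\lambda,\mu\in\mathbb{R}$ with $c\neq 0$ and $\lambda^2+\mu^2\neq 0$, the domain $I\subset\mathbb{R}$ of $s$ is such that the functions $r,a,b$ make sense, and $r,a,b$ are of one of the following three types: \begin{enumerate} \item Type I: $$r(s)=\frac{c}{\sqrt{\lambda^2+\mu^2}\,\cos(cs)},\quad a(s)=\frac{c\lambda\tan(cs)}{\lambda^2+\mu^2},\quad b(s)=\frac{c\mu\tan(cs)}{\lambda^2+\mu^2};$$ \item Type II: $$r(s)=\frac{1}{\sqrt{\lambda^2+\mu^2}\,s+c},\quad a(s)=-\frac{\lambda}{(\lambda^2+\mu^2)s+c\sqrt{\lambda^2+\mu^2}},\quad b(s)=-\frac{\mu}{(\lambda^2+\mu^2)s+c\sqrt{\lambda^2+\mu^2}};$$ \item Type III: $$r(s)=\frac{c}{\sqrt{\lambda^2+\mu^2}\,\sinh(cs)},\quad a(s)=-\frac{c\lambda\coth(cs)}{\lambda^2+\mu^2},\quad b(s)=-\frac{c\mu\coth(cs)}{\lambda^2+\mu^2}.$$ \end{enumerate}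
   Context: Let $\Sigma$ be an oriented surface immersed in Euclidean space $\mathbb{R}^3$ (coordinates $(x,y,z)$) with unit normal $\nu=(\nu_1,\nu_2,\nu_3)$. The Dirichlet energy of $\Sigma$ is $\mathcal{F}(\Sigma)=\int_\Sigma F(\nu)\,d\Sigma$ with $F(\nu)=\frac{1}{\nu_3}-\nu_3$, where it is understood that $\nu_3\neq 0$; if $\Sigma$ is the graph $z=u(x,y)$ over $\Omega\subset\mathbb{R}^2$, this equals $\int_\Omega|Du|^2$. The anisotropic mean curvature of $\Sigma$ is $\Lambda=2HF-\mathrm{div}_\Sigma DF$, where $H$ is the mean curvature of $\Sigma$ and $DF$ is the gradient of $F$ on the unit sphere $\mathbb{S}^2$. $\Sigma$ is an anisotropic minimal surface if $\Lambda=0$; for a graph $z=u(x,y)$ this means $u_{xx}+u_{yy}=0$. A surface of $\mathbb{R}^3$ is a cyclic surface if it is foliated by a smooth one-parameter family of circles (not necessarily of the same radius). In the parametrization, $s\in I$, $\theta\in\mathbb{R}$, and the circle at height $s$ has center $(a(s),b(s),s)$ and radius $r(s)>0$.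
   Formalization: The surface is also assumed not to lie in a plane: z = x minus a point, foliated by concentric circles, has Λ = 0 but is in neither class. In types I–III the function r may be negative where it makes sense; the circle then has radius |r|. *)

(* Defs.v *)
From Stdlib Require Import Reals.
From Coquelicot Require Import Coquelicot.
Open Scope R_scope.

Definition R3 : Type := (R * R * R)%type.

Definition px (p : R3) : R := fst (fst p).
Definition py (p : R3) : R := snd (fst p).
Definition pz (p : R3) : R := snd p.

Definition dot (u v : R3) : R := px u * px v + py u * py v + pz u * pz v.
Definition cross (u v : R3) : R3 :=
  (py u * pz v - pz u * py v, pz u * px v - px u * pz v, px u * py v - py u * px v).
Definition enorm (u : R3) : R := sqrt (dot u u).

Definition nonempty_open_interval (I : R -> Prop) : Prop :=
  (exists s, I s) /\ open I /\
  (forall s1 s s2, I s1 -> I s2 -> s1 <= s <= s2 -> I s).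

Definition smooth_on (I : R -> Prop) (f : R -> R) : Prop :=
  forall (n : nat) (s : R), I s -> ex_derive_n f n s.
Definition smooth_curve_on (I : R -> Prop) (c : R -> R3) : Prop :=
  smooth_on I (fun s => px (c s)) /\ smooth_on I (fun s => py (c s)) /\
  smooth_on I (fun s => pz (c s)).

(* Geometry of a parametrized surface (s, t) |-> X s t. *)

Definition Derive_R3 (c : R -> R3) (s : R) : R3 :=
  (Derive (fun x => px (c x)) s, Derive (fun x => py (c x)) s,
   Derive (fun x => pz (c x)) s).
Definition d_s (V : R -> R -> R3) (s t : R) : R3 := Derive_R3 (fun x => V x t) s.
Definition d_t (V : R -> R -> R3) (s t : R) : R3 := Derive_R3 (fun y => V s y) t.

Definition normal_field (X : R -> R -> R3) (s t : R) : R3 :=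
  cross (d_s X s t) (d_t X s t).
Definition unit_normal (X : R -> R -> R3) (s t : R) : R3 :=
  scal (/ enorm (normal_field X s t)) (normal_field X s t).

Definition immersion_on (I : R -> Prop) (X : R -> R -> R3) : Prop :=
  forall s t, I s -> normal_field X s t <> zero.

Definition ff_E (X : R -> R -> R3) (s t : R) : R := dot (d_s X s t) (d_s X s t).
Definition ff_F (X : R -> R -> R3) (s t : R) : R := dot (d_s X s t) (d_t X s t).
Definition ff_G (X : R -> R -> R3) (s t : R) : R := dot (d_t X s t) (d_t X s t).
Definition sf_e (X : R -> R -> R3) (s t : R) : R := dot (d_s (d_s X) s t) (unit_normal X s t).
Definition sf_f (X : R -> R -> R3) (s t : R) : R := dot (d_t (d_s X) s t) (unit_normal X s t).
Definition sf_g (X : R -> R -> R3) (s t : R) : R := dot (d_t (d_t X) s t) (unit_normal X s t).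

(* Sign convention: 2 H = - div nu (a round sphere has H > 0 for its inward
   normal).  It is the one for which 2 H F - div (DF) is the Euler-Lagrange
   expression of the integral of F(nu). *)
Definition mean_curvature (X : R -> R -> R3) (s t : R) : R :=
  (sf_e X s t * ff_G X s t - 2 * sf_f X s t * ff_F X s t + sf_g X s t * ff_E X s t)
  / (2 * (ff_E X s t * ff_G X s t - ff_F X s t ^ 2)).

(* Trace over the tangent plane of (v, w) |-> <D_v V, w>, i.e. the sum of
   g^{ij} <V_i, X_j>, for a field V along X. *)
Definition surface_div (X V : R -> R -> R3) (s t : R) : R :=
  (ff_G X s t * dot (d_s V s t) (d_s X s t)
   - ff_F X s t * (dot (d_s V s t) (d_t X s t) + dot (d_t V s t) (d_s X s t))
   + ff_E X s t * dot (d_t V s t) (d_t X s t))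
  / (ff_E X s t * ff_G X s t - ff_F X s t ^ 2).

Definition gradient (F : R3 -> R) (p : R3) : R3 :=
  (Derive (fun x => F (x, py p, pz p)) (px p),
   Derive (fun y => F (px p, y, pz p)) (py p),
   Derive (fun z => F (px p, py p, z)) (pz p)).

(* Gradient on the unit sphere of the restriction of F to it: the tangential
   part of the Euclidean gradient at a unit vector n. *)
Definition sphere_gradient (F : R3 -> R) (n : R3) : R3 :=
  minus (gradient F n) (scal (dot (gradient F n) n) n).

Definition anisotropic_mean_curvature (F : R3 -> R) (X : R -> R -> R3) (s t : R) : R :=
  2 * mean_curvature X s t * F (unit_normal X s t)
  - surface_div X (fun s t => sphere_gradient F (unit_normal X s t)) s t.

Definition dirichlet_density (n : R3) : R := / pz n - pz n.

(* The density is defined only where nu_3 <> 0, so the equation is required at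
   the points where nu_3 <> 0, and there must be such points.  Complete circles
   may meet the curve nu_3 = 0: those of the surfaces of types I and II do. *)
Definition dirichlet_minimal_on (I : R -> Prop) (X : R -> R -> R3) : Prop :=
  (exists s t, I s /\ pz (unit_normal X s t) <> 0) /\
  (forall s t, I s -> pz (unit_normal X s t) <> 0 ->
     anisotropic_mean_curvature dirichlet_density X s t = 0).

(* A one-parameter family of circles in arbitrary planes: center C s, radius
   r s, and an orthonormal basis (e1 s, e2 s) of the direction of the plane. *)
Definition circles (C e1 e2 : R -> R3) (r : R -> R) (s t : R) : R3 :=
  plus (C s) (scal (r s) (plus (scal (cos t) (e1 s)) (scal (sin t) (e2 s)))).

Definition cyclic (I : R -> Prop) (C e1 e2 : R -> R3) (r : R -> R) : Prop :=
  nonempty_open_interval I /\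
  smooth_curve_on I C /\ smooth_curve_on I e1 /\ smooth_curve_on I e2 /\
  smooth_on I r /\
  (forall s, I s ->
     0 < r s /\ dot (e1 s) (e1 s) = 1 /\ dot (e2 s) (e2 s) = 1 /\ dot (e1 s) (e2 s) = 0) /\
  immersion_on I (circles C e1 e2 r).

Definition surface (I : R -> Prop) (X : R -> R -> R3) (p : R3) : Prop :=
  exists s t, I s /\ p = X s t.

Definition planar (S : R3 -> Prop) : Prop :=
  exists (n : R3) (d : R), n <> zero /\ forall p, S p -> dot n p = d.

Definition rotation_z (x0 y0 t : R) (p : R3) : R3 :=
  (x0 + (cos t * (px p - x0) - sin t * (py p - y0)),
   y0 + (sin t * (px p - x0) + cos t * (py p - y0)),
   pz p).

Definition revolution_about_vertical_axis (S : R3 -> Prop) : Prop :=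
  exists x0 y0, forall t p, S p -> S (rotation_z x0 y0 t p).

Inductive family_type := TypeI | TypeII | TypeIII.

(* Where the denominators do not vanish.  The function family_r may be negative
   there; the circle then has radius - family_r k c la mu s. *)
Definition family_domain (k : family_type) (c la mu s : R) : Prop :=
  match k with
  | TypeI => cos (c * s) <> 0
  | TypeII => sqrt (la ^ 2 + mu ^ 2) * s + c <> 0
  | TypeIII => sinh (c * s) <> 0
  end.

Definition coth (x : R) : R := cosh x / sinh x.

Definition family_r (k : family_type) (c la mu s : R) : R :=
  match k with
  | TypeI => c / (sqrt (la ^ 2 + mu ^ 2) * cos (c * s))
  | TypeII => 1 / (sqrt (la ^ 2 + mu ^ 2) * s + c)
  | TypeIII => c / (sqrt (la ^ 2 + mu ^ 2) * sinh (c * s))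
  end.

Definition family_a (k : family_type) (c la mu s : R) : R :=
  match k with
  | TypeI => c * la * tan (c * s) / (la ^ 2 + mu ^ 2)
  | TypeII => - (la / ((la ^ 2 + mu ^ 2) * s + c * sqrt (la ^ 2 + mu ^ 2)))
  | TypeIII => - (c * la * coth (c * s) / (la ^ 2 + mu ^ 2))
  end.

Definition family_b (k : family_type) (c la mu s : R) : R :=
  match k with
  | TypeI => c * mu * tan (c * s) / (la ^ 2 + mu ^ 2)
  | TypeII => - (mu / ((la ^ 2 + mu ^ 2) * s + c * sqrt (la ^ 2 + mu ^ 2)))
  | TypeIII => - (c * mu * coth (c * s) / (la ^ 2 + mu ^ 2))
  end.

Definition family_X (k : family_type) (c la mu s t : R) : R3 :=
  plus (family_a k c la mu s, family_b k c la mu s, s)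
       (scal (family_r k c la mu s) (cos t, sin t, 0)).

(* Main.v *)
(** The anisotropic mean curvature of the Dirichlet density is [2 Q / N_z^3], where [N = X_s x X_t]
    and [Q] is the trace of the (unnormalized) second fundamental form with respect to the
    degenerate metric [dx^2 + dy^2]; so [N_z Q = 0] everywhere, including on the curves [nu_3 = 0].
    On a circle [N_z Q] is a trigonometric polynomial of degree 7.  Writing
    [E = e1 - i e2] and [n' = - p e1 - q e2] for the derivative of the unit normal [n = e1 x e2] of the
    planes, its leading coefficient is a nonzero multiple of [(p - i q)^4 E_z^3].  Hence at each [s]
    the planes are stationary or horizontal; in both cases [n_z' = 0], so [n_z], and then [n], is constant.

    If the planes are not horizontal, [Q] of degree 3 forces every circle to move inside its plane
    or vertically without changing its radius; by connectedness the surface is planar or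
    [nu_3 = 0] identically.  If they are horizontal, with center [(a, b, z)],
    then [z'] vanishes identically or nowhere, and in the second case the equation becomes
    [(a' / (z' r^2))' = (b' / (z' r^2))' = 0] together with a second order equation for [1 / r] as a function of
    the height, which after one integration is linear with constant coefficients; the sign of
    the constant gives the three types. *)

Require Import Defs.
From Stdlib Require Import Reals Ranalysis5 Lra Lia.
From Coquelicot Require Import Coquelicot.
Open Scope R_scope.

(** * Leading coefficients of trigonometric polynomials *)

(** Trigonometric polynomials have no zero divisors, so [N_z Q = 0] splits on each circle: one of
    the two factors vanishes on the whole circle. This alternative is only pointwise in [s] and
    could a priori change along the family; most of the work after the leading coefficient consists
    in making it uniform. For tilted planes, a continuous function of [s] has a sign that records
    the alternative, and a zero of it would contradict the immersion. For horizontal planes, the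
    equations are kept in polynomial form, valid also where [z' = 0], until a linear homogeneous
    equation for a squared slope excludes isolated zeros of [z'].

    The parameters [la] and [mu] of the family are the constants [a' / (z' r^2)] and
    [b' / (z' r^2)], and the vertical translation is the phase of the profile [1 / r]. The radius
    function of the family may be negative and the frame of the given circles may turn or reverse,
    so circles are compared as point sets, through their center, their height and the square of
    their radius. *)

Definition wave (k : nat) (z : C) (t : R) : R :=
  Re z * cos (INR k * t) - Im z * sin (INR k * t).

(** [wave k z] is the real part of [z exp(i k t)], so one complex number carries both coefficients
    of a frequency. The constructor [trig_ext] closes the class under pointwise equality, which
    replaces functional extensionality. *)
Inductive trig (n : nat) : (R -> R) -> Prop :=
| trig_wave k z : (k <= n)%nat -> trig n (wave k z)
| trig_plus f g : trig n f -> trig n g -> trig n (fun t => f t + g t)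
| trig_ext f g : trig n f -> (forall t, f t = g t) -> trig n g.

(* [f] has degree at most [n + 1], and [z] is its coefficient at the frequency [n + 1]. *)
Definition lead (n : nat) (z : C) (f : R -> R) : Prop :=
  exists g, trig n g /\ forall t, f t = wave (S n) z t + g t.

Lemma trig_const n a : trig n (fun _ => a).
Proof.
apply trig_ext with (wave 0 (RtoC a)); [apply trig_wave; lia|].
intros t; unfold wave; simpl; rewrite Rmult_0_l, cos_0, sin_0; ring.
Qed.

Lemma trig_scal n a f : trig n f -> trig n (fun t => a * f t).
Proof.
induction 1 as [k z Hk|f g _ IHf _ IHg|f g _ IHf E].
- apply trig_ext with (wave k (RtoC a * z)%C); [now apply trig_wave|].
  intros t; unfold wave; destruct z; simpl; ring.
- apply trig_ext with (fun t => a * f t + a * g t); [now apply trig_plus|].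
  intros; ring.
- apply trig_ext with (fun t => a * f t); [assumption|].
  intros; now rewrite E.
Qed.

Lemma trig_le n m f : (n <= m)%nat -> trig n f -> trig m f.
Proof.
intros H; induction 1 as [k z Hk|f g _ IHf _ IHg|f g _ IHf E].
- apply trig_wave; lia.
- now apply trig_plus.
- now apply trig_ext with f.
Qed.

(** This is [Re x Re y = (Re (x y) + Re (x conj y)) / 2]; the order of [k] and [l] keeps the natural
    subtraction exact. *)
Lemma wave_mult k l z w t :
  (l <= k)%nat ->
  wave k z t * wave l w t =
  wave (k + l) (z * w / 2)%C t + wave (k - l) (z * Cconj w / 2)%C t.
Proof.
intros H; unfold wave.
rewrite plus_INR, minus_INR by assumption.
replace ((INR k - INR l) * t) with (INR k * t - INR l * t) by ring.
replace ((INR k + INR l) * t) with (INR k * t + INR l * t) by ring.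
rewrite cos_minus, sin_minus, cos_plus, sin_plus.
destruct z as [a b], w as [c d]; simpl; field.
Qed.

Lemma trig_mult n m f g : trig n f -> trig m g -> trig (n + m) (fun t => f t * g t).
Proof.
intros Hf Hg; induction Hf as [k z Hk|f f' _ IHf _ IHf'|f f' _ IHf E].
- induction Hg as [l w Hl|g g' _ IHg _ IHg'|g g' _ IHg E].
  + destruct (Nat.le_ge_cases l k) as [H|H].
    * eapply trig_ext; [|intros t; symmetry; now apply wave_mult].
      apply trig_plus; apply trig_wave; lia.
    * apply trig_ext with (fun t => wave l w t * wave k z t); [|intros; cbv beta; ring].
      eapply trig_ext; [|intros t; symmetry; now apply wave_mult].
      apply trig_plus; apply trig_wave; lia.
  + eapply trig_ext; [exact (trig_plus _ _ _ IHg IHg')|intros; cbv beta; ring].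
  + eapply trig_ext; [exact IHg|intros; cbv beta; now rewrite E].
- eapply trig_ext; [exact (trig_plus _ _ _ IHf IHf')|intros; cbv beta; ring].
- eapply trig_ext; [exact IHf|intros; cbv beta; now rewrite E].
Qed.

Lemma lead_ext n z w f g :
  lead n z f -> z = w -> (forall t, f t = g t) -> lead n w g.
Proof.
intros (h & Hh & E) <- H; exists h; split; [assumption|].
intros t; now rewrite <- H.
Qed.

Lemma wave_plus k z w t : wave k (z + w)%C t = wave k z t + wave k w t.
Proof. unfold wave; destruct z, w; simpl; ring. Qed.

Lemma lead_plus n z w f g :
  lead n z f -> lead n w g -> lead n (z + w)%C (fun t => f t + g t).
Proof.
intros (h & Hh & E) (h' & Hh' & E').
exists (fun t => h t + h' t); split; [now apply trig_plus|].
intros t; rewrite E, E', wave_plus; ring.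
Qed.

Lemma lead_scal n a z f : lead n z f -> lead n (RtoC a * z)%C (fun t => a * f t).
Proof.
intros (h & Hh & E).
exists (fun t => a * h t); split; [now apply trig_scal|].
intros t; rewrite E; unfold wave; destruct z; simpl; ring.
Qed.

Lemma lead_minus n z w f g :
  lead n z f -> lead n w g -> lead n (z - w)%C (fun t => f t - g t).
Proof.
intros Hf Hg.
eapply lead_ext; [exact (lead_plus _ _ _ _ _ Hf (lead_scal _ (-1) _ _ Hg))| |].
- destruct z, w; apply injective_projections; simpl; ring.
- intros; simpl; ring.
Qed.

Lemma trig_lead n f : trig n f -> lead n 0%C f.
Proof.
intros H; exists f; split; [assumption|].
intros t; unfold wave; simpl; ring.
Qed.

Lemma lead_trig n z f : lead n z f -> trig (S n) f.
Proof.
intros (g & Hg & E).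
apply trig_ext with (fun t => wave (S n) z t + g t).
- apply trig_plus; [apply trig_wave; lia|apply trig_le with n; auto].
- intros; now rewrite E.
Qed.

(** The point [cos t e1 + sin t e2] is the real part of [(e1 - i e2) exp(i t)]; this is where the
    complex vector [E] and the minus signs of all later coefficients come from. *)
Lemma lead_cos_sin x y : lead 0 (x, - y) (fun t => cos t * x + sin t * y).
Proof.
exists (fun _ => 0); split; [apply trig_const|].
intros t; unfold wave; simpl; rewrite Rmult_1_l; ring.
Qed.

(** Leading coefficients multiply, up to the factor 1/2 of [wave_mult]. The index shift is that of
    [lead]: degrees [n + 1] and [m + 1] add up to [S (n + m) + 1]. *)
Lemma lead_mult n m z w f g :
  lead n z f -> lead m w g -> lead (S (n + m)) (z * w / 2)%C (fun t => f t * g t).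
Proof.
intros Hf Hg.
assert (Hf' := lead_trig _ _ _ Hf). assert (Hg' := lead_trig _ _ _ Hg).
destruct Hf as (f1 & Hf & Ef), Hg as (g1 & Hg & Eg).
assert (W : exists h, trig (S (n + m)) h /\
  forall t, wave (S n) z t * wave (S m) w t = wave (S (S (n + m))) (z * w / 2)%C t + h t).
{ destruct (Nat.le_ge_cases m n) as [H|H].
  - exists (wave (S n - S m) (z * Cconj w / 2)%C); split; [apply trig_wave; lia|].
    intros t; rewrite wave_mult by lia.
    now replace (S n + S m)%nat with (S (S (n + m))) by lia.
  - exists (wave (S m - S n) (w * Cconj z / 2)%C); split; [apply trig_wave; lia|].
    intros t; rewrite Rmult_comm, wave_mult by lia.
    replace (S m + S n)%nat with (S (S (n + m))) by lia.
    now rewrite (Cmult_comm w z). }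
destruct W as (h & Hh & W).
(* The remainder is split asymmetrically, with the whole of [g] in the last product, so that each
   product is a single use of [trig_mult]. *)
exists (fun t => h t + (wave (S n) z t * g1 t + f1 t * g t)); split.
- apply trig_plus; [assumption|apply trig_plus].
  + apply (trig_mult (S n) m); [apply trig_wave; lia|assumption].
  + replace (S (n + m)) with (n + S m)%nat by lia. now apply trig_mult.
- intros t; rewrite Ef, Eg, <- Rplus_assoc, <- W. rewrite <- Eg at 1. rewrite Eg; ring.
Qed.

(* The functional [f |-> sum_j (-1)^j f (t + j pi / (n+1))] over one period kills
   every frequency at most [n] and multiplies frequency [n+1] by [2(n+1)]. *)
Definition alternating_sum (n : nat) (f : R -> R) (t : R) (N : nat) : R :=
  sum_f_R0 (fun j => (-1) ^ j * f (t + INR j * (PI / INR (S n)))) N.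

Lemma wave_shift_sum k z x h :
  wave k z (x + h / 2) + wave k z (x - h / 2) = 2 * cos (INR k * h / 2) * wave k z x.
Proof.
unfold wave.
rewrite Rmult_plus_distr_l, Rmult_minus_distr_l.
replace (INR k * h / 2) with (INR k * (h / 2)) by field.
rewrite cos_plus, cos_minus, sin_plus, sin_minus; ring.
Qed.

(** The factor [2 cos (k h / 2)] turns each sample into the sum of the samples half a step before
    and after it; with alternating signs the sum telescopes. *)
Lemma alternating_sum_wave n k z t N :
  let h := PI / INR (S n) in
  2 * cos (INR k * h / 2) * alternating_sum n (wave k z) t N =
  (-1) ^ N * wave k z (t + (INR N + / 2) * h) + wave k z (t - h / 2).
Proof.
intros h; unfold alternating_sum; fold h.
induction N as [|N IH].
- simpl sum_f_R0; simpl pow. rewrite !Rmult_1_l, INR_0.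
  replace (t + 0 * h) with t by ring.
  replace (t + (0 + / 2) * h) with (t + h / 2) by field.
  now rewrite wave_shift_sum.
- rewrite tech5, Rmult_plus_distr_l, IH.
  replace (2 * cos (INR k * h / 2) * ((-1) ^ S N * wave k z (t + INR (S N) * h)))
    with ((-1) ^ S N * (2 * cos (INR k * h / 2) * wave k z (t + INR (S N) * h))) by ring.
  rewrite <- wave_shift_sum.
  replace (t + INR (S N) * h - h / 2) with (t + (INR N + / 2) * h)
    by (rewrite S_INR; field).
  replace (t + INR (S N) * h + h / 2) with (t + (INR (S N) + / 2) * h) by field.
  simpl pow; ring.
Qed.

Lemma wave_period k z t : wave k z (t + 2 * PI) = wave k z t.
Proof.
unfold wave.
replace (INR k * (t + 2 * PI)) with (INR k * t + 2 * INR k * PI) by ring.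
now rewrite cos_period, sin_period.
Qed.

Lemma pow_m1_odd n : (-1) ^ (2 * n + 1) = -1.
Proof. rewrite pow_add, pow_1_even; simpl; ring. Qed.

(** The [2 n + 2] steps of length [pi / (n + 1)] make up one period, and the last sign is -1, so the
    two end terms of the telescoped sum cancel. The factor [2 cos (k h / 2)] can be divided out
    because [k <= n] gives [k h < pi]. *)
Lemma alternating_sum_trig n f t : trig n f -> alternating_sum n f t (2 * n + 1) = 0.
Proof.
assert (Hn : 0 < INR (S n)) by apply lt_0_INR, Nat.lt_0_succ.
assert (HPI := PI_RGT_0).
induction 1 as [k z Hk|f g _ IHf _ IHg|f g _ IHf E].
- set (h := PI / INR (S n)).
  assert (P : 2 * cos (INR k * h / 2) * alternating_sum n (wave k z) t (2 * n + 1) = 0).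
  { assert (A := alternating_sum_wave n k z t (2 * n + 1)).
    cbv zeta in A; fold h in A; rewrite A.
    replace (t + (INR (2 * n + 1) + / 2) * h) with (t - h / 2 + 2 * PI).
    - rewrite wave_period, pow_m1_odd; ring.
    - unfold h. rewrite plus_INR, mult_INR, !S_INR, INR_0.
      rewrite S_INR in Hn. field; lra. }
  assert (cos (INR k * h / 2) <> 0).
  { apply Rgt_not_eq, cos_gt_0.
    - apply Rlt_le_trans with 0; [lra|].
      assert (0 <= INR k) by apply pos_INR.
      assert (0 < h) by (apply Rdiv_lt_0_compat; lra). nra.
    - assert (INR k * h < PI); [|lra].
      unfold h. apply Rmult_lt_reg_r with (INR (S n)); [assumption|].
      replace (INR k * (PI / INR (S n)) * INR (S n)) with (INR k * PI) by (field; lra).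
      rewrite (Rmult_comm PI). apply Rmult_lt_compat_r; [lra|]. apply lt_INR; lia. }
  apply Rmult_integral in P; destruct P as [P|P]; [lra|exact P].
- transitivity (alternating_sum n f t (2 * n + 1) + alternating_sum n g t (2 * n + 1)).
  + unfold alternating_sum; rewrite <- plus_sum. apply sum_eq; intros; ring.
  + lra.
- rewrite <- IHf. apply sum_eq; intros; now rewrite E.
Qed.

Lemma wave_half_period n z t j :
  wave (S n) z (t + INR j * (PI / INR (S n))) = (-1) ^ j * wave (S n) z t.
Proof.
assert (Hn : INR (S n) <> 0) by now apply not_0_INR.
induction j as [|j IH].
- simpl; f_equal; rewrite Rmult_0_l, Rplus_0_r, Rmult_1_l; reflexivity.
- rewrite (S_INR j). simpl pow; rewrite Rmult_assoc, <- IH.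
  unfold wave.
  replace (INR (S n) * (t + (INR j + 1) * (PI / INR (S n))))
    with (INR (S n) * (t + INR j * (PI / INR (S n))) + PI) by now field.
  rewrite neg_cos, neg_sin; ring.
Qed.

(** If [f] vanishes, the remainder is minus the leading wave. The alternating sum kills the
    remainder, whereas all its terms agree on a wave of frequency [n + 1]; hence the wave vanishes
    at every [t]. *)
Lemma lead_zero n z f : lead n z f -> (forall t, f t = 0) -> z = 0%C.
Proof.
intros (g & Hg & E) Z.
assert (Hn : 0 < INR (S n)) by apply lt_0_INR, Nat.lt_0_succ.
assert (W : forall t, wave (S n) z t = 0).
{ intros t.
  assert (S0 := alternating_sum_trig n g t Hg).
  assert (S1 : alternating_sum n g t (2 * n + 1)
               = sum_f_R0 (fun _ => - wave (S n) z t) (2 * n + 1)).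
  { apply sum_eq; intros j _.
    assert (E' := E (t + INR j * (PI / INR (S n)))).
    rewrite Z, wave_half_period in E'.
    replace (g (t + INR j * (PI / INR (S n)))) with (- ((-1) ^ j * wave (S n) z t)) by lra.
    replace ((-1) ^ j * - ((-1) ^ j * wave (S n) z t))
      with (- (((-1) ^ j * (-1) ^ j) * wave (S n) z t)) by ring.
    rewrite <- pow_add. replace (j + j)%nat with (2 * j)%nat by lia.
    rewrite pow_1_even; ring. }
  rewrite S0, sum_cte in S1.
  assert (0 < INR (S (2 * n + 1))) by apply lt_0_INR, Nat.lt_0_succ. nra. }
(* The value at 0 reads off the real part, the value at a quarter of the period of frequency [n + 1]
   the imaginary part. *)
apply injective_projections; simpl.
- specialize (W 0); unfold wave, Re, Im in W.
  rewrite Rmult_0_r, cos_0, sin_0 in W; lra.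
- specialize (W (PI / 2 / INR (S n))); unfold wave, Re, Im in W.
  replace (INR (S n) * (PI / 2 / INR (S n))) with (PI / 2) in W by (field; lra).
  rewrite cos_PI2, sin_PI2 in W; lra.
Qed.

Lemma trig_S_lead n f : trig (S n) f -> exists z, lead n z f.
Proof.
induction 1 as [k z Hk|f g _ [z Hz] _ [w Hw]|f g _ [z Hz] E].
- destruct (Nat.eq_dec k (S n)) as [->|Hn].
  + exists z, (fun _ => 0); split; [apply trig_const|intros; cbv beta; ring].
  + exists 0%C; apply trig_lead, trig_wave; lia.
- exists (z + w)%C; now apply lead_plus.
- exists z; now apply lead_ext with z f.
Qed.

Lemma trig_0_const f : trig 0 f -> exists a, forall t, f t = a.
Proof.
induction 1 as [k z Hk|f g _ [a Ha] _ [b Hb]|f g _ [a Ha] E].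
- exists (Re z); intros t. replace k with 0%nat by lia.
  unfold wave; simpl; rewrite Rmult_0_l, cos_0, sin_0; ring.
- exists (a + b); intros; now rewrite Ha, Hb.
- exists a; intros; now rewrite <- E.
Qed.

Lemma trig_const_or_lead n f :
  trig n f -> (exists a, forall t, f t = a) \/ (exists k (z : C), z <> RtoC 0 /\ lead k z f).
Proof.
revert f; induction n as [|n IH]; intros f H.
- left; now apply trig_0_const.
- destruct (trig_S_lead _ _ H) as [z Hz].
  destruct (Ceq_dec z 0) as [->|Nz].
  + apply IH. destruct Hz as (g & Hg & E). apply trig_ext with g; [assumption|].
    intros t; rewrite E; unfold wave; simpl; ring.
  + right; now exists n, z.
Qed.

(** A nonzero trigonometric polynomial is a nonzero constant or has a nonzero leading coefficient,
    and these multiply to a nonzero number. *)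
Lemma trig_integral n m f g :
  trig n f -> trig m g -> (forall t, f t * g t = 0) ->
  (forall t, f t = 0) \/ (forall t, g t = 0).
Proof.
intros Hf Hg Z.
destruct (trig_const_or_lead _ _ Hf) as [[a Ha]|(k & z & Nz & Lf)].
{ destruct (Req_dec a 0) as [->|Na]; [now left|right; intros t].
  specialize (Z t); rewrite Ha in Z; apply Rmult_integral in Z; tauto. }
destruct (trig_const_or_lead _ _ Hg) as [[a Ha]|(l & w & Nw & Lg)].
{ destruct (Req_dec a 0) as [->|Na]; [now right|left; intros t].
  specialize (Z t); rewrite Ha in Z; apply Rmult_integral in Z; tauto. }
exfalso.
assert (zw := lead_zero _ _ _ (lead_mult _ _ _ _ _ _ Lf Lg) Z).
assert (H : (z * w)%C = RtoC 0).
{ replace (z * w)%C with (2 * (z * w / 2))%C.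
  - rewrite zw; ring.
  - now field. }
now apply (Cmult_neq_0 z w).
Qed.

(** * The anisotropic mean curvature of a parametrized surface *)

Lemma R3_plusE (u v : R3) : plus u v = (px u + px v, py u + py v, pz u + pz v) :> R3.
Proof. reflexivity. Qed.
Lemma R3_oppE (u : R3) : opp u = (- px u, - py u, - pz u) :> R3.
Proof. reflexivity. Qed.
Lemma R3_scalE (k : R) (u : R3) : scal k u = (k * px u, k * py u, k * pz u) :> R3.
Proof. reflexivity. Qed.

Definition is_derive3 (c : R -> R3) (x : R) (v : R3) : Prop :=
  is_derive (fun y => px (c y)) x (px v) /\ is_derive (fun y => py (c y)) x (py v) /\
  is_derive (fun y => pz (c y)) x (pz v).

Lemma R3_ext (u v : R3) : px u = px v -> py u = py v -> pz u = pz v -> u = v.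
Proof. destruct u as [[? ?] ?], v as [[? ?] ?]; unfold px, py, pz; simpl; congruence. Qed.

Lemma is_derive3_unique (c : R -> R3) (x : R) (v : R3) : is_derive3 c x v -> Derive_R3 c x = v.
Proof.
intros (Hx & Hy & Hz); apply R3_ext; unfold Derive_R3, px, py, pz; simpl;
  now apply is_derive_unique.
Qed.

Lemma is_derive3_ext_loc (c d : R -> R3) (x : R) (v : R3) :
  locally x (fun y => c y = d y) -> is_derive3 c x v -> is_derive3 d x v.
Proof.
intros L (Hx & Hy & Hz).
assert (P : forall p : R3 -> R, locally x (fun y => p (c y) = p (d y))).
{ intros p; apply filter_imp with (2 := L); intros y E; now rewrite E. }
split; [|split].
- now apply is_derive_ext_loc with (1 := P px).
- now apply is_derive_ext_loc with (1 := P py).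
- now apply is_derive_ext_loc with (1 := P pz).
Qed.

Lemma is_derive3_cross (c d : R -> R3) (x : R) (u v : R3) :
  is_derive3 c x u -> is_derive3 d x v ->
  is_derive3 (fun y => cross (c y) (d y)) x (plus (cross u (d x)) (cross (c x) v)).
Proof.
assert (P : forall (f g k l : R -> R) (f' g' k' l' w : R),
  is_derive f x f' -> is_derive g x g' -> is_derive k x k' -> is_derive l x l' ->
  w = f' * g x - k' * l x + (f x * g' - k x * l') ->
  is_derive (fun y => f y * g y - k y * l y) x w).
{ intros f g k l f' g' k' l' w Hf Hg Hk Hl ->.
  auto_derive; [repeat split; eexists; eassumption|].
  rewrite (is_derive_unique (fun y : R => f y) _ _ Hf), (is_derive_unique (fun y : R => g y) _ _ Hg),
    (is_derive_unique (fun y : R => k y) _ _ Hk), (is_derive_unique (fun y : R => l y) _ _ Hl); ring. }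
intros (Hx & Hy & Hz) (Kx & Ky & Kz).
split; [|split].
- now apply (P _ _ _ _ _ _ _ _ _ Hy Kz Hz Ky).
- now apply (P _ _ _ _ _ _ _ _ _ Hz Kx Hx Kz).
- now apply (P _ _ _ _ _ _ _ _ _ Hx Ky Hy Kx).
Qed.

(** At a unit vector the Euclidean gradient is vertical, [- (1 / nu_3^2 + 1)], and its tangential
    part is unchanged under [nu -> - nu] in the vertical component and odd in the horizontal ones
    only through the ratios with [nu_3]. The norm of [n] therefore enters only through its square,
    and what remains to be differentiated is a rational expression. *)
Lemma sphere_gradient_dirichlet (n : R3) :
  dot n n <> 0 -> pz n <> 0 ->
  sphere_gradient dirichlet_density (scal (/ enorm n) n) =
  (px n / pz n + px n * pz n / dot n n, py n / pz n + py n * pz n / dot n n,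
   pz n ^ 2 / dot n n - dot n n / pz n ^ 2).
Proof.
intros Hn Hz; rewrite R3_scalE; unfold sphere_gradient, gradient, enorm.
destruct n as [[x y] z]; unfold minus; rewrite R3_plusE, R3_oppE, R3_scalE.
unfold dirichlet_density, dot, px, py, pz in *; cbn [fst snd] in *.
set (q := x * x + y * y + z * z) in *.
assert (Hq : 0 < q) by (unfold q; nra).
assert (Hw := sqrt_sqrt q (Rlt_le _ _ Hq)).
assert (Hw0 := sqrt_lt_R0 q Hq).
set (w := sqrt q) in *.
rewrite !Derive_const.
replace (Derive (fun z0 : R => / z0 - z0) (/ w * z)) with (- / (/ w * z) ^ 2 - 1).
2:{ symmetry; apply is_derive_unique.
    assert (/ w * z <> 0) by (apply Rmult_integral_contrapositive; split; [apply Rinv_neq_0_compat; lra|assumption]).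
    auto_derive; [assumption|field; split; lra]. }
apply R3_ext; unfold px, py, pz; cbn [fst snd]; rewrite <- Hw; field; split; lra.
Qed.

(** With [q = N.N] the field is [(1 / N_z + N_z / q) N - (q / N_z^2 + 1) e_z]. Against a vector [T]
    orthogonal to [N], the derivative of the first factor drops out; the last term of the formula is
    the derivative of [- q / N_z^2] times the height of [T]. *)
Lemma is_derive3_sphere_gradient (N : R -> R3) (x : R) (N' : R3) :
  is_derive3 N x N' -> pz (N x) <> 0 ->
  exists V', is_derive3 (fun y => sphere_gradient dirichlet_density (scal (/ enorm (N y)) (N y))) x V' /\
    forall T, dot T (N x) = 0 ->
      dot V' T = dot N' T * (/ pz (N x) + pz (N x) / dot (N x) (N x))
        + 2 / pz (N x) ^ 3 * (dot (N x) (N x) * pz N' - pz (N x) * dot (N x) N') * pz T.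
Proof.
intros (Hx & Hy & Hz) Nz.
set (q' := 2 * dot (N x) N').
assert (Q : 0 < dot (N x) (N x)) by (unfold dot; nra).
assert (Hq : is_derive (fun y => dot (N y) (N y)) x q').
{ assert (P : forall (f g h : R -> R) (f' g' h' : R),
    is_derive f x f' -> is_derive g x g' -> is_derive h x h' ->
    is_derive (fun y => f y * f y + g y * g y + h y * h y) x
      (2 * (f x * f' + g x * g' + h x * h'))).
  { clear; intros f g h f' g' h' Hf Hg Hh.
    auto_derive; [repeat split; eexists; eassumption|].
    rewrite (is_derive_unique (fun y : R => f y) _ _ Hf), (is_derive_unique (fun y : R => g y) _ _ Hg),
      (is_derive_unique (fun y : R => h y) _ _ Hh); ring. }
  exact (P _ _ _ _ _ _ Hx Hy Hz). }
assert (P : forall (f h q : R -> R) (f' h' q' : R),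
  is_derive f x f' -> is_derive h x h' -> is_derive q x q' -> h x <> 0 -> q x <> 0 ->
  is_derive (fun y => f y / h y + f y * h y / q y) x
    (f' / h x - f x * h' / h x ^ 2 + (f' * h x + f x * h') / q x - f x * h x * q' / q x ^ 2)).
{ clear; intros f h q f' h' q' Hf Hh Hq h0 q0.
  auto_derive; [repeat split; try assumption; eexists; eassumption|].
  rewrite (is_derive_unique (fun y : R => f y) _ _ Hf), (is_derive_unique (fun y : R => h y) _ _ Hh),
    (is_derive_unique (fun y : R => q y) _ _ Hq); field; tauto. }
assert (P' : forall (h q : R -> R) (h' q' : R),
  is_derive h x h' -> is_derive q x q' -> h x <> 0 -> q x <> 0 ->
  is_derive (fun y => h y ^ 2 / q y - q y / h y ^ 2) x
    (2 * h x * h' / q x - h x ^ 2 * q' / q x ^ 2 - q' / h x ^ 2 + 2 * q x * h' / h x ^ 3)).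
{ clear; intros h q h' q' Hh Hq h0 q0.
  assert (h x * (h x * 1) <> 0) by nra.
  auto_derive; [repeat split; try assumption; eexists; eassumption|].
  rewrite (is_derive_unique (fun y : R => h y) _ _ Hh),
    (is_derive_unique (fun y : R => q y) _ _ Hq); field; tauto. }
assert (q0 : dot (N x) (N x) <> 0) by lra.
eexists (_, _, _); split.
- eapply is_derive3_ext_loc with
    (c := fun y => (px (N y) / pz (N y) + px (N y) * pz (N y) / dot (N y) (N y),
                    py (N y) / pz (N y) + py (N y) * pz (N y) / dot (N y) (N y),
                    pz (N y) ^ 2 / dot (N y) (N y) - dot (N y) (N y) / pz (N y) ^ 2)).
  + assert (Ch : continuous (fun y => pz (N y)) x)
      by (apply (ex_derive_continuous (fun y => pz (N y))); eexists; exact Hz).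
    assert (L : locally x (fun y => pz (N y) <> 0)) by exact (Ch (fun v => v <> 0) (open_neq 0 _ Nz)).
    eapply filter_imp; [|exact L]; intros y Hy'; cbv beta.
    symmetry; apply sphere_gradient_dirichlet; [unfold dot; nra|exact Hy'].
  + split; [|split].
    * exact (P _ _ _ _ _ _ Hx Hz Hq Nz q0).
    * exact (P _ _ _ _ _ _ Hy Hz Hq Nz q0).
    * exact (P' _ _ _ _ Hz Hq Nz q0).
- intros T HT; unfold q', dot in *; clear - HT q0 Nz.
  destruct T as [[t1 t2] t3], N' as [[n1 n2] n3], (N x) as [[x1 x2] x3].
  unfold px, py, pz in *; cbn [fst snd] in *.
  replace t3 with (- (t1 * x1 + t2 * x2) / x3) by (field_simplify_eq; lra).
  field; tauto.
Qed.

Definition hdot (u v : R3) : R := px u * px v + py u * py v.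

(* [cross Xs Xt] is not normalized, and the metric is that of the horizontal projection, so up to
   a factor this is the Laplacian of the height of the surface seen as a graph. *)
Definition flat_trace (Xs Xt Xss Xst Xtt : R3) : R :=
  hdot Xt Xt * dot (cross Xs Xt) Xss - 2 * hdot Xs Xt * dot (cross Xs Xt) Xst
  + hdot Xs Xs * dot (cross Xs Xt) Xtt.

Lemma px_plus (u v : R3) : px (plus u v) = px u + px v. Proof. reflexivity. Qed.
Lemma px_opp (u : R3) : px (opp u) = - px u. Proof. reflexivity. Qed.
Lemma px_minus (u v : R3) : px (minus u v) = px u - px v. Proof. reflexivity. Qed.
Lemma px_scal (k : R) (u : R3) : px (scal k u) = k * px u. Proof. reflexivity. Qed.
Lemma px_zero : px zero = 0. Proof. reflexivity. Qed.
Lemma py_plus (u v : R3) : py (plus u v) = py u + py v. Proof. reflexivity. Qed.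
Lemma py_opp (u : R3) : py (opp u) = - py u. Proof. reflexivity. Qed.
Lemma py_minus (u v : R3) : py (minus u v) = py u - py v. Proof. reflexivity. Qed.
Lemma py_scal (k : R) (u : R3) : py (scal k u) = k * py u. Proof. reflexivity. Qed.
Lemma py_zero : py zero = 0. Proof. reflexivity. Qed.
Lemma pz_plus (u v : R3) : pz (plus u v) = pz u + pz v. Proof. reflexivity. Qed.
Lemma pz_opp (u : R3) : pz (opp u) = - pz u. Proof. reflexivity. Qed.
Lemma pz_minus (u v : R3) : pz (minus u v) = pz u - pz v. Proof. reflexivity. Qed.
Lemma pz_scal (k : R) (u : R3) : pz (scal k u) = k * pz u. Proof. reflexivity. Qed.
Lemma pz_zero : pz zero = 0. Proof. reflexivity. Qed.
Lemma px_cross u v : px (cross u v) = py u * pz v - pz u * py v. Proof. reflexivity. Qed.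
Lemma py_cross u v : py (cross u v) = pz u * px v - px u * pz v. Proof. reflexivity. Qed.
Lemma pz_cross u v : pz (cross u v) = px u * py v - py u * px v. Proof. reflexivity. Qed.
#[local] Hint Rewrite px_plus px_opp px_minus px_scal px_zero px_cross py_plus py_opp py_minus py_scal py_zero py_cross pz_plus pz_opp pz_minus pz_scal pz_zero pz_cross : r3.

Ltac r3_ring := intros; unfold hdot, dot; cbv beta; autorewrite with r3; ring.

Lemma dot_comm u v : dot u v = dot v u.
Proof. r3_ring. Qed.

Lemma dot_scal_r k u v : dot u (scal k v) = k * dot u v.
Proof. r3_ring. Qed.

Lemma dot_cross_l u v : dot u (cross u v) = 0.
Proof. r3_ring. Qed.

Lemma dot_cross_r u v : dot v (cross u v) = 0.
Proof. r3_ring. Qed.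

(** Weingarten equations for the unnormalized normal [u x w]: [a] and [b] stand for the derivatives
    of [u] and [w] in one direction, and the first summand of the pairing is the derivative of the
    normal in that direction. *)
Lemma dot_weingarten_l u w a b :
  dot (plus (cross a w) (cross u b)) u = - dot (cross u w) a.
Proof. r3_ring. Qed.

Lemma dot_weingarten_r u w a b :
  dot (plus (cross a w) (cross u b)) w = - dot (cross u w) b.
Proof. r3_ring. Qed.

(** The left side is [n.n] times the height of the tangential part of the derivative of [n]. Since
    [n.n] is the determinant of the metric, expanding that part in the basis [u], [w] with the
    inverse metric leaves no denominator. *)
Lemma pz_weingarten u w a b :
  let n := cross u w in
  dot n n * pz (plus (cross a w) (cross u b)) - pz n * dot n (plus (cross a w) (cross u b)) =
  - (dot n a * (dot w w * pz u - dot u w * pz w) + dot n b * (dot u u * pz w - dot u w * pz u)).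
Proof. cbv zeta; r3_ring. Qed.

(** Here [w] is the norm of the normal, [h] its height, [zs] and [zt] the heights of the tangent
    vectors, and [e], [f], [g] are taken against the unnormalized normal. The hypothesis on [h] says
    that the squared horizontal part of the normal is the squared surface gradient of the height
    times the determinant of the metric. The coefficients [G - zt^2] and its analogues are those of
    [dx^2 + dy^2]. *)
Lemma dirichlet_curvature_algebra (w E F G e f g zs zt h : R) :
  w <> 0 -> h <> 0 -> w ^ 2 = E * G - F ^ 2 ->
  h ^ 2 = w ^ 2 - (G * zs ^ 2 - 2 * F * zs * zt + E * zt ^ 2) ->
  let k := / h + h / (w ^ 2) in
  let a := - (e * (G * zs - F * zt) + f * (E * zt - F * zs)) in
  let b := - (f * (G * zs - F * zt) + g * (E * zt - F * zs)) in
  2 * ((/ w * e * G - 2 * (/ w * f) * F + / w * g * E) / (2 * (E * G - F ^ 2))) * (/ (/ w * h) - / w * h)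
  - (G * (- e * k + 2 / h ^ 3 * a * zs)
     - F * ((- f * k + 2 / h ^ 3 * a * zt) + (- f * k + 2 / h ^ 3 * b * zs))
     + E * (- g * k + 2 / h ^ 3 * b * zt)) / (E * G - F ^ 2)
  = 2 * ((G - zt ^ 2) * e - 2 * (F - zs * zt) * f + (E - zs ^ 2) * g) / h ^ 3.
Proof.
intros Hw Hh W H k a b.
rewrite <- W.
(* The trace for the induced metric, corrected by the terms along the gradient of the height, is the
   trace for the horizontal metric; this is the inversion of the metric minus [dz^2]. *)
assert (K : h ^ 2 * (e * G - 2 * f * F + g * E) + (- a * (G * zs - F * zt) - b * (E * zt - F * zs))
  = w ^ 2 * ((G - zt ^ 2) * e - 2 * (F - zs * zt) * f + (E - zs ^ 2) * g)).
{ rewrite H, W; unfold a, b; ring. }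
replace ((G - zt ^ 2) * e - 2 * (F - zs * zt) * f + (E - zs ^ 2) * g)
  with ((h ^ 2 * (e * G - 2 * f * F + g * E) + (- a * (G * zs - F * zt) - b * (E * zt - F * zs))) / w ^ 2)
  by (rewrite K; field; assumption).
unfold k; clearbody a b; field; tauto.
Qed.

(** [U] and [W] are explicit formulas for the partial derivatives. In the direction of [s] they need
    to hold only near the point, since a family of circles is controlled only over the open set [I];
    the common [Xst] expresses the symmetry of the mixed derivatives. *)
Lemma anisotropic_mean_curvature_dirichlet (X U W : R -> R -> R3) (s t : R) (Xss Xst Xtt : R3) :
  (forall y, d_s X s y = U s y) -> (forall y, d_t X s y = W s y) ->
  locally s (fun x => d_s X x t = U x t /\ d_t X x t = W x t) ->
  is_derive3 (fun x => U x t) s Xss -> is_derive3 (U s) t Xst ->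
  is_derive3 (fun x => W x t) s Xst -> is_derive3 (W s) t Xtt ->
  pz (cross (U s t) (W s t)) <> 0 ->
  anisotropic_mean_curvature dirichlet_density X s t
  = 2 * flat_trace (U s t) (W s t) Xss Xst Xtt / pz (cross (U s t) (W s t)) ^ 3.
Proof.
intros EU EW L Dss Dst Dts Dtt Nz.
set (N := fun x y => cross (U x y) (W x y)).
assert (Ess : d_s (d_s X) s t = Xss).
{ apply is_derive3_unique, (is_derive3_ext_loc (fun x => U x t)); [|assumption].
  apply filter_imp with (2 := L); intros x [E _]; now symmetry. }
assert (Est : d_t (d_s X) s t = Xst).
{ apply is_derive3_unique, (is_derive3_ext_loc (U s)); [|assumption].
  apply filter_forall; intros x; now symmetry. }
assert (Ett : d_t (d_t X) s t = Xtt).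
{ apply is_derive3_unique, (is_derive3_ext_loc (W s)); [|assumption].
  apply filter_forall; intros x; now symmetry. }
assert (Ns := is_derive3_cross _ _ _ _ _ Dss Dts).
assert (Nt := is_derive3_cross _ _ _ _ _ Dst Dtt).
destruct (is_derive3_sphere_gradient (fun x => N x t) s _ Ns Nz) as (Vs & HVs & Fs).
destruct (is_derive3_sphere_gradient (N s) t _ Nt Nz) as (Vt & HVt & Ft).
assert (EN : forall y, normal_field X s y = N s y).
{ intros y; unfold normal_field, N; now rewrite EU, EW. }
assert (Es : d_s (fun s t => sphere_gradient dirichlet_density (unit_normal X s t)) s t = Vs).
{ apply is_derive3_unique; revert HVs; apply is_derive3_ext_loc.
  apply filter_imp with (2 := L); intros x [E E'].
  unfold unit_normal, normal_field, N; now rewrite E, E'. }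
assert (Et : d_t (fun s t => sphere_gradient dirichlet_density (unit_normal X s t)) s t = Vt).
{ apply is_derive3_unique; revert HVt; apply is_derive3_ext_loc.
  apply filter_forall; intros x; unfold unit_normal; now rewrite EN. }
unfold anisotropic_mean_curvature, mean_curvature, surface_div.
rewrite Es, Et.
unfold sf_e, sf_f, sf_g, ff_E, ff_F, ff_G.
rewrite Ess, Est, Ett, EU, EW; unfold unit_normal; rewrite EN.
rewrite Fs, Fs, Ft, Ft; try (unfold N; apply dot_cross_l || apply dot_cross_r).
rewrite !dot_scal_r; unfold N at 1 2 3 4.
unfold N in *; clear - Nz.
set (n := cross (U s t) (W s t)) in *.
assert (q0 : 0 < dot n n) by (unfold dot; nra).
unfold dirichlet_density.
replace (pz (scal (/ enorm n) n)) with (/ enorm n * pz n) by reflexivity.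
assert (w0 : 0 < enorm n) by now apply sqrt_lt_R0.
assert (w2 : enorm n ^ 2 = dot n n) by (apply pow2_sqrt; lra).
assert (A := dirichlet_curvature_algebra (enorm n) (dot (U s t) (U s t)) (dot (U s t) (W s t))
  (dot (W s t) (W s t)) (dot n Xss) (dot n Xst) (dot n Xtt) (pz (U s t)) (pz (W s t)) (pz n)).
rewrite w2 in A; cbv zeta in A.
unfold flat_trace; fold n.
replace (hdot (W s t) (W s t)) with (dot (W s t) (W s t) - pz (W s t) ^ 2) by r3_ring.
replace (hdot (U s t) (W s t)) with (dot (U s t) (W s t) - pz (U s t) * pz (W s t)) by r3_ring.
replace (hdot (U s t) (U s t)) with (dot (U s t) (U s t) - pz (U s t) ^ 2) by r3_ring.
rewrite <- A; clear A; try lra; try (unfold n; r3_ring).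
rewrite !(dot_comm _ n).
unfold n; rewrite !dot_weingarten_l, !dot_weingarten_r.
now rewrite (pz_weingarten _ _ Xss Xst), (pz_weingarten _ _ Xst Xtt).
Qed.

(** * Families of circles *)

Lemma is_derive_cst (a x : R) : is_derive (fun _ => a) x 0.
Proof. apply (is_derive_const (V := R_NormedModule)). Qed.

Lemma is_derive3_const (v : R3) (x : R) : is_derive3 (fun _ => v) x zero.
Proof. split; [|split]; apply is_derive_cst. Qed.

Lemma is_derive3_plus (c d : R -> R3) (x : R) (u v : R3) :
  is_derive3 c x u -> is_derive3 d x v -> is_derive3 (fun y => plus (c y) (d y)) x (plus u v).
Proof.
intros (Hx & Hy & Hz) (Kx & Ky & Kz); split; [|split].
- exact (is_derive_plus (V := R_NormedModule) _ _ _ _ _ Hx Kx).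
- exact (is_derive_plus (V := R_NormedModule) _ _ _ _ _ Hy Ky).
- exact (is_derive_plus (V := R_NormedModule) _ _ _ _ _ Hz Kz).
Qed.

Lemma is_derive3_scal (f : R -> R) (c : R -> R3) (x f' : R) (v : R3) :
  is_derive f x f' -> is_derive3 c x v ->
  is_derive3 (fun y => scal (f y) (c y)) x (plus (scal f' (c x)) (scal (f x) v)).
Proof.
intros Hf (Hx & Hy & Hz).
assert (P : forall (g : R -> R) (g' : R), is_derive g x g' ->
  is_derive (fun y => f y * g y) x (f' * g x + f x * g')).
{ intros g g' Hg. exact (is_derive_mult (K := R_AbsRing) _ _ _ _ _ Hf Hg Rmult_comm). }
split; [|split].
- exact (P _ _ Hx).
- exact (P _ _ Hy).
- exact (P _ _ Hz).
Qed.

Lemma smooth_on_derive (I : R -> Prop) (f : R -> R) n s :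
  smooth_on I f -> I s -> is_derive (Derive_n f n) s (Derive_n f (S n) s).
Proof. intros H Hs; apply Derive_correct, (H (S n) s Hs). Qed.

Definition D3 (c : R -> R3) (n : nat) (s : R) : R3 :=
  (Derive_n (fun x => px (c x)) n s, Derive_n (fun x => py (c x)) n s,
   Derive_n (fun x => pz (c x)) n s).

Lemma D3_0 c s : D3 c 0 s = c s.
Proof. unfold D3; simpl; now destruct (c s) as [[? ?] ?]. Qed.

Lemma smooth_curve_derive (I : R -> Prop) (c : R -> R3) n s :
  smooth_curve_on I c -> I s -> is_derive3 (D3 c n) s (D3 c (S n) s).
Proof.
intros (Hx & Hy & Hz) Hs; split; [|split].
- exact (smooth_on_derive I _ n s Hx Hs).
- exact (smooth_on_derive I _ n s Hy Hs).
- exact (smooth_on_derive I _ n s Hz Hs).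
Qed.

Lemma smooth_curve_derive_0 (I : R -> Prop) (c : R -> R3) s :
  smooth_curve_on I c -> I s -> is_derive3 c s (D3 c 1 s).
Proof.
intros Hc Hs; apply (is_derive3_ext_loc (D3 c 0)).
- apply filter_forall; intros; apply D3_0.
- now apply smooth_curve_derive with I.
Qed.

Definition lin (a b : R3) (t : R) : R3 := plus (scal (cos t) a) (scal (sin t) b).

Lemma is_derive3_lin_t a b t : is_derive3 (lin a b) t (lin b (opp a) t).
Proof.
replace (lin b (opp a) t) with
  (plus (plus (scal (- sin t) a) (scal (cos t) (zero : R3)))
        (plus (scal (cos t) b) (scal (sin t) (zero : R3)))).
- apply is_derive3_plus; apply is_derive3_scal; try apply is_derive3_const.
  + apply is_derive_cos.
  + apply is_derive_sin.
- unfold lin; apply R3_ext; r3_ring.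
Qed.

Lemma is_derive3_lin (a b : R -> R3) (s : R) (a' b' : R3) t :
  is_derive3 a s a' -> is_derive3 b s b' ->
  is_derive3 (fun x => lin (a x) (b x) t) s (lin a' b' t).
Proof.
intros Ha Hb.
replace (lin a' b' t) with
  (plus (plus (scal 0 (a s)) (scal (cos t) a')) (plus (scal 0 (b s)) (scal (sin t) b'))).
- apply is_derive3_plus.
  + apply (is_derive3_scal (fun _ => cos t)); [apply is_derive_cst|assumption].
  + apply (is_derive3_scal (fun _ => sin t)); [apply is_derive_cst|assumption].
- unfold lin; apply R3_ext; r3_ring.
Qed.

Lemma is_derive3_eq c x u v : is_derive3 c x u -> u = v -> is_derive3 c x v.
Proof. now intros H <-. Qed.

Section Circles.

Variables (C e1 e2 : R -> R3) (r : R -> R).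

Definition circ_s (s t : R) : R3 :=
  plus (D3 C 1 s) (plus (scal (Derive_n r 1 s) (lin (e1 s) (e2 s) t))
    (scal (r s) (lin (D3 e1 1 s) (D3 e2 1 s) t))).
Definition circ_t (s t : R) : R3 := scal (r s) (lin (e2 s) (opp (e1 s)) t).
Definition circ_ss (s t : R) : R3 :=
  plus (D3 C 2 s) (plus (scal (Derive_n r 2 s) (lin (e1 s) (e2 s) t))
    (plus (scal (2 * Derive_n r 1 s) (lin (D3 e1 1 s) (D3 e2 1 s) t))
      (scal (r s) (lin (D3 e1 2 s) (D3 e2 2 s) t)))).
Definition circ_st (s t : R) : R3 :=
  plus (scal (Derive_n r 1 s) (lin (e2 s) (opp (e1 s)) t))
    (scal (r s) (lin (D3 e2 1 s) (opp (D3 e1 1 s)) t)).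
Definition circ_tt (s t : R) : R3 := scal (r s) (lin (opp (e1 s)) (opp (e2 s)) t).

Definition circ_normal (s t : R) : R3 := cross (circ_s s t) (circ_t s t).
Definition circ_flat_trace (s t : R) : R :=
  flat_trace (circ_s s t) (circ_t s t) (circ_ss s t) (circ_st s t) (circ_tt s t).

Variable I : R -> Prop.
Hypotheses (HC : smooth_curve_on I C) (H1 : smooth_curve_on I e1) (H2 : smooth_curve_on I e2)
  (Hr : smooth_on I r).

Lemma is_derive3_circles_s s t : I s -> is_derive3 (fun x => circles C e1 e2 r x t) s (circ_s s t).
Proof.
intros Hs; unfold circles, circ_s.
assert (Z := fun c Hc => smooth_curve_derive_0 I c s Hc Hs).
apply is_derive3_plus; [now apply Z|].
apply (is_derive3_scal r (fun x => lin (e1 x) (e2 x) t)).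
- exact (smooth_on_derive I r 0 s Hr Hs).
- apply is_derive3_lin; now apply Z.
Qed.

Lemma is_derive3_circles_t s t : is_derive3 (circles C e1 e2 r s) t (circ_t s t).
Proof.
unfold circles, circ_t.
replace (scal (r s) (lin (e2 s) (opp (e1 s)) t)) with
  (plus (zero : R3) (plus (scal 0 (lin (e1 s) (e2 s) t)) (scal (r s) (lin (e2 s) (opp (e1 s)) t))))
  by (apply R3_ext; unfold lin; r3_ring).
apply is_derive3_plus; [apply is_derive3_const|].
apply (is_derive3_scal (fun _ => r s) (lin (e1 s) (e2 s))).
- apply is_derive_cst.
- apply is_derive3_lin_t.
Qed.

Lemma is_derive3_circ_s_s s t : I s -> is_derive3 (fun x => circ_s x t) s (circ_ss s t).
Proof.
intros Hs; unfold circ_s, circ_ss.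
assert (Z := fun c Hc => smooth_curve_derive_0 I c s Hc Hs).
assert (Z' := fun c Hc => smooth_curve_derive I c 1 s Hc Hs).
apply is_derive3_plus; [now apply Z'|].
eapply is_derive3_eq.
- apply is_derive3_plus.
  + apply (is_derive3_scal (Derive_n r 1) (fun x => lin (e1 x) (e2 x) t)).
    * exact (smooth_on_derive I r 1 s Hr Hs).
    * apply is_derive3_lin; now apply Z.
  + apply (is_derive3_scal r (fun x => lin (D3 e1 1 x) (D3 e2 1 x) t)).
    * exact (smooth_on_derive I r 0 s Hr Hs).
    * apply is_derive3_lin; now apply Z'.
- cbv beta. generalize (lin (e1 s) (e2 s) t) (lin (D3 e1 1 s) (D3 e2 1 s) t)
    (lin (D3 e1 2 s) (D3 e2 2 s) t).
  change (Derive_n r 0 s) with (r s).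
  intros u v w; apply R3_ext; r3_ring.
Qed.

Lemma is_derive3_circ_s_t s t : is_derive3 (circ_s s) t (circ_st s t).
Proof.
unfold circ_s, circ_st.
eapply is_derive3_eq.
- apply is_derive3_plus; [apply is_derive3_const|].
  apply is_derive3_plus.
  + apply (is_derive3_scal (fun _ => Derive_n r 1 s)).
    * apply is_derive_cst.
    * apply is_derive3_lin_t.
  + apply (is_derive3_scal (fun _ => r s)).
    * apply is_derive_cst.
    * apply is_derive3_lin_t.
- generalize (D3 e1 1 s) (D3 e2 1 s) (e1 s) (e2 s) (r s) (Derive_n r 1 s); intros.
  apply R3_ext; unfold lin; r3_ring.
Qed.

Lemma is_derive3_circ_t_s s t : I s -> is_derive3 (fun x => circ_t x t) s (circ_st s t).
Proof.
intros Hs; unfold circ_t, circ_st.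
assert (Z := fun c Hc => smooth_curve_derive_0 I c s Hc Hs).
apply (is_derive3_scal r (fun x => lin (e2 x) (opp (e1 x)) t)).
- exact (smooth_on_derive I r 0 s Hr Hs).
- apply (is_derive3_lin e2 (fun x => opp (e1 x))); [now apply Z|].
  destruct (Z e1 H1) as (Hx & Hy & Hz); split; [|split].
  + exact (is_derive_opp (V := R_NormedModule) _ _ _ Hx).
  + exact (is_derive_opp (V := R_NormedModule) _ _ _ Hy).
  + exact (is_derive_opp (V := R_NormedModule) _ _ _ Hz).
Qed.

Lemma is_derive3_circ_t_t s t : is_derive3 (circ_t s) t (circ_tt s t).
Proof.
unfold circ_t, circ_tt.
eapply is_derive3_eq.
- apply (is_derive3_scal (fun _ => r s)).
  + apply is_derive_cst.
  + apply is_derive3_lin_t.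
- generalize (e1 s) (e2 s) (r s); intros; apply R3_ext; unfold lin; r3_ring.
Qed.

Lemma d_s_circles s t : I s -> d_s (circles C e1 e2 r) s t = circ_s s t.
Proof. intros Hs; now apply is_derive3_unique, is_derive3_circles_s. Qed.

Lemma d_t_circles s t : d_t (circles C e1 e2 r) s t = circ_t s t.
Proof. apply is_derive3_unique, is_derive3_circles_t. Qed.

Lemma normal_field_circles s t :
  I s -> normal_field (circles C e1 e2 r) s t = circ_normal s t.
Proof. intros Hs; unfold normal_field; now rewrite d_s_circles, d_t_circles. Qed.

Lemma minimal_circ_flat_trace s t :
  open I -> dirichlet_minimal_on I (circles C e1 e2 r) -> I s ->
  pz (circ_normal s t) * circ_flat_trace s t = 0.
Proof.
intros Io [_ Hm] Hs.
destruct (Req_dec (pz (circ_normal s t)) 0) as [->|Nz]; [ring|].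
assert (M := Hm s t Hs).
rewrite (anisotropic_mean_curvature_dirichlet _ circ_s circ_t s t
  (circ_ss s t) (circ_st s t) (circ_tt s t)) in M.
- fold (circ_normal s t) in M; fold (circ_flat_trace s t) in M.
  assert (M' : 2 * circ_flat_trace s t / pz (circ_normal s t) ^ 3 = 0).
  { apply M. unfold unit_normal; rewrite normal_field_circles by assumption.
    change (/ enorm (circ_normal s t) * pz (circ_normal s t) <> 0).
    apply Rmult_integral_contrapositive; split; [|assumption].
    apply Rinv_neq_0_compat, Rgt_not_eq, sqrt_lt_R0; unfold dot; nra. }
  replace (circ_flat_trace s t) with
    (2 * circ_flat_trace s t / pz (circ_normal s t) ^ 3 * pz (circ_normal s t) ^ 3 / 2)
    by now field.
  rewrite M'; field.
- intros; now apply d_s_circles.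
- intros; now apply d_t_circles.
- apply filter_imp with (2 := Io s Hs); intros x Hx; split;
    [now apply d_s_circles|now apply d_t_circles].
- now apply is_derive3_circ_s_s.
- apply is_derive3_circ_s_t.
- now apply is_derive3_circ_t_s.
- apply is_derive3_circ_t_t.
- exact Nz.
Qed.

End Circles.

(** * The planes of the circles are parallel *)

Definition lead3 (z1 z2 z3 : C) (f : R -> R3) : Prop :=
  lead 0 z1 (fun t => px (f t)) /\ lead 0 z2 (fun t => py (f t)) /\ lead 0 z3 (fun t => pz (f t)).

Lemma lead3_lin a b : lead3 (px a, - px b) (py a, - py b) (pz a, - pz b) (lin a b).
Proof. split; [|split]; apply lead_cos_sin. Qed.

Lemma lead3_scal k z1 z2 z3 f : lead3 z1 z2 z3 f ->
  lead3 (RtoC k * z1)%C (RtoC k * z2)%C (RtoC k * z3)%C (fun t => scal k (f t)).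
Proof. intros (H1 & H2 & H3); split; [|split]; now apply (lead_scal 0 k). Qed.

Lemma lead3_plus z1 z2 z3 w1 w2 w3 f g : lead3 z1 z2 z3 f -> lead3 w1 w2 w3 g ->
  lead3 (z1 + w1)%C (z2 + w2)%C (z3 + w3)%C (fun t => plus (f t) (g t)).
Proof.
intros (H1 & H2 & H3) (K1 & K2 & K3); split; [|split].
- exact (lead_plus _ _ _ _ _ H1 K1).
- exact (lead_plus _ _ _ _ _ H2 K2).
- exact (lead_plus _ _ _ _ _ H3 K3).
Qed.

Lemma lead3_const_plus v z1 z2 z3 f : lead3 z1 z2 z3 f ->
  lead3 z1 z2 z3 (fun t => plus v (f t)).
Proof.
assert (P : forall a z g, lead 0 z g -> lead 0 z (fun t => a + g t)).
{ intros a z g H; eapply lead_ext.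
  - exact (lead_plus _ _ _ _ _ (trig_lead 0 _ (trig_const 0 a)) H).
  - apply Cplus_0_l.
  - reflexivity. }
intros (H1 & H2 & H3); split; [|split].
- exact (P _ _ _ H1).
- exact (P _ _ _ H2).
- exact (P _ _ _ H3).
Qed.

Lemma lead_hdot z1 z2 z3 w1 w2 w3 f g : lead3 z1 z2 z3 f -> lead3 w1 w2 w3 g ->
  lead 1 ((z1 * w1 + z2 * w2) / 2)%C (fun t => hdot (f t) (g t)).
Proof.
intros (H1 & H2 & H3) (K1 & K2 & K3).
eapply lead_ext.
- exact (lead_plus _ _ _ _ _ (lead_mult _ _ _ _ _ _ H1 K1) (lead_mult _ _ _ _ _ _ H2 K2)).
- field.
- reflexivity.
Qed.

Lemma lead_det z1 z2 z3 w1 w2 w3 v1 v2 v3 f g h :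
  lead3 z1 z2 z3 f -> lead3 w1 w2 w3 g -> lead3 v1 v2 v3 h ->
  lead 1 ((z1 * w2 - z2 * w1) / 2)%C (fun t => pz (cross (f t) (g t))) /\
  lead 2 (((z2 * w3 - z3 * w2) * v1 + (z3 * w1 - z1 * w3) * v2 + (z1 * w2 - z2 * w1) * v3) / 4)%C
    (fun t => dot (cross (f t) (g t)) (h t)).
Proof.
intros (H1 & H2 & H3) (K1 & K2 & K3) (L1 & L2 & L3).
assert (N1 := lead_minus _ _ _ _ _ (lead_mult _ _ _ _ _ _ H2 K3) (lead_mult _ _ _ _ _ _ H3 K2)).
assert (N2 := lead_minus _ _ _ _ _ (lead_mult _ _ _ _ _ _ H3 K1) (lead_mult _ _ _ _ _ _ H1 K3)).
assert (N3 := lead_minus _ _ _ _ _ (lead_mult _ _ _ _ _ _ H1 K2) (lead_mult _ _ _ _ _ _ H2 K1)).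
split.
- eapply lead_ext; [exact N3|field|reflexivity].
- eapply lead_ext.
  + exact (lead_plus _ _ _ _ _ (lead_plus _ _ _ _ _ (lead_mult _ _ _ _ _ _ N1 L1)
      (lead_mult _ _ _ _ _ _ N2 L2)) (lead_mult _ _ _ _ _ _ N3 L3)).
  + field.
  + reflexivity.
Qed.

(* Only the term of [X_ss] contributes: the leading coefficients of [X_st] and [X_tt] are linear
   combinations of those of [X_s] and [X_t], hence orthogonal to that of the normal. *)
Lemma lead_flat_trace (E1 E2 E3 A1 A2 A3 B1 B2 B3 : C) (r r1 r2 : R)
  (xs xt xss xst xtt : R -> R3) :
  lead3 (RtoC r1 * E1 + RtoC r * A1)%C (RtoC r1 * E2 + RtoC r * A2)%C (RtoC r1 * E3 + RtoC r * A3)%C xs ->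
  lead3 (RtoC r * (Ci * E1))%C (RtoC r * (Ci * E2))%C (RtoC r * (Ci * E3))%C xt ->
  lead3 (RtoC r2 * E1 + (RtoC (2 * r1) * A1 + RtoC r * B1))%C
    (RtoC r2 * E2 + (RtoC (2 * r1) * A2 + RtoC r * B2))%C
    (RtoC r2 * E3 + (RtoC (2 * r1) * A3 + RtoC r * B3))%C xss ->
  lead3 (RtoC r1 * (Ci * E1) + RtoC r * (Ci * A1))%C (RtoC r1 * (Ci * E2) + RtoC r * (Ci * A2))%C
    (RtoC r1 * (Ci * E3) + RtoC r * (Ci * A3))%C xst ->
  lead3 (RtoC r * - E1)%C (RtoC r * - E2)%C (RtoC r * - E3)%C xtt ->
  lead 6 (RtoC r ^ 7 * Ci ^ 4 / 64 * (A1 * E2 - A2 * E1) * (E1 * E1 + E2 * E2) *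
     ((A2 * E3 - A3 * E2) * B1 + (A3 * E1 - A1 * E3) * B2 + (A1 * E2 - A2 * E1) * B3))%C
   (fun t => pz (cross (xs t) (xt t)) * flat_trace (xs t) (xt t) (xss t) (xst t) (xtt t)).
Proof.
intros Hs Ht Hss Hst Htt.
destruct (lead_det _ _ _ _ _ _ _ _ _ _ _ _ Hs Ht Hss) as [Hn Hnss].
destruct (lead_det _ _ _ _ _ _ _ _ _ _ _ _ Hs Ht Hst) as [_ Hnst].
destruct (lead_det _ _ _ _ _ _ _ _ _ _ _ _ Hs Ht Htt) as [_ Hntt].
assert (HE := lead_hdot _ _ _ _ _ _ _ _ Hs Hs).
assert (HF := lead_hdot _ _ _ _ _ _ _ _ Hs Ht).
assert (HG := lead_hdot _ _ _ _ _ _ _ _ Ht Ht).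
eapply lead_ext.
- exact (lead_mult _ _ _ _ _ _ Hn
   (lead_plus _ _ _ _ _ (lead_minus _ _ _ _ _ (lead_mult _ _ _ _ _ _ HG Hnss)
     (lead_mult _ _ _ _ _ _ (lead_scal _ 2 _ _ HF) Hnst)) (lead_mult _ _ _ _ _ _ HE Hntt))).
- rewrite RtoC_mult. field.
- reflexivity.
Qed.

Lemma orthonormal_cross (e1 e2 : R3) :
  dot e1 e1 = 1 -> dot e2 e2 = 1 -> dot e1 e2 = 0 ->
  dot (cross e1 e2) (cross e1 e2) = 1 /\
  cross (cross e1 e2) e1 = e2 /\ cross (cross e1 e2) e2 = opp e1 /\
  forall a, a = plus (plus (scal (dot a e1) e1) (scal (dot a e2) e2)) (scal (dot a (cross e1 e2)) (cross e1 e2)).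
Proof.
intros H1 H2 H12.
assert (N : dot (cross e1 e2) (cross e1 e2) = 1).
{ transitivity (dot e1 e1 * dot e2 e2 - dot e1 e2 ^ 2); [r3_ring|rewrite H1, H2, H12; ring]. }
split; [exact N|split; [|split]].
- transitivity (minus (scal (dot e1 e1) e2) (scal (dot e1 e2) e1)).
  + apply R3_ext; r3_ring.
  + rewrite H1, H12; apply R3_ext; r3_ring.
- transitivity (minus (scal (dot e1 e2) e2) (scal (dot e2 e2) e1)).
  + apply R3_ext; r3_ring.
  + rewrite H2, H12; apply R3_ext; r3_ring.
- intros a; transitivity (scal (dot (cross e1 e2) (cross e1 e2)) a).
  + rewrite N; apply R3_ext; r3_ring.
  + transitivity (plus (plus
       (scal (dot a e1) (minus (scal (dot e2 e2) e1) (scal (dot e1 e2) e2)))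
       (scal (dot a e2) (minus (scal (dot e1 e1) e2) (scal (dot e1 e2) e1))))
       (scal (dot a (cross e1 e2)) (cross e1 e2))).
    * apply R3_ext; r3_ring.
    * rewrite H1, H2, H12; apply R3_ext; r3_ring.
Qed.

Lemma cross_orthonormal (u ut n c : R3) :
  dot u u = 1 -> dot ut ut = 1 -> dot u ut = 0 -> cross u ut = n ->
  cross c ut = minus (scal (dot c u) n) (scal (dot c n) u).
Proof.
intros Huu Htt Hut Hn.
destruct (orthonormal_cross u ut Huu Htt Hut) as (_ & _ & N2 & Ex); rewrite Hn in *.
rewrite (Ex c) at 1.
transitivity (plus (scal (dot c u) (cross u ut)) (scal (dot c n) (cross n ut))).
- generalize (dot c u) (dot c ut) (dot c n); intros; apply R3_ext; r3_ring.
- rewrite Hn, N2; generalize (dot c u) (dot c n); intros; apply R3_ext; r3_ring.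
Qed.

Lemma frame_derivatives (e1 e2 a1 a2 : R3) :
  dot e1 e1 = 1 -> dot e2 e2 = 1 -> dot e1 e2 = 0 ->
  dot e1 a1 = 0 -> dot e2 a2 = 0 -> dot e1 a2 + dot e2 a1 = 0 ->
  a1 = plus (scal (dot a1 e2) e2) (scal (dot a1 (cross e1 e2)) (cross e1 e2)) /\
  a2 = plus (scal (- dot a1 e2) e1) (scal (dot a2 (cross e1 e2)) (cross e1 e2)).
Proof.
intros H11 H22 H12 D11 D22 D12.
destruct (orthonormal_cross e1 e2 H11 H22 H12) as (_ & _ & _ & Ex).
set (n := cross e1 e2) in *; split.
- rewrite (Ex a1) at 1; rewrite (dot_comm a1 e1), D11.
  generalize (dot a1 e2) (dot a1 n); clearbody n; intros; apply R3_ext; r3_ring.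
- rewrite (Ex a2) at 1; rewrite (dot_comm a2 e2), D22.
  replace (dot a2 e1) with (- dot a1 e2) by (rewrite (dot_comm a2), (dot_comm a1); lra).
  generalize (dot a1 e2) (dot a2 n); clearbody n; intros; apply R3_ext; r3_ring.
Qed.

(** With the complex vectors [E = e1 - i e2], [A = E'], [B = E''] and [P = p - i q], the frame
    equations read [A = i k E + P n]. As [n x E = i E], this gives [A x E = i P E]; as [E.E = 0] for
    the bilinear product, differentiating twice gives [E.B = - A.A = - P^2], and
    [E_x^2 + E_y^2 = - E_z^2]. Every factor becomes a product of powers of [P] and [E_z]. *)
Lemma isotropic_degeneracy (e1 e2 a1 a2 b1 b2 : R3) (c : C) :
  dot e1 e1 = 1 -> dot e2 e2 = 1 -> dot e1 e2 = 0 ->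
  dot e1 a1 = 0 -> dot e2 a2 = 0 -> dot e1 a2 + dot e2 a1 = 0 ->
  dot e1 b1 + dot a1 a1 = 0 -> dot e2 b2 + dot a2 a2 = 0 ->
  dot e1 b2 + dot e2 b1 + 2 * dot a1 a2 = 0 ->
  let E := fun p : R3 -> R => (p e1, - p e2) : C in
  let A := fun p : R3 -> R => (p a1, - p a2) : C in
  let B := fun p : R3 -> R => (p b1, - p b2) : C in
  c <> RtoC 0 ->
  (c * (A px * E py - A py * E px) * (E px * E px + E py * E py) *
     ((A py * E pz - A pz * E py) * B px + (A pz * E px - A px * E pz) * B py
      + (A px * E py - A py * E px) * B pz))%C = RtoC 0 ->
  (dot a1 (cross e1 e2) = 0 /\ dot a2 (cross e1 e2) = 0) \/ (pz e1 = 0 /\ pz e2 = 0).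
Proof.
intros H11 H22 H12 D11 D22 D12 S11 S22 S12 E A B c0 Z.
destruct (orthonormal_cross e1 e2 H11 H22 H12) as (Nn & N1 & N2 & Ex).
set (n := cross e1 e2) in *.
set (k := dot a1 e2) in *; set (p := dot a1 n) in *; set (q := dot a2 n) in *.
destruct (frame_derivatives e1 e2 a1 a2 H11 H22 H12 D11 D22 D12) as [F1 F2].
fold n k p q in F1, F2.
assert (V1 : minus (cross a1 e1) (cross a2 e2) = plus (scal q e1) (scal p e2)).
{ transitivity (minus (scal p (cross n e1)) (scal q (cross n e2))).
  - rewrite F1, F2; clearbody n k p q; apply R3_ext; r3_ring.
  - rewrite N1, N2; clearbody n k p q; apply R3_ext; r3_ring. }
assert (V2 : plus (cross a1 e2) (cross a2 e1) = plus (scal (- p) e1) (scal q e2)).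
{ transitivity (plus (scal p (cross n e2)) (scal q (cross n e1))).
  - rewrite F1, F2; clearbody n k p q; apply R3_ext; r3_ring.
  - rewrite N1, N2; clearbody n k p q; apply R3_ext; r3_ring. }
assert (n1 : dot e1 n = 0) by (unfold n; r3_ring).
assert (n2 : dot e2 n = 0) by (unfold n; r3_ring).
assert (Q11 : dot a1 a1 = k ^ 2 + p ^ 2).
{ rewrite F1. transitivity (k ^ 2 * dot e2 e2 + p ^ 2 * dot n n + 2 * k * p * dot e2 n).
  - clearbody n k p q; r3_ring.
  - rewrite H22, Nn, n2; ring. }
assert (Q22 : dot a2 a2 = k ^ 2 + q ^ 2).
{ rewrite F2. transitivity (k ^ 2 * dot e1 e1 + q ^ 2 * dot n n - 2 * k * q * dot e1 n).
  - clearbody n k p q; r3_ring.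
  - rewrite H11, Nn, n1; ring. }
assert (Q12 : dot a1 a2 = p * q).
{ rewrite F1, F2. transitivity (- k ^ 2 * dot e1 e2 + p * q * dot n n + k * q * dot e2 n - k * p * dot e1 n).
  - clearbody n k p q; r3_ring.
  - rewrite H12, Nn, n1, n2; ring. }
set (P := (p, - q) : C).
assert (X3 : (A px * E py - A py * E px = Ci * P * E pz)%C).
{ apply (f_equal pz) in V1; apply (f_equal pz) in V2.
  revert V1 V2; unfold minus, cross; rewrite !R3_plusE, ?R3_oppE, !R3_scalE.
  unfold A, E, P; clear; intros V1 V2.
  apply injective_projections; unfold px, py, pz in *; simpl in *; lra. }
assert (X1 : (A py * E pz - A pz * E py = Ci * P * E px)%C).
{ apply (f_equal px) in V1; apply (f_equal px) in V2.
  revert V1 V2; unfold minus, cross; rewrite !R3_plusE, ?R3_oppE, !R3_scalE.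
  unfold A, E, P; clear; intros V1 V2.
  apply injective_projections; unfold px, py, pz in *; simpl in *; lra. }
assert (X2 : (A pz * E px - A px * E pz = Ci * P * E py)%C).
{ apply (f_equal py) in V1; apply (f_equal py) in V2.
  revert V1 V2; unfold minus, cross; rewrite !R3_plusE, ?R3_oppE, !R3_scalE.
  unfold A, E, P; clear; intros V1 V2.
  apply injective_projections; unfold px, py, pz in *; simpl in *; lra. }
assert (I0 : (E px * E px + E py * E py = - (E pz * E pz))%C).
{ unfold E; revert H11 H22 H12; unfold dot; clear; intros.
  apply injective_projections; simpl; lra. }
assert (EB : (E px * B px + E py * B py + E pz * B pz = - (P * P))%C).
{ rewrite Q11 in S11; rewrite Q22 in S22; rewrite Q12 in S12.
  unfold E, B, P; revert S11 S22 S12; unfold dot; clear; intros.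
  apply injective_projections; simpl; lra. }
rewrite X1, X2, X3, I0 in Z.
assert (Z' : (c * Ci * Ci * (P * P * P * P * (E pz * E pz * E pz)) = RtoC 0)%C).
{ rewrite <- Z. transitivity (- (c * (Ci * P * E pz) * (E pz * E pz) * (Ci * P * (- (P * P)))))%C; [ring|].
  rewrite <- EB; ring. }
assert (Ci0 : Ci <> RtoC 0) by (intros H; apply (f_equal snd) in H; simpl in H; lra).
destruct (Ceq_dec P (RtoC 0)) as [HP|HP].
- left; split.
  + exact (f_equal fst HP).
  + apply (f_equal snd) in HP; simpl in HP; lra.
- right; destruct (Ceq_dec (E pz) (RtoC 0)) as [HE|HE].
  + split.
    * exact (f_equal fst HE).
    * apply (f_equal snd) in HE; simpl in HE; lra.
  + exfalso; revert Z'; repeat apply Cmult_neq_0; assumption.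
Qed.

(** * Differentiation and connectedness on an interval; the trace for parallel planes *)

Lemma is_derive_dot (c d : R -> R3) (x : R) (u v : R3) :
  is_derive3 c x u -> is_derive3 d x v ->
  is_derive (fun y => dot (c y) (d y)) x (dot u (d x) + dot (c x) v).
Proof.
intros (Hx & Hy & Hz) (Kx & Ky & Kz).
assert (P : forall (f g : R -> R) (f' g' : R), is_derive f x f' -> is_derive g x g' ->
  is_derive (fun y => f y * g y) x (f' * g x + f x * g')).
{ intros f g f' g' Hf Hg. exact (is_derive_mult (K := R_AbsRing) _ _ _ _ _ Hf Hg Rmult_comm). }
replace (dot u (d x) + dot (c x) v) with
  (plus (plus (px u * px (d x) + px (c x) * px v) (py u * py (d x) + py (c x) * py v))
     (pz u * pz (d x) + pz (c x) * pz v)) by (unfold dot; simpl; unfold plus; simpl; ring).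
apply (is_derive_plus (V := R_NormedModule) (fun y => px (c y) * px (d y) + py (c y) * py (d y))).
- apply (is_derive_plus (V := R_NormedModule) (fun y => px (c y) * px (d y))).
  + exact (P _ _ _ _ Hx Kx).
  + exact (P _ _ _ _ Hy Ky).
- exact (P _ _ _ _ Hz Kz).
Qed.

Lemma is_derive_locally_const (I : R -> Prop) (f : R -> R) (k s l : R) :
  open I -> (forall x, I x -> f x = k) -> I s -> is_derive f s l -> l = 0.
Proof.
intros Io H Hs Hl.
apply is_derive_unique in Hl; rewrite <- Hl.
apply is_derive_unique, (is_derive_ext_loc (fun _ => k)).
- apply filter_imp with (2 := Io s Hs); intros x Hx; symmetry; now apply H.
- apply is_derive_cst.
Qed.

Lemma angle_exists (x y k : R) : 0 < k -> x ^ 2 + y ^ 2 = k ^ 2 -> exists t, x = k * cos t /\ y = k * sin t.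
Proof.
intros Hk H.
assert (Hx : -1 <= x / k <= 1).
{ assert (E : x = x / k * k) by (field; lra).
  set (q := x / k) in *; clearbody q; subst x.
  assert (K : 0 < k ^ 2) by nra.
  assert (q ^ 2 <= 1) by (apply Rmult_le_reg_r with (k ^ 2); [exact K|]; assert (0 <= y ^ 2) by apply pow2_ge_0; lra).
  split; nra. }
assert (E : x = k * cos (acos (x / k))).
{ rewrite cos_acos by assumption; field; lra. }
assert (S : (k * sin (acos (x / k))) ^ 2 = y ^ 2).
{ assert (T := sin2_cos2 (acos (x / k))); unfold Rsqr in T.
  set (c := cos (acos (x / k))) in *; set (s := sin (acos (x / k))) in *. nra. }
assert (S' : y = k * sin (acos (x / k)) \/ y = - (k * sin (acos (x / k)))).
{ assert (F : (y - k * sin (acos (x / k))) * (y + k * sin (acos (x / k))) = 0) by lra.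
  apply Rmult_integral in F; destruct F; [left|right]; lra. }
destruct S' as [S'|S'].
- now exists (acos (x / k)).
- exists (- acos (x / k)); rewrite cos_neg, sin_neg; split; [assumption|lra].
Qed.

Lemma interval_derive_0 (I : R -> Prop) (f : R -> R) :
  nonempty_open_interval I -> (forall s, I s -> is_derive f s 0) ->
  forall a b, I a -> I b -> f a = f b.
Proof.
intros (_ & _ & Iv) D.
assert (P : forall a b, I a -> I b -> a < b -> f a = f b).
{ intros a b Ha Hb L; apply (eq_is_derive (V := R_NormedModule) f); [|exact L].
  intros t Ht; apply D; now apply Iv with a b. }
intros a b Ha Hb; destruct (Rtotal_order a b) as [L|[->|L]]; [now apply P|reflexivity|].
symmetry; now apply P.
Qed.

Lemma interval_constant_sign (I : R -> Prop) (f : R -> R) :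
  nonempty_open_interval I -> (forall s, I s -> continuous f s) -> (forall s, I s -> f s <> 0) ->
  forall a b, I a -> I b -> 0 < f a -> 0 < f b.
Proof.
intros (_ & _ & Iv) Cf Nf a b Ha Hb Fa.
destruct (Rlt_le_dec 0 (f b)) as [|Fb]; [assumption|exfalso].
assert (Fb' : f b < 0) by (assert (N := Nf b Hb); lra).
destruct (Rtotal_order a b) as [L|[E|L]]; [|subst b; lra|].
- destruct (IVT_interv (fun x => - f x) a b) as (z & Hz & Zz); [|assumption|lra|lra|].
  + intros c Hc; apply continuity_pt_opp, continuity_pt_filterlim, Cf; now apply Iv with a b.
  + apply (Nf z); [now apply Iv with a b|lra].
- destruct (IVT_interv f b a) as (z & Hz & Zz); [|assumption|lra|lra|].
  + intros c Hc; apply continuity_pt_filterlim, Cf; now apply Iv with b a.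
  + apply (Nf z); [now apply Iv with b a|lra].
Qed.

(* Rotating the circle parameter with the frame subtracts [k X_t] from [X_s];
   the trace does not change, so the rotation speed [k] of the frame drops out. *)
Lemma flat_trace_parallel (u ut n c1 c2 : R3) (r r1 r2 k k1 : R) :
  dot u u = 1 -> dot ut ut = 1 -> dot u ut = 0 -> cross u ut = n ->
  let xs := plus c1 (plus (scal r1 u) (scal (r * k) ut)) in
  let xt := scal r ut in
  let xss := plus c2 (plus (scal r2 u) (plus (scal (2 * r1 * k) ut)
               (scal r (minus (scal k1 ut) (scal (k ^ 2) u))))) in
  let xst := minus (scal r1 ut) (scal (r * k) u) in
  let xtt := scal (- r) u in
  let v := plus c1 (scal r1 u) in
  cross xs xt = scal r (minus (scal (dot c1 u + r1) n) (scal (dot c1 n) u)) /\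
  flat_trace xs xt xss xst xtt =
  r ^ 2 * (r * hdot ut ut * ((dot c1 u + r1) * dot c2 n - dot c1 n * (dot c2 u + r2))
           + dot c1 n * hdot v v).
Proof.
intros Huu Htt Hut Hn xs xt xss xst xtt v.
assert (Hnu : dot n u = 0) by (rewrite <- Hn; r3_ring).
assert (Hnt : dot n ut = 0) by (rewrite <- Hn; r3_ring).
assert (X := cross_orthonormal u ut n c1 Huu Htt Hut Hn).
assert (XN : cross xs xt = scal r (minus (scal (dot c1 u + r1) n) (scal (dot c1 n) u))).
{ transitivity (scal r (plus (cross c1 ut) (scal r1 (cross u ut)))).
  - unfold xs, xt; apply R3_ext; r3_ring.
  - rewrite X, Hn; generalize (dot c1 u) (dot c1 n); intros; apply R3_ext; r3_ring. }
split; [exact XN|].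
assert (L : forall w, dot (cross xs xt) w = r * ((dot c1 u + r1) * dot n w - dot c1 n * dot u w)).
{ intros w; rewrite XN; generalize (dot c1 u) (dot c1 n); intros; r3_ring. }
unfold flat_trace; rewrite !L.
assert (S1 : dot n xss = dot c2 n).
{ transitivity (dot c2 n + (r2 - r * k ^ 2) * dot n u + (2 * r1 * k + r * k1) * dot n ut).
  - unfold xss, minus; r3_ring.
  - rewrite Hnu, Hnt; ring. }
assert (S2 : dot u xss = dot c2 u + r2 - r * k ^ 2).
{ transitivity (dot c2 u + (r2 - r * k ^ 2) * dot u u + (2 * r1 * k + r * k1) * dot u ut).
  - unfold xss, minus; r3_ring.
  - rewrite Huu, Hut; ring. }
assert (S3 : dot n xst = 0).
{ transitivity (r1 * dot n ut - r * k * dot n u).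
  - unfold xst, minus; r3_ring.
  - rewrite Hnu, Hnt; ring. }
assert (S4 : dot u xst = - (r * k)).
{ transitivity (r1 * dot u ut - r * k * dot u u).
  - unfold xst, minus; r3_ring.
  - rewrite Huu, Hut; ring. }
assert (S5 : dot n xtt = 0).
{ transitivity (- r * dot n u); [unfold xtt; r3_ring|rewrite Hnu; ring]. }
assert (S6 : dot u xtt = - r).
{ transitivity (- r * dot u u); [unfold xtt; r3_ring|rewrite Huu; ring]. }
rewrite S1, S2, S3, S4, S5, S6.
replace (hdot xt xt) with (r ^ 2 * hdot ut ut) by (unfold xt; r3_ring).
replace (hdot xs xt) with (r * (hdot v ut + r * k * hdot ut ut)) by (unfold xs, xt, v; r3_ring).
replace (hdot xs xs) with (hdot v v + 2 * r * k * hdot v ut + (r * k) ^ 2 * hdot ut ut)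
  by (unfold xs, v; r3_ring).
ring.
Qed.

(** All five vectors have degree at most one in the angle, so the two factors are trigonometric
    polynomials of degrees at most 2 and 5, and [trig_integral] applies. *)
Lemma trig_flat_trace (xs xt xss xst xtt : R -> R3) :
  (exists z1 z2 z3, lead3 z1 z2 z3 xs) -> (exists z1 z2 z3, lead3 z1 z2 z3 xt) ->
  (exists z1 z2 z3, lead3 z1 z2 z3 xss) -> (exists z1 z2 z3, lead3 z1 z2 z3 xst) ->
  (exists z1 z2 z3, lead3 z1 z2 z3 xtt) ->
  (forall t, pz (cross (xs t) (xt t)) * flat_trace (xs t) (xt t) (xss t) (xst t) (xtt t) = 0) ->
  (forall t, pz (cross (xs t) (xt t)) = 0) \/
  (forall t, flat_trace (xs t) (xt t) (xss t) (xst t) (xtt t) = 0).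
Proof.
intros (? & ? & ? & Hs) (? & ? & ? & Ht) (? & ? & ? & Hss) (? & ? & ? & Hst) (? & ? & ? & Htt).
destruct (lead_det _ _ _ _ _ _ _ _ _ _ _ _ Hs Ht Hss) as [Hn Hnss].
destruct (lead_det _ _ _ _ _ _ _ _ _ _ _ _ Hs Ht Hst) as [_ Hnst].
destruct (lead_det _ _ _ _ _ _ _ _ _ _ _ _ Hs Ht Htt) as [_ Hntt].
assert (HE := lead_hdot _ _ _ _ _ _ _ _ Hs Hs).
assert (HF := lead_hdot _ _ _ _ _ _ _ _ Hs Ht).
assert (HG := lead_hdot _ _ _ _ _ _ _ _ Ht Ht).
apply trig_integral with 2%nat 5%nat.
- exact (lead_trig _ _ _ Hn).
- exact (lead_trig _ _ _ (lead_plus _ _ _ _ _ (lead_minus _ _ _ _ _ (lead_mult _ _ _ _ _ _ HG Hnss)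
     (lead_mult _ _ _ _ _ _ (lead_scal _ 2 _ _ HF) Hnst)) (lead_mult _ _ _ _ _ _ HE Hntt))).
Qed.

Section Parallel.

Variables (I : R -> Prop) (C e1 e2 : R -> R3) (r : R -> R).
Hypotheses (cyc : cyclic I C e1 e2 r) (mini : dirichlet_minimal_on I (circles C e1 e2 r)).

Let nrm (s : R) : R3 := cross (e1 s) (e2 s).

Lemma cyclic_frame_relations s : I s ->
  (dot (e1 s) (D3 e1 1 s) = 0 /\ dot (e2 s) (D3 e2 1 s) = 0 /\
   dot (e1 s) (D3 e2 1 s) + dot (e2 s) (D3 e1 1 s) = 0) /\
  (dot (e1 s) (D3 e1 2 s) + dot (D3 e1 1 s) (D3 e1 1 s) = 0 /\
   dot (e2 s) (D3 e2 2 s) + dot (D3 e2 1 s) (D3 e2 1 s) = 0 /\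
   dot (e1 s) (D3 e2 2 s) + dot (e2 s) (D3 e1 2 s) + 2 * dot (D3 e1 1 s) (D3 e2 1 s) = 0).
Proof.
destruct cyc as ((_ & Io & _) & _ & S1 & S2 & _ & On & _).
assert (A11 : forall x, I x -> dot (e1 x) (D3 e1 1 x) = 0).
{ intros x Hx.
  assert (Z := is_derive_dot _ _ _ _ _ (smooth_curve_derive_0 I e1 x S1 Hx) (smooth_curve_derive_0 I e1 x S1 Hx)).
  apply (is_derive_locally_const I _ 1 x) in Z; [|assumption|intros y Hy; apply (On y Hy)|assumption].
  rewrite dot_comm in Z; lra. }
assert (A22 : forall x, I x -> dot (e2 x) (D3 e2 1 x) = 0).
{ intros x Hx.
  assert (Z := is_derive_dot _ _ _ _ _ (smooth_curve_derive_0 I e2 x S2 Hx) (smooth_curve_derive_0 I e2 x S2 Hx)).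
  apply (is_derive_locally_const I _ 1 x) in Z; [|assumption|intros y Hy; apply (On y Hy)|assumption].
  rewrite dot_comm in Z; lra. }
assert (A12 : forall x, I x -> dot (e1 x) (D3 e2 1 x) + dot (e2 x) (D3 e1 1 x) = 0).
{ intros x Hx.
  assert (Z := is_derive_dot _ _ _ _ _ (smooth_curve_derive_0 I e1 x S1 Hx) (smooth_curve_derive_0 I e2 x S2 Hx)).
  apply (is_derive_locally_const I _ 0 x) in Z; [|assumption|intros y Hy; apply (On y Hy)|assumption].
  rewrite (dot_comm (D3 e1 1 x)) in Z; lra. }
intros Hs; split; [now repeat split; auto|split; [|split]].
- assert (Z := is_derive_dot _ _ _ _ _ (smooth_curve_derive_0 I e1 s S1 Hs) (smooth_curve_derive I e1 1 s S1 Hs)).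
  apply (is_derive_locally_const I _ 0 s) in Z; [lra|assumption|assumption|assumption].
- assert (Z := is_derive_dot _ _ _ _ _ (smooth_curve_derive_0 I e2 s S2 Hs) (smooth_curve_derive I e2 1 s S2 Hs)).
  apply (is_derive_locally_const I _ 0 s) in Z; [lra|assumption|assumption|assumption].
- assert (Z := is_derive_plus (V := R_NormedModule) _ _ _ _ _
    (is_derive_dot _ _ _ _ _ (smooth_curve_derive_0 I e1 s S1 Hs) (smooth_curve_derive I e2 1 s S2 Hs))
    (is_derive_dot _ _ _ _ _ (smooth_curve_derive_0 I e2 s S2 Hs) (smooth_curve_derive I e1 1 s S1 Hs))).
  apply (is_derive_locally_const I _ 0 s) in Z; [|assumption|assumption|assumption].
  revert Z; unfold plus; simpl; rewrite (dot_comm (D3 e2 1 s)); lra.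
Qed.

(** Differentiation in the angle multiplies a leading coefficient by [Ci]. The coefficients are
    written in the exact shape that [lead_flat_trace] expects, with [E], [E'] and [E''] in the
    places of its [E], [A] and [B]. *)
Lemma circ_lead3 s :
  (lead3 (RtoC (Derive_n r 1 s) * (px (e1 s), (- px (e2 s))%R) + RtoC (r s) * (px (D3 e1 1 s), (- px (D3 e2 1 s))%R))%C
     (RtoC (Derive_n r 1 s) * (py (e1 s), (- py (e2 s))%R) + RtoC (r s) * (py (D3 e1 1 s), (- py (D3 e2 1 s))%R))%C
     (RtoC (Derive_n r 1 s) * (pz (e1 s), (- pz (e2 s))%R) + RtoC (r s) * (pz (D3 e1 1 s), (- pz (D3 e2 1 s))%R))%C
     (circ_s C e1 e2 r s)) /\
  (lead3 (RtoC (r s) * (Ci * (px (e1 s), (- px (e2 s))%R)))%C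
     (RtoC (r s) * (Ci * (py (e1 s), (- py (e2 s))%R)))%C
     (RtoC (r s) * (Ci * (pz (e1 s), (- pz (e2 s))%R)))%C (circ_t e1 e2 r s)) /\
  (lead3 (RtoC (Derive_n r 2 s) * (px (e1 s), (- px (e2 s))%R) +
       (RtoC (2 * Derive_n r 1 s) * (px (D3 e1 1 s), (- px (D3 e2 1 s))%R)
        + RtoC (r s) * (px (D3 e1 2 s), (- px (D3 e2 2 s))%R)))%C
     (RtoC (Derive_n r 2 s) * (py (e1 s), (- py (e2 s))%R) +
       (RtoC (2 * Derive_n r 1 s) * (py (D3 e1 1 s), (- py (D3 e2 1 s))%R)
        + RtoC (r s) * (py (D3 e1 2 s), (- py (D3 e2 2 s))%R)))%C
     (RtoC (Derive_n r 2 s) * (pz (e1 s), (- pz (e2 s))%R) +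
       (RtoC (2 * Derive_n r 1 s) * (pz (D3 e1 1 s), (- pz (D3 e2 1 s))%R)
        + RtoC (r s) * (pz (D3 e1 2 s), (- pz (D3 e2 2 s))%R)))%C
     (circ_ss C e1 e2 r s)) /\
  (lead3 (RtoC (Derive_n r 1 s) * (Ci * (px (e1 s), (- px (e2 s))%R)) + RtoC (r s) * (Ci * (px (D3 e1 1 s), (- px (D3 e2 1 s))%R)))%C
     (RtoC (Derive_n r 1 s) * (Ci * (py (e1 s), (- py (e2 s))%R)) + RtoC (r s) * (Ci * (py (D3 e1 1 s), (- py (D3 e2 1 s))%R)))%C
     (RtoC (Derive_n r 1 s) * (Ci * (pz (e1 s), (- pz (e2 s))%R)) + RtoC (r s) * (Ci * (pz (D3 e1 1 s), (- pz (D3 e2 1 s))%R)))%C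
     (circ_st e1 e2 r s)) /\
  (lead3 (RtoC (r s) * - (px (e1 s), (- px (e2 s))%R))%C
     (RtoC (r s) * - (py (e1 s), (- py (e2 s))%R))%C
     (RtoC (r s) * - (pz (e1 s), (- pz (e2 s))%R))%C (circ_tt e1 e2 r s)).
Proof.
assert (J : forall x y, (Ci * (x, (- y)%R))%C = (y, (- - x)%R)).
{ intros; apply injective_projections; simpl; ring. }
split; [|split; [|split; [|split]]].
- apply lead3_const_plus, lead3_plus; apply lead3_scal, lead3_lin.
- rewrite !J; apply lead3_scal, lead3_lin.
- apply lead3_const_plus, lead3_plus; [|apply lead3_plus]; apply lead3_scal, lead3_lin.
- rewrite !J; apply lead3_plus; apply lead3_scal, lead3_lin.
- apply lead3_scal, lead3_lin.
Qed.

Lemma circ_minimal_product s t : I s ->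
  pz (circ_normal C e1 e2 r s t) * circ_flat_trace C e1 e2 r s t = 0.
Proof.
destruct cyc as ((_ & Io & _) & S0 & S1 & S2 & Sr & _ & _).
intros Hs; now apply minimal_circ_flat_trace with I.
Qed.

Lemma circ_dichotomy s : I s ->
  (forall t, pz (circ_normal C e1 e2 r s t) = 0) \/ (forall t, circ_flat_trace C e1 e2 r s t = 0).
Proof.
intros Hs; destruct (circ_lead3 s) as (Ls & Lt & Lss & Lst & Ltt).
apply trig_flat_trace; try (do 3 eexists; eassumption).
intros t; now apply circ_minimal_product.
Qed.

Lemma cyclic_degeneracy s : I s ->
  (dot (D3 e1 1 s) (nrm s) = 0 /\ dot (D3 e2 1 s) (nrm s) = 0) \/
  (pz (e1 s) = 0 /\ pz (e2 s) = 0).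
Proof.
intros Hs.
destruct (cyclic_frame_relations s Hs) as ((D11 & D22 & D12) & (S11 & S22 & S12)).
destruct cyc as (_ & _ & _ & _ & _ & On & _).
destruct (On s Hs) as (r0 & H11 & H22 & H12).
destruct (circ_lead3 s) as (Ls & Lt & Lss & Lst & Ltt).
assert (L := lead_flat_trace _ _ _ _ _ _ _ _ _ _ _ _ _ _ _ _ _ Ls Lt Lss Lst Ltt).
assert (Z := lead_zero _ _ _ L (fun t => circ_minimal_product s t Hs)).
apply (isotropic_degeneracy _ _ _ _ (D3 e1 2 s) (D3 e2 2 s) (RtoC (r s) ^ 7 * Ci ^ 4 / 64)%C H11 H22 H12);
  try assumption.
assert (C4 : (Ci ^ 4)%C = RtoC 1) by (apply injective_projections; simpl; ring).
rewrite C4, <- RtoC_pow, Cmult_1_r, <- RtoC_div by lra.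
intros H; apply RtoC_inj in H.
assert (0 < r s ^ 7) by now apply pow_lt.
lra.
Qed.

Lemma is_derive3_nrm s : I s -> is_derive3 nrm s
  (opp (plus (scal (dot (D3 e1 1 s) (nrm s)) (e1 s)) (scal (dot (D3 e2 1 s) (nrm s)) (e2 s)))).
Proof.
intros Hs.
destruct (cyclic_frame_relations s Hs) as ((D11 & D22 & D12) & _).
destruct cyc as (_ & _ & S1 & S2 & _ & On & _).
destruct (On s Hs) as (_ & H11 & H22 & H12).
destruct (frame_derivatives _ _ _ _ H11 H22 H12 D11 D22 D12) as [F1 F2].
destruct (orthonormal_cross _ _ H11 H22 H12) as (_ & N1 & N2 & _).
fold (nrm s) in *.
eapply is_derive3_eq.
- exact (is_derive3_cross _ _ _ _ _ (smooth_curve_derive_0 I e1 s S1 Hs) (smooth_curve_derive_0 I e2 s S2 Hs)).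
- rewrite F1 at 1; rewrite F2 at 1.
  generalize (dot (D3 e1 1 s) (e2 s)) (dot (D3 e1 1 s) (nrm s)) (dot (D3 e2 1 s) (nrm s)).
  intros k p q.
  transitivity (plus (scal p (cross (nrm s) (e2 s))) (scal (- q) (cross (nrm s) (e1 s)))).
  + generalize (nrm s) (e1 s) (e2 s); intros; apply R3_ext; r3_ring.
  + rewrite N1, N2; generalize (e1 s) (e2 s); intros; apply R3_ext; r3_ring.
Qed.

Lemma frame_height s : I s -> pz (e1 s) ^ 2 + pz (e2 s) ^ 2 + pz (nrm s) ^ 2 = 1.
Proof.
intros Hs; destruct cyc as (_ & _ & _ & _ & _ & On & _).
destruct (On s Hs) as (_ & H11 & H22 & H12).
destruct (orthonormal_cross _ _ H11 H22 H12) as (_ & _ & _ & Ex).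
specialize (Ex (0, 0, 1)); apply (f_equal pz) in Ex; fold (nrm s) in Ex.
change (1 = dot (0, 0, 1) (e1 s) * pz (e1 s) + dot (0, 0, 1) (e2 s) * pz (e2 s)
  + dot (0, 0, 1) (nrm s) * pz (nrm s)) in Ex.
unfold dot in Ex; change (px (0, 0, 1)) with 0 in Ex; change (py (0, 0, 1)) with 0 in Ex;
  change (pz (0, 0, 1)) with 1 in Ex. lra.
Qed.

Lemma nrm_pz_const a b : I a -> I b -> pz (nrm a) = pz (nrm b).
Proof.
apply (interval_derive_0 I (fun s => pz (nrm s))); [apply cyc|].
intros s Hs; destruct (is_derive3_nrm s Hs) as (_ & _ & Hz).
eapply is_derive_ext_loc; [apply filter_forall; reflexivity|].
replace 0 with (pz (opp (plus (scal (dot (D3 e1 1 s) (nrm s)) (e1 s)) (scal (dot (D3 e2 1 s) (nrm s)) (e2 s)))));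
  [exact Hz|].
change (- (dot (D3 e1 1 s) (nrm s) * pz (e1 s) + dot (D3 e2 1 s) (nrm s) * pz (e2 s)) = 0).
destruct (cyclic_degeneracy s Hs) as [[-> ->]|[-> ->]]; ring.
Qed.

(** Only the horizontal alternative needs an argument: there [n_z^2 = 1], which propagates to all of
    [I] because [n_z] is constant. The frame is then horizontal throughout, so its derivative is
    horizontal, hence orthogonal to the vertical normal. *)
Lemma parallel_planes s : I s ->
  dot (D3 e1 1 s) (nrm s) = 0 /\ dot (D3 e2 1 s) (nrm s) = 0.
Proof.
intros Hs; destruct (cyclic_degeneracy s Hs) as [H|[Z1 Z2]]; [assumption|].
assert (Hn := frame_height s Hs); rewrite Z1, Z2 in Hn.
assert (A : forall x, I x -> pz (e1 x) = 0 /\ pz (e2 x) = 0).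
{ intros x Hx; assert (Hn' := frame_height x Hx).
  rewrite (nrm_pz_const x s Hx Hs) in Hn'; nra. }
destruct cyc as ((_ & Io & _) & _ & S1 & S2 & _ & _ & _).
assert (A1 : pz (D3 e1 1 s) = 0).
{ apply (is_derive_locally_const I (fun x => pz (e1 x)) 0 s); try assumption.
  - intros x Hx; now apply A.
  - apply (smooth_curve_derive_0 I e1 s S1 Hs). }
assert (A2 : pz (D3 e2 1 s) = 0).
{ apply (is_derive_locally_const I (fun x => pz (e2 x)) 0 s); try assumption.
  - intros x Hx; now apply A.
  - apply (smooth_curve_derive_0 I e2 s S2 Hs). }
unfold dot; rewrite A1, A2.
replace (px (nrm s)) with 0; [replace (py (nrm s)) with 0; [split; ring|]|].
- unfold nrm, cross, px, py, pz in *; simpl; rewrite Z1, Z2; ring.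
- unfold nrm, cross, px, py, pz in *; simpl; rewrite Z1, Z2; ring.
Qed.

Lemma nrm_const a b : I a -> I b -> nrm a = nrm b.
Proof.
assert (D : forall s, I s -> is_derive3 nrm s zero).
{ intros s Hs; eapply is_derive3_eq; [exact (is_derive3_nrm s Hs)|].
  destruct (parallel_planes s Hs) as [-> ->]; apply R3_ext; r3_ring. }
intros Ha Hb; apply R3_ext.
- apply (interval_derive_0 I (fun s => px (nrm s))); [apply cyc| |assumption|assumption].
  intros s Hs; apply (D s Hs).
- apply (interval_derive_0 I (fun s => py (nrm s))); [apply cyc| |assumption|assumption].
  intros s Hs; apply (D s Hs).
- apply (interval_derive_0 I (fun s => pz (nrm s))); [apply cyc| |assumption|assumption].
  intros s Hs; apply (D s Hs).
Qed.

Lemma lin_orthonormal s t : I s ->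
  let u := lin (e1 s) (e2 s) t in let ut := lin (e2 s) (opp (e1 s)) t in
  dot u u = 1 /\ dot ut ut = 1 /\ dot u ut = 0 /\ cross u ut = nrm s.
Proof.
intros Hs u ut; destruct cyc as (_ & _ & _ & _ & _ & On & _).
destruct (On s Hs) as (_ & H11 & H22 & H12).
assert (T := sin2_cos2 t); unfold Rsqr in T.
unfold u, ut, lin, nrm; revert H11 H22 H12; generalize (e1 s) (e2 s); intros a b Ha Hb Hab.
split; [|split; [|split]].
- transitivity (cos t * cos t * dot a a + 2 * cos t * sin t * dot a b + sin t * sin t * dot b b);
    [r3_ring|rewrite Ha, Hb, Hab; lra].
- transitivity (cos t * cos t * dot b b - 2 * cos t * sin t * dot a b + sin t * sin t * dot a a);
    [r3_ring|rewrite Ha, Hb, Hab; lra].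
- transitivity (cos t * sin t * (dot b b - dot a a) + (cos t * cos t - sin t * sin t) * dot a b);
    [r3_ring|rewrite Ha, Hb, Hab; lra].
- transitivity (scal (sin t * sin t + cos t * cos t) (cross a b)); [apply R3_ext; r3_ring|].
  rewrite T; apply R3_ext; r3_ring.
Qed.

Lemma circ_parallel s t : I s ->
  let u := lin (e1 s) (e2 s) t in let ut := lin (e2 s) (opp (e1 s)) t in
  let c1 := D3 C 1 s in let c2 := D3 C 2 s in
  let r1 := Derive_n r 1 s in let r2 := Derive_n r 2 s in
  let v := plus c1 (scal r1 u) in
  circ_normal C e1 e2 r s t = scal (r s) (minus (scal (dot c1 u + r1) (nrm s)) (scal (dot c1 (nrm s)) u)) /\
  circ_flat_trace C e1 e2 r s t =
  r s ^ 2 * (r s * hdot ut ut * ((dot c1 u + r1) * dot c2 (nrm s) - dot c1 (nrm s) * (dot c2 u + r2))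
           + dot c1 (nrm s) * hdot v v).
Proof.
intros Hs u ut c1 c2 r1 r2 v.
destruct (cyclic_frame_relations s Hs) as ((D11 & D22 & D12) & (S11 & S22 & S12)).
destruct (lin_orthonormal s t Hs) as (U1 & U2 & U3 & U4).
destruct (parallel_planes s Hs) as [P1 P2].
(* As the normal is constant, it may be frozen at [s]: differentiating [e1'.n = 0] and [e2'.n = 0]
   then produces no term in [n']. *)
assert (Q : dot (D3 e1 2 s) (nrm s) = 0 /\ dot (D3 e2 2 s) (nrm s) = 0).
{ destruct cyc as ((_ & Io & _) & _ & S1 & S2 & _ & _ & _).
  split.
  - apply (is_derive_locally_const I (fun x => dot (D3 e1 1 x) (nrm s)) 0 s); try assumption.
    + intros x Hx; rewrite (nrm_const s x Hs Hx); now apply parallel_planes.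
    + replace (dot (D3 e1 2 s) (nrm s)) with (dot (D3 e1 2 s) (nrm s) + dot (D3 e1 1 s) zero)
        by (unfold nrm; r3_ring).
      apply (is_derive_dot (D3 e1 1) (fun _ => nrm s)); [now apply smooth_curve_derive with I|apply is_derive3_const].
  - apply (is_derive_locally_const I (fun x => dot (D3 e2 1 x) (nrm s)) 0 s); try assumption.
    + intros x Hx; rewrite (nrm_const s x Hs Hx); now apply parallel_planes.
    + replace (dot (D3 e2 2 s) (nrm s)) with (dot (D3 e2 2 s) (nrm s) + dot (D3 e2 1 s) zero)
        by (unfold nrm; r3_ring).
      apply (is_derive_dot (D3 e2 1) (fun _ => nrm s)); [now apply smooth_curve_derive with I|apply is_derive3_const]. }
destruct Q as [Q1 Q2].
destruct cyc as (_ & _ & _ & _ & _ & On & _).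
destruct (On s Hs) as (_ & H11 & H22 & H12).
destruct (frame_derivatives _ _ _ _ H11 H22 H12 D11 D22 D12) as [F1 F2].
destruct (orthonormal_cross _ _ H11 H22 H12) as (_ & _ & _ & Ex).
fold (nrm s) in *.
set (k := dot (D3 e1 1 s) (e2 s)) in *.
rewrite P1 in F1; rewrite P2 in F2.
assert (F1' : D3 e1 1 s = scal k (e2 s)) by (rewrite F1 at 1; apply R3_ext; r3_ring).
assert (F2' : D3 e2 1 s = scal (- k) (e1 s)) by (rewrite F2 at 1; apply R3_ext; r3_ring).
set (k1 := dot (D3 e1 2 s) (e2 s)).
assert (K11 : dot (D3 e1 1 s) (D3 e1 1 s) = k ^ 2).
{ transitivity (k ^ 2 * dot (e2 s) (e2 s)); [rewrite F1'; clearbody k; r3_ring|rewrite H22; ring]. }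
assert (K22 : dot (D3 e2 1 s) (D3 e2 1 s) = k ^ 2).
{ transitivity (k ^ 2 * dot (e1 s) (e1 s)); [rewrite F2'; clearbody k; r3_ring|rewrite H11; ring]. }
assert (K12 : dot (D3 e1 1 s) (D3 e2 1 s) = 0).
{ transitivity (- k ^ 2 * dot (e1 s) (e2 s)); [rewrite F1', F2'; clearbody k; r3_ring|rewrite H12; ring]. }
assert (G1 : D3 e1 2 s = plus (scal (- k ^ 2) (e1 s)) (scal k1 (e2 s))).
{ rewrite (Ex (D3 e1 2 s)) at 1; fold k1; rewrite Q1.
  replace (dot (D3 e1 2 s) (e1 s)) with (- k ^ 2) by (rewrite dot_comm; lra).
  clearbody k k1; apply R3_ext; r3_ring. }
assert (G2 : D3 e2 2 s = plus (scal (- k1) (e1 s)) (scal (- k ^ 2) (e2 s))).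
{ rewrite (Ex (D3 e2 2 s)) at 1; rewrite Q2.
  replace (dot (D3 e2 2 s) (e2 s)) with (- k ^ 2) by (rewrite dot_comm; lra).
  replace (dot (D3 e2 2 s) (e1 s)) with (- k1)
    by (unfold k1; rewrite (dot_comm (D3 e2 2 s)), (dot_comm (D3 e1 2 s)); lra).
  clearbody k k1; apply R3_ext; r3_ring. }
assert (P := flat_trace_parallel u ut (nrm s) c1 c2 (r s) r1 r2 k k1 U1 U2 U3 U4).
cbv zeta in P; fold v in P.
assert (Xs : circ_s C e1 e2 r s t = plus c1 (plus (scal r1 u) (scal (r s * k) ut))).
{ unfold circ_s; rewrite F1', F2'; fold c1 r1 u; unfold ut, lin.
  clearbody k c1 r1 u; apply R3_ext; r3_ring. }
assert (Xss : circ_ss C e1 e2 r s t = plus c2 (plus (scal r2 u) (plus (scal (2 * r1 * k) ut)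
               (scal (r s) (minus (scal k1 ut) (scal (k ^ 2) u)))))).
{ unfold circ_ss; rewrite F1', F2', G1, G2; fold c2 r1 r2; unfold u, ut, lin, minus.
  clearbody k k1 c2 r1 r2; apply R3_ext; r3_ring. }
assert (Xst : circ_st e1 e2 r s t = minus (scal r1 ut) (scal (r s * k) u)).
{ unfold circ_st; rewrite F1', F2'; fold r1; unfold u, ut, lin, minus.
  clearbody k r1; apply R3_ext; r3_ring. }
assert (Xtt : circ_tt e1 e2 r s t = scal (- r s) u).
{ unfold circ_tt, u, lin; apply R3_ext; r3_ring. }
unfold circ_normal, circ_flat_trace; rewrite Xs, Xss, Xst, Xtt.
exact P.
Qed.

End Parallel.

(** * Circles in non-horizontal planes *)

(** For a tilted plane the horizontal length of the tangent to the circle has degree 2 in the angle,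
    so the equation has degree 3. The top coefficient reduces the bracket to the constant [K], and
    four well chosen points then give a sum of nonnegative terms equal to zero. *)
Lemma tilted_trace_zero (a b n c1 c2 : R3) (r r1 r2 : R) :
  0 < r -> dot a a = 1 -> dot b b = 1 -> dot a b = 0 -> 0 < pz a ^ 2 + pz b ^ 2 <= 1 ->
  (forall t, let u := lin a b t in let ut := lin b (opp a) t in let v := plus c1 (scal r1 u) in
     r * hdot ut ut * ((dot c1 u + r1) * dot c2 n - dot c1 n * (dot c2 u + r2))
           + dot c1 n * hdot v v = 0) ->
  dot c1 n <> 0 -> px c1 = 0 /\ py c1 = 0 /\ r1 = 0.
Proof.
intros Hr Ha Hb Hab Hz H D0.
set (D := dot c1 n) in *; set (D1 := dot c2 n) in *.
set (M := dot c1 a * D1 - D * dot c2 a).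
set (N := dot c1 b * D1 - D * dot c2 b).
set (K := r1 * D1 - D * r2).
assert (MN : forall t, (dot c1 (lin a b t) + r1) * D1 - D * (dot c2 (lin a b t) + r2)
  = (cos t * M + sin t * N) + K).
{ intros t; unfold M, N, K, lin; clearbody D D1; r3_ring. }
assert (Z : M = 0 /\ N = 0).
{ assert (Lu := lead3_lin a b). assert (Lt := lead3_lin b (opp a)).
  assert (Lg := lead_hdot _ _ _ _ _ _ _ _ Lt Lt).
  assert (Lv := lead3_const_plus c1 _ _ _ _ (lead3_scal r1 _ _ _ _ Lu)).
  assert (Lh := trig_lead 2 _ (lead_trig _ _ _ (lead_hdot _ _ _ _ _ _ _ _ Lv Lv))).
  assert (Lm := lead_plus _ _ _ _ _ (lead_cos_sin M N) (trig_lead 0 _ (trig_const 0 K))).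
  (* The summand with the speed has degree at most 2, so frequency 3 comes from the first product
     alone; its coefficient is [(r / 4) E_z^2 (M - i N)], and [E_z] is nonzero because the plane is
     tilted. *)
  assert (L := lead_plus _ _ _ _ _ (lead_mult _ _ _ _ _ _ (lead_scal _ r _ _ Lg) Lm)
     (lead_scal _ D _ _ Lh)).
  apply lead_zero in L.
  2:{ intros t; cbv beta; rewrite <- MN; apply H. }
  set (E := (pz a, - pz b) : C).
  assert (L' : (RtoC (r / 4) * (E * E * (M, (- N)%R)))%C = RtoC 0).
  { rewrite <- L.
    replace ((px b, (- px (opp a))%R) * (px b, (- px (opp a))%R)
      + (py b, (- py (opp a))%R) * (py b, (- py (opp a))%R))%C with (E * E)%C.
    - rewrite RtoC_div by lra; field.
    - change (px (opp a)) with (- px a); change (py (opp a)) with (- py a).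
      unfold E; revert Ha Hb Hab; unfold dot; clear; intros.
      apply injective_projections; simpl; lra. }
  assert (E0 : E <> RtoC 0).
  { intros HE; assert (F1 := f_equal fst HE); assert (F2 := f_equal snd HE); simpl in F1, F2.
    assert (pz b = 0) by lra. rewrite F1, H0 in Hz; lra. }
  destruct (Ceq_dec (M, - N) (RtoC 0)) as [HMN|HMN].
  - split.
    + exact (f_equal fst HMN).
    + apply (f_equal snd) in HMN; simpl in HMN; lra.
  - exfalso; revert L'; repeat apply Cmult_neq_0; try assumption.
    intros F; apply RtoC_inj in F; lra. }
destruct Z as [ZM ZN].
assert (H' : forall t, r * hdot (lin b (opp a) t) (lin b (opp a) t) * K
   + D * hdot (plus c1 (scal r1 (lin a b t))) (plus c1 (scal r1 (lin a b t))) = 0).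
{ intros t; rewrite <- (H t); cbv zeta; rewrite MN, ZM, ZN; ring. }
clear H MN.
set (k := sqrt (pz a ^ 2 + pz b ^ 2)).
assert (k0 : 0 < k) by (apply sqrt_lt_R0; lra).
assert (k2 : k ^ 2 = pz a ^ 2 + pz b ^ 2) by (apply pow2_sqrt; lra).
(* This angle is that of the highest point of the circle: [u] has height [k] there and the tangent
   [w] is horizontal. *)
destruct (angle_exists (pz a) (pz b) k k0 (eq_sym k2)) as (t & Ca & Sb).
set (u := lin a b t). set (w := lin b (opp a) t).
assert (T := sin2_cos2 t); unfold Rsqr in T.
assert (uu : hdot u u = 1 - k ^ 2).
{ transitivity (cos t ^ 2 * dot a a + 2 * cos t * sin t * dot a b + sin t ^ 2 * dot b b
    - (cos t * pz a + sin t * pz b) ^ 2); [unfold u, lin; r3_ring|].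
  rewrite Ha, Hb, Hab, Ca, Sb.
  replace (cos t * (k * cos t) + sin t * (k * sin t)) with (k * (sin t * sin t + cos t * cos t)) by ring.
  rewrite T; replace (cos t ^ 2) with (1 - sin t ^ 2) by (simpl; lra); ring. }
assert (ww : hdot w w = 1).
{ transitivity (cos t ^ 2 * dot b b - 2 * cos t * sin t * dot a b + sin t ^ 2 * dot a a
    - (cos t * pz b - sin t * pz a) ^ 2); [unfold w, lin; r3_ring|].
  rewrite Ha, Hb, Hab, Ca, Sb.
  replace (cos t ^ 2) with (1 - sin t ^ 2) by (simpl; lra); ring. }
assert (E1 := H' t). assert (E2 := H' (t + PI)).
assert (E3 := H' (t + PI / 2)). assert (E4 := H' (t + PI / 2 + PI)).
assert (S1 : forall x p q, lin p q (x + PI) = opp (lin p q x)).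
{ intros; unfold lin; rewrite neg_cos, neg_sin; apply R3_ext; r3_ring. }
assert (S2 : forall x p q, lin p q (x + PI / 2) = lin q (opp p) x).
{ intros; unfold lin; rewrite cos_plus, sin_plus, cos_PI2, sin_PI2; apply R3_ext; r3_ring. }
rewrite !S1 in E2, E4; rewrite !S2 in E3, E4.
replace (lin (opp a) (opp b) t) with (opp u) in E3, E4 by (unfold u, lin; apply R3_ext; r3_ring).
fold u w in E1, E2, E3, E4.
assert (X : forall p, hdot (opp p) (opp p) = hdot p p) by r3_ring.
assert (Y : forall p, hdot (plus c1 (scal r1 p)) (plus c1 (scal r1 p))
  = hdot c1 c1 + 2 * r1 * hdot c1 p + r1 ^ 2 * hdot p p) by r3_ring.
assert (W : forall p, hdot c1 (opp p) = - hdot c1 p) by r3_ring.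
rewrite Y, uu, ww in E1. rewrite Y, W, !X, uu, ww in E2.
rewrite Y, X, uu, ww in E3. rewrite Y, W, !X, uu, ww in E4.
set (h := hdot c1 c1) in *.
(* Averaging over two antipodal points removes the term linear in [r1]. The highest and lowest
   points give [G1], the two points at a quarter turn give [G2], and their difference determines
   [r K]. *)
assert (G1 : r * K + D * (h + r1 ^ 2 * (1 - k ^ 2)) = 0) by lra.
assert (G2 : r * (1 - k ^ 2) * K + D * (h + r1 ^ 2) = 0) by lra.
assert (G3 : k ^ 2 * (r * K - D * r1 ^ 2) = 0) by lra.
assert (k2p : 0 < k ^ 2) by now apply pow_lt.
apply Rmult_integral in G3; destruct G3 as [G3|G3]; [lra|].
assert (G4 : D * (h + r1 ^ 2 * (2 - k ^ 2)) = 0) by (assert (r * K = D * r1 ^ 2) by lra; nra).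
apply Rmult_integral in G4; destruct G4 as [G4|G4]; [contradiction|].
unfold h, hdot in G4.
assert (0 <= r1 ^ 2) by apply pow2_ge_0.
assert (0 <= r1 ^ 2 * (1 - k ^ 2)) by (apply Rmult_le_pos; lra).
assert (R1 : r1 ^ 2 = 0) by nra.
assert (px c1 * px c1 + py c1 * py c1 = 0) by nra.
split; [nra|split; nra].
Qed.

Section Tilted.

Variables (I : R -> Prop) (C e1 e2 : R -> R3) (r : R -> R).
Hypotheses (cyc : cyclic I C e1 e2 r) (mini : dirichlet_minimal_on I (circles C e1 e2 r)).

Let nrm (s : R) : R3 := cross (e1 s) (e2 s).

(** Both cases of the dichotomy lead to the same infinitesimal motion. A circle translated
    vertically sweeps a vertical cylinder, which is why the height of the normal then vanishes. *)
Lemma tilted_pointwise s : I s -> pz (nrm s) ^ 2 <> 1 -> dot (D3 C 1 s) (nrm s) <> 0 ->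
  (px (D3 C 1 s) = 0 /\ py (D3 C 1 s) = 0 /\ Derive_n r 1 s = 0) /\
  forall t, pz (circ_normal C e1 e2 r s t) = 0.
Proof.
intros Hs Hn D0.
assert (Hz : pz (e1 s) ^ 2 + pz (e2 s) ^ 2 + pz (nrm s) ^ 2 = 1) by exact (frame_height I C e1 e2 r cyc s Hs).
assert (0 < r s /\ dot (e1 s) (e1 s) = 1 /\ dot (e2 s) (e2 s) = 1 /\ dot (e1 s) (e2 s) = 0)
  as (r0 & H11 & H22 & H12) by (apply cyc; exact Hs).
assert (P := fun t => circ_parallel I C e1 e2 r cyc mini s t Hs); cbv zeta in P; fold (nrm s) in P.
assert (F : (px (D3 C 1 s) = 0 /\ py (D3 C 1 s) = 0 /\ Derive_n r 1 s = 0) ->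
  forall t, pz (circ_normal C e1 e2 r s t) = 0).
{ intros (Z1 & Z2 & Z3) t; destruct (P t) as [-> _]; rewrite Z3.
  set (u := lin _ _ _); unfold dot, minus; rewrite Z1, Z2.
  rewrite !R3_scalE, R3_oppE, R3_plusE; unfold px, py, pz; cbn [fst snd]; ring. }
enough (Z : px (D3 C 1 s) = 0 /\ py (D3 C 1 s) = 0 /\ Derive_n r 1 s = 0) by (split; auto).
clear F; destruct (circ_dichotomy I C e1 e2 r cyc mini s Hs) as [Z|Z].
- set (c1 := D3 C 1 s) in *; set (r1 := Derive_n r 1 s) in *.
  assert (Z' : forall t, px c1 * py (lin (e2 s) (opp (e1 s)) t)
    - py c1 * px (lin (e2 s) (opp (e1 s)) t) + r1 * pz (nrm s) = 0).
  { intros t; destruct (lin_orthonormal I C e1 e2 r cyc s t Hs) as (U1 & U2 & U3 & U4).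
    destruct (P t) as [E _]; assert (Z2 := Z t); rewrite E in Z2; clear Z E.
    cbv beta in Z2; change (cross (e1 s) (e2 s)) with (nrm s) in Z2.
    set (u := lin (e1 s) (e2 s) t) in *; set (ut := lin (e2 s) (opp (e1 s)) t) in *.
    assert (X := cross_orthonormal u ut (nrm s) c1 U1 U2 U3 U4).
    apply (f_equal pz) in X; clearbody c1; autorewrite with r3 in X, Z2.
    apply Rmult_integral in Z2; destruct Z2 as [Z2|Z2]; [lra|].
    lra. }
  (* In this case the expression has degree one in the angle; these three values separate its
     constant term and its two coefficients. *)
  assert (A0 := Z' 0). assert (A1 := Z' (PI / 2)). assert (A2 := Z' PI).
  clear Z Z' P.
  unfold lin in A0, A1, A2; rewrite cos_0, sin_0 in A0; rewrite cos_PI2, sin_PI2 in A1;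
    rewrite cos_PI, sin_PI in A2.
  revert A0 A1 A2 D0; unfold nrm, cross, dot; rewrite ?R3_scalE, ?R3_oppE, ?R3_plusE, ?R3_scalE, ?R3_oppE.
  clearbody c1 r1; destruct (e1 s) as [[x1 y1] z1], (e2 s) as [[x2 y2] z2], c1 as [[a b] c].
  unfold px, py, pz; cbn [fst snd]; intros A0 A1 A2 D0.
  set (nz := x1 * y2 - y1 * x2) in *.
  assert (R0 : r1 * nz = 0) by lra.
  assert (B0 : a * y2 - b * x2 = 0) by lra.
  assert (B1 : a * y1 - b * x1 = 0) by lra.
  assert (Ca : a * nz = 0).
  { unfold nz; transitivity (x1 * (a * y2 - b * x2) - x2 * (a * y1 - b * x1)); [ring|rewrite B0, B1; ring]. }
  assert (Cb : b * nz = 0).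
  { unfold nz; transitivity (y1 * (a * y2 - b * x2) - y2 * (a * y1 - b * x1)); [ring|rewrite B0, B1; ring]. }
  destruct (Req_dec nz 0) as [N0|N0].
  (* If the normal is horizontal, the speed across the plane is a combination of the two vanishing
     coefficients. *)
  + exfalso; apply D0; rewrite N0.
    transitivity (z2 * (a * y1 - b * x1) - z1 * (a * y2 - b * x2)); [ring|rewrite B0, B1; ring].
  + apply Rmult_integral in Ca; apply Rmult_integral in Cb; apply Rmult_integral in R0; tauto.
- apply (tilted_trace_zero (e1 s) (e2 s) (nrm s) (D3 C 1 s) (D3 C 2 s) (r s) _ (Derive_n r 2 s));
    try assumption; [assert (0 <= pz (nrm s) ^ 2) by apply pow2_ge_0|].
  + split; [|lra]. assert (0 <= pz (e1 s) ^ 2) by apply pow2_ge_0.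
    assert (0 <= pz (e2 s) ^ 2) by apply pow2_ge_0. lra.
  + intros t; specialize (Z t); destruct (P t) as [_ E]; rewrite E in Z.
    apply Rmult_integral in Z; destruct Z as [Z|Z]; [|exact Z].
    assert (0 < r s ^ 2) by now apply pow_lt. lra.
Qed.

Lemma planar_of_vanishing_speed n0 : n0 <> zero ->
  (forall s, I s -> nrm s = n0 /\ dot (D3 C 1 s) n0 = 0) ->
  planar (surface I (circles C e1 e2 r)).
Proof.
intros N0 H.
destruct cyc as (Int & S0 & _).
destruct (proj1 Int) as [s0 Hs0].
exists n0, (dot (C s0) n0); split; [exact N0|].
intros p (s & t & Hs & ->).
replace (dot n0 (circles C e1 e2 r s t)) with (dot (C s) n0).
- apply (interval_derive_0 I (fun s => dot (C s) n0) Int); [|assumption|assumption].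
  intros x Hx; replace 0 with (dot (D3 C 1 x) n0 + dot (C x) zero).
  + apply (is_derive_dot C (fun _ => n0)); [now apply smooth_curve_derive_0 with I|apply is_derive3_const].
  + destruct (H x Hx) as [_ ->]; r3_ring.
- destruct (H s Hs) as [<- _]; unfold nrm, circles; r3_ring.
Qed.

(** If one circle left its plane, the sign of the function [f] below would make all of them do so,
    and the height of the normal would vanish on the whole surface. This contradicts the point with
    [nu_3 <> 0] that [dirichlet_minimal_on] provides. *)
Lemma tilted_planar s0 : I s0 -> pz (nrm s0) ^ 2 <> 1 ->
  planar (surface I (circles C e1 e2 r)).
Proof.
intros Hs0 Hn.
assert (Nc : forall s, I s -> nrm s = nrm s0).
{ intros s Hs; exact (nrm_const I C e1 e2 r cyc mini s s0 Hs Hs0). }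
apply (planar_of_vanishing_speed (nrm s0)).
{ intros Z; assert (U := lin_orthonormal I C e1 e2 r cyc s0 0 Hs0); cbv zeta in U.
  destruct U as (U1 & U2 & U3 & U4); change (cross (e1 s0) (e2 s0)) with (nrm s0) in U4.
  destruct (orthonormal_cross _ _ U1 U2 U3) as [Nn _]; rewrite U4, Z in Nn.
  unfold dot in Nn; autorewrite with r3 in Nn; lra. }
intros s1 Hs1; split; [now apply Nc|].
destruct (Req_dec (dot (D3 C 1 s1) (nrm s0)) 0) as [|D0]; [assumption|exfalso].
assert (Tp : forall s, I s -> dot (D3 C 1 s) (nrm s0) <> 0 ->
  (px (D3 C 1 s) = 0 /\ py (D3 C 1 s) = 0 /\ Derive_n r 1 s = 0) /\
  forall t, pz (circ_normal C e1 e2 r s t) = 0).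
{ intros s Hs D; apply tilted_pointwise; rewrite ?(Nc s Hs); assumption. }
(* Where the circle leaves its plane, the subtracted squares vanish and [f] is positive. Where it
   stays in its plane, [f] is at most 0, and [f = 0] would mean that the center and the radius are
   both stationary, against the immersion. So [f] has no zero and keeps its sign. *)
set (f := fun s => dot (D3 C 1 s) (nrm s0) ^ 2
   - (px (D3 C 1 s) ^ 2 + py (D3 C 1 s) ^ 2 + Derive_n r 1 s ^ 2)).
assert (nz0 : pz (nrm s0) <> 0).
{ intros Z; apply D0; destruct (Tp s1 Hs1 D0) as [(Z1 & Z2 & _) _].
  unfold dot; rewrite Z, Z1, Z2; ring. }
destruct cyc as (Int & S0 & _ & _ & Sr & _ & Imm).
assert (Cf : forall s, I s -> continuous f s).
{ intros s Hs; apply (ex_derive_continuous f).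
  destruct (smooth_curve_derive I C 1 s S0 Hs) as (Hx & Hy & Hz).
  assert (Hr := smooth_on_derive I r 1 s Sr Hs).
  assert (Hd := is_derive_dot (D3 C 1) (fun _ => nrm s0) s _ _ (smooth_curve_derive I C 1 s S0 Hs) (is_derive3_const _ s)).
  assert (P : forall g g', is_derive g s g' -> ex_derive (fun x => g x ^ 2) s).
  { intros g g' Hg; apply (ex_derive_pow g 2); eexists; exact Hg. }
  unfold f; apply @ex_derive_minus; [exact (P _ _ Hd)|].
  apply @ex_derive_plus; [apply @ex_derive_plus|]; eapply P; eassumption. }
assert (Nf : forall s, I s -> f s <> 0).
{ intros s Hs F; unfold f in F.
  destruct (Req_dec (dot (D3 C 1 s) (nrm s0)) 0) as [D|D].
  - rewrite D in F.
    assert (Hx : px (D3 C 1 s) = 0) by nra.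
    assert (Hy : py (D3 C 1 s) = 0) by nra.
    assert (Hr : Derive_n r 1 s = 0) by nra.
    apply (Imm s 0 Hs). rewrite (normal_field_circles C e1 e2 r I) by apply cyc || assumption.
    destruct (circ_parallel I C e1 e2 r cyc mini s 0 Hs) as [E _].
    change (cross (e1 s) (e2 s)) with (nrm s) in E; rewrite (Nc s Hs) in E.
    assert (Hz : pz (D3 C 1 s) = 0).
    { unfold dot in D; rewrite Hx, Hy in D.
      assert (D' : pz (D3 C 1 s) * pz (nrm s0) = 0) by lra.
      apply Rmult_integral in D'; tauto. }
    assert (CZ : D3 C 1 s = zero) by (apply R3_ext; assumption).
    rewrite E, Hr, CZ. generalize (lin (e1 s) (e2 s) 0) (nrm s0); intros; apply R3_ext; r3_ring.
  - destruct (Tp s Hs D) as [(Z1 & Z2 & Z3) _]; rewrite Z1, Z2, Z3 in F; nra. }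
destruct mini as [(s & t & Hs & Hnz) _].
assert (F1 : 0 < f s1).
{ unfold f; destruct (Tp s1 Hs1 D0) as [(-> & -> & ->) _]; nra. }
assert (F := interval_constant_sign I f Int Cf Nf s1 s Hs1 Hs F1).
destruct (Tp s Hs) as [_ Z].
- intros D; unfold f in F; rewrite D in F.
  assert (0 <= px (D3 C 1 s) ^ 2) by apply pow2_ge_0.
  assert (0 <= py (D3 C 1 s) ^ 2) by apply pow2_ge_0.
  assert (0 <= Derive_n r 1 s ^ 2) by apply pow2_ge_0. lra.
- apply Hnz; unfold unit_normal; rewrite (normal_field_circles C e1 e2 r I) by apply cyc || assumption.
  rewrite px_scal || rewrite pz_scal; rewrite Z; ring.
Qed.

End Tilted.

(** * Horizontal circles *)

(** The integrating factor: [f] times the exponential of minus the integral of [k] has zero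
    derivative. *)
Lemma linear_ode_zero (I : R -> Prop) (f k : R -> R) :
  nonempty_open_interval I ->
  (forall s, I s -> continuous k s) -> (forall s, I s -> is_derive f s (k s * f s)) ->
  forall a b, I a -> I b -> f a = 0 -> f b = 0.
Proof.
intros Int Ck Df a b Ha Hb Fa.
destruct Int as (Ne & Io & Iv).
assert (Sub : forall s x, I s -> Rmin a s <= x <= Rmax a s -> I x).
{ intros s x Hs Hx; destruct (Rle_lt_dec a s).
  - apply (Iv a x s); trivial. rewrite Rmin_left, Rmax_right in Hx; lra.
  - apply (Iv s x a); trivial. rewrite Rmin_right, Rmax_left in Hx; lra. }
assert (DK : forall s, I s -> is_derive (RInt k a) s (k s)).
{ intros s Hs; apply (is_derive_RInt k (RInt k a) a s); [|now apply Ck].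
  apply filter_imp with (2 := Io s Hs); intros x Hx.
  apply (RInt_correct (V := R_CompleteNormedModule)), (ex_RInt_continuous (V := R_CompleteNormedModule)); intros y Hy; apply Ck; now apply (Sub x). }
assert (G : forall s, I s -> is_derive (fun s => f s * exp (- RInt k a s)) s 0).
{ intros s Hs.
  replace 0 with ((k s * f s) * exp (- RInt k a s) + f s * (- k s * exp (- RInt k a s))) by ring.
  apply (is_derive_mult (K := R_AbsRing) f (fun s => exp (- RInt k a s))); [now apply Df| |apply Rmult_comm].
  apply (is_derive_comp (V := R_NormedModule) exp (fun s => - RInt k a s)).
  - apply is_derive_exp.
  - now apply (is_derive_opp (V := R_NormedModule)), DK. }
assert (E := interval_derive_0 I _ (conj Ne (conj Io Iv)) G b a Hb Ha); cbv beta in E.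
rewrite Fa in E.
assert (P := exp_pos (- RInt k a b)).
assert (Z : f b * exp (- RInt k a b) = 0) by lra.
apply Rmult_integral in Z; lra.
Qed.

Lemma continuous_nonzero (f : R -> R) (s : R) : continuous f s -> f s <> 0 -> locally s (fun x => f x <> 0).
Proof. intros Cf N; exact (Cf (fun v => v <> 0) (open_neq 0 _ N)). Qed.

(** Where [z1] and [r] are nonzero, this is [- z1^2 r^3] times the derivative of [c1 / (z1 r^2)].
    Both equations are cleared of denominators so that they make sense where [z1] vanishes. *)
Definition center_equation (c1 c2 z1 z2 r r1 : R) : R :=
  r * (z2 * c1 - z1 * c2) + 2 * z1 * r1 * c1.
Definition radius_equation (r r1 r2 z1 z2 S : R) : R :=
  r * (z2 * r1 - z1 * r2) + z1 * S.

Lemma ex_derive_center_equation (c1 c2 z1 z2 r r1 : R -> R) (s : R) :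
  ex_derive c1 s -> ex_derive c2 s -> ex_derive z1 s -> ex_derive z2 s ->
  ex_derive r s -> ex_derive r1 s ->
  ex_derive (fun s => center_equation (c1 s) (c2 s) (z1 s) (z2 s) (r s) (r1 s)) s.
Proof. intros; unfold center_equation; auto_derive; tauto. Qed.

Lemma ex_derive_radius_equation (r r1 r2 z1 z2 a b : R -> R) (s : R) :
  ex_derive r s -> ex_derive r1 s -> ex_derive r2 s -> ex_derive z1 s -> ex_derive z2 s ->
  ex_derive a s -> ex_derive b s ->
  ex_derive (fun s => radius_equation (r s) (r1 s) (r2 s) (z1 s) (z2 s) (a s ^ 2 + b s ^ 2 + r1 s ^ 2)) s.
Proof. intros; unfold radius_equation; auto_derive; tauto. Qed.

(* [z1 ^ 2 / (a ^ 2 + b ^ 2 + c ^ 2 + z1 ^ 2)] solves a linear equation, so that it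
   vanishes identically or nowhere. *)
Definition slope_rate (a b c z r : R) : R :=
  - (2 * c * (3 * (a ^ 2 + b ^ 2) + c ^ 2)) / (r * (a ^ 2 + b ^ 2 + c ^ 2 + z ^ 2)).

(** Writing [S = a^2 + b^2 + c^2] and [W = S' / 2], the derivative is
    [2 z (z' S - z W) / (S + z^2)^2]. Adding [a], [b], [c] times the three equations expresses
    [z' S - z W] as a multiple of [z], so the right side is a multiple of the quotient without any
    division by [z]. *)
Lemma is_derive_slope (a b c z : R -> R) (s a' b' c' z' r : R) :
  is_derive a s a' -> is_derive b s b' -> is_derive c s c' -> is_derive z s z' ->
  r <> 0 -> a s ^ 2 + b s ^ 2 + c s ^ 2 + z s ^ 2 <> 0 ->
  center_equation (a s) a' (z s) z' r (c s) = 0 ->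
  center_equation (b s) b' (z s) z' r (c s) = 0 ->
  radius_equation r (c s) c' (z s) z' (a s ^ 2 + b s ^ 2 + c s ^ 2) = 0 ->
  is_derive (fun s => z s ^ 2 / (a s ^ 2 + b s ^ 2 + c s ^ 2 + z s ^ 2)) s
    (slope_rate (a s) (b s) (c s) (z s) r * (z s ^ 2 / (a s ^ 2 + b s ^ 2 + c s ^ 2 + z s ^ 2))).
Proof.
unfold center_equation, radius_equation; intros Ha Hb Hc Hz r0 S0 E1 E2 E3.
auto_derive.
- repeat split; try (eexists; eassumption). simpl in S0; exact S0.
- rewrite (is_derive_unique (fun s : R => a s) _ _ Ha), (is_derive_unique (fun s : R => b s) _ _ Hb),
    (is_derive_unique (fun s : R => c s) _ _ Hc), (is_derive_unique (fun s : R => z s) _ _ Hz).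
  set (A := a s) in *; set (B := b s) in *; set (c0 := c s) in *; set (Z := z s) in *.
  set (W := A * a' + B * b' + c0 * c').
  set (S := A ^ 2 + B ^ 2 + c0 ^ 2).
  assert (E : z' * S - Z * W = - Z * c0 * (3 * (A ^ 2 + B ^ 2) + c0 ^ 2) / r).
  { apply (Rmult_eq_reg_l r); [|assumption].
    transitivity (- Z * c0 * (3 * (A ^ 2 + B ^ 2) + c0 ^ 2)); [|now field].
    assert (A * (r * (z' * A - Z * a') + 2 * Z * c0 * A) = 0) by (rewrite E1; ring).
    assert (B * (r * (z' * B - Z * b') + 2 * Z * c0 * B) = 0) by (rewrite E2; ring).
    assert (c0 * (r * (z' * c0 - Z * c') + Z * (A ^ 2 + B ^ 2 + c0 ^ 2)) = 0) by (rewrite E3; ring).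
    unfold S, W; lra. }
  transitivity (2 * Z * (z' * S - Z * W) / (S + Z ^ 2) ^ 2).
  + unfold S, W in *; field; exact S0.
  + rewrite E; unfold slope_rate, S in *; field; split; assumption.
Qed.

Section Horizontal.

Variables (I : R -> Prop) (C e1 e2 : R -> R3) (r : R -> R).
Hypotheses (cyc : cyclic I C e1 e2 r) (mini : dirichlet_minimal_on I (circles C e1 e2 r)).
Hypothesis hor : forall s, I s -> pz (e1 s) = 0 /\ pz (e2 s) = 0.

Let C1 := D3 C 1.
Let C2 := D3 C 2.
Let r1 := Derive_n r 1.
Let r2 := Derive_n r 2.
Let speed2 (s : R) : R := px (C1 s) ^ 2 + py (C1 s) ^ 2 + r1 s ^ 2.

Lemma horizontal_normal s : I s ->
  exists eps, eps ^ 2 = 1 /\ cross (e1 s) (e2 s) = (0, 0, eps).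
Proof.
intros Hs; destruct (hor s Hs) as [Z1 Z2].
assert (H := frame_height I C e1 e2 r cyc s Hs); cbv beta in H.
exists (pz (cross (e1 s) (e2 s))); split; [rewrite Z1, Z2 in H; lra|].
apply R3_ext; autorewrite with r3; rewrite ?Z1, ?Z2; unfold px, py, pz; simpl; ring.
Qed.

(** For a horizontal frame the radial and tangential vectors have horizontal length 1, so the trace
    has only degree one in the angle. Its two coefficients give the center equations and its
    constant term the radius equation; the first alternative is that of a vertical surface along the
    circle. *)
Lemma horizontal_pointwise s : I s ->
  (px (C1 s) = 0 /\ py (C1 s) = 0 /\ r1 s = 0) \/
  (center_equation (px (C1 s)) (px (C2 s)) (pz (C1 s)) (pz (C2 s)) (r s) (r1 s) = 0 /\
   center_equation (py (C1 s)) (py (C2 s)) (pz (C1 s)) (pz (C2 s)) (r s) (r1 s) = 0 /\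
   radius_equation (r s) (r1 s) (r2 s) (pz (C1 s)) (pz (C2 s)) (speed2 s) = 0).
Proof.
intros Hs; destruct (hor s Hs) as [Z1 Z2].
assert (0 < r s /\ dot (e1 s) (e1 s) = 1 /\ dot (e2 s) (e2 s) = 1 /\ dot (e1 s) (e2 s) = 0)
  as (r0 & H11 & H22 & H12) by (apply cyc; exact Hs).
destruct (orthonormal_cross _ _ H11 H22 H12) as (_ & _ & _ & Ex).
destruct (horizontal_normal s Hs) as (eps & He & Hn).
assert (eps0 : eps <> 0) by nra.
assert (P := fun t => circ_parallel I C e1 e2 r cyc mini s t Hs); cbv beta zeta in P.
rewrite Hn in *; fold C1 C2 r1 r2 in P.
assert (W : forall w : R3, dot w (e1 s) = 0 -> dot w (e2 s) = 0 -> px w = 0 /\ py w = 0).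
{ intros w W1 W2; rewrite (Ex w), W1, W2; autorewrite with r3.
  unfold px, py, pz; simpl; split; ring. }
assert (D : forall w : R3, dot w (0, 0, eps) = eps * pz w) by (intros; unfold dot, px, py, pz; simpl; ring).
destruct (circ_dichotomy I C e1 e2 r cyc mini s Hs) as [Z|Z].
- left.
  assert (Z' : forall t, cos t * dot (C1 s) (e1 s) + sin t * dot (C1 s) (e2 s) + r1 s = 0).
  { intros t; specialize (Z t); destruct (P t) as [E _]; rewrite E in Z; clear E.
    revert Z; unfold lin, dot; autorewrite with r3; rewrite Z1, Z2; intros Z.
    apply Rmult_integral in Z; destruct Z as [Z|Z]; [lra|].
    apply (Rmult_eq_reg_l eps); [|assumption].
    revert Z; unfold px, py, pz; simpl; intros; lra. }
  assert (A0 := Z' 0). assert (A1 := Z' PI). assert (A2 := Z' (PI / 2)).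
  rewrite cos_0, sin_0 in A0; rewrite cos_PI, sin_PI in A1; rewrite cos_PI2, sin_PI2 in A2.
  destruct (W (C1 s)) as [X Y]; [lra|lra|]. repeat split; try assumption; lra.
- right.
  set (w := plus (scal (r s) (minus (scal (pz (C2 s)) (C1 s)) (scal (pz (C1 s)) (C2 s))))
     (scal (2 * pz (C1 s) * r1 s) (C1 s))).
  assert (Z' : forall t, cos t * dot w (e1 s) + sin t * dot w (e2 s)
    + radius_equation (r s) (r1 s) (r2 s) (pz (C1 s)) (pz (C2 s)) (speed2 s) = 0).
  { intros t; specialize (Z t); destruct (P t) as [_ E]; rewrite E in Z; clear E P.
    destruct (lin_orthonormal I C e1 e2 r cyc s t Hs) as (U1 & U2 & U3 & U4).
    apply Rmult_integral in Z; destruct Z as [Z|Z]; [assert (0 < r s ^ 2) by (now apply pow_lt); lra|].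
    rewrite !D in Z.
    set (u := lin (e1 s) (e2 s) t) in *; set (ut := lin (e2 s) (opp (e1 s)) t) in *.
    assert (uz : pz u = 0) by (unfold u, lin; autorewrite with r3; rewrite Z1, Z2; ring).
    assert (utz : pz ut = 0) by (unfold ut, lin; autorewrite with r3; rewrite Z1, Z2; ring).
    replace (hdot ut ut) with 1 in Z by (rewrite <- U2; unfold dot, hdot; rewrite utz; ring).
    replace (hdot (plus (C1 s) (scal (r1 s) u)) (plus (C1 s) (scal (r1 s) u))) with
      (speed2 s + 2 * r1 s * dot (C1 s) u) in Z.
    2:{ transitivity (hdot (C1 s) (C1 s) + 2 * r1 s * hdot (C1 s) u + r1 s ^ 2 * hdot u u); [|r3_ring].
        replace (hdot u u) with 1 by (rewrite <- U1; unfold dot, hdot; rewrite uz; ring).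
        unfold speed2, dot, hdot; rewrite uz; ring. }
    apply (Rmult_eq_reg_l eps); [|assumption]; rewrite Rmult_0_r, <- Z.
    transitivity (eps * (dot w u + radius_equation (r s) (r1 s) (r2 s) (pz (C1 s)) (pz (C2 s)) (speed2 s))).
    - unfold u, lin; clearbody w; r3_ring.
    - unfold w, radius_equation. clearbody u ut C1 C2 r1 r2 speed2. clear. r3_ring. }
  assert (A0 := Z' 0). assert (A1 := Z' PI). assert (A2 := Z' (PI / 2)).
  rewrite cos_0, sin_0 in A0; rewrite cos_PI, sin_PI in A1; rewrite cos_PI2, sin_PI2 in A2.
  destruct (W w) as [X Y]; [lra|lra|].
  unfold w in X, Y; autorewrite with r3 in X, Y.
  unfold center_equation; repeat split; lra.
Qed.

(** If one of the expressions were nonzero at [s], it would be nonzero nearby, so the first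
    alternative of [horizontal_pointwise] would hold on a neighborhood. There [a'], [b'] and [r']
    vanish identically, hence also their derivatives at [s], which makes the expression zero. *)
Lemma horizontal_equations s : I s ->
  center_equation (px (C1 s)) (px (C2 s)) (pz (C1 s)) (pz (C2 s)) (r s) (r1 s) = 0 /\
  center_equation (py (C1 s)) (py (C2 s)) (pz (C1 s)) (pz (C2 s)) (r s) (r1 s) = 0 /\
  radius_equation (r s) (r1 s) (r2 s) (pz (C1 s)) (pz (C2 s)) (speed2 s) = 0.
Proof.
intros Hs.
set (T1 := fun s => center_equation (px (C1 s)) (px (C2 s)) (pz (C1 s)) (pz (C2 s)) (r s) (r1 s)).
set (T2 := fun s => center_equation (py (C1 s)) (py (C2 s)) (pz (C1 s)) (pz (C2 s)) (r s) (r1 s)).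
set (T3 := fun s => radius_equation (r s) (r1 s) (r2 s) (pz (C1 s)) (pz (C2 s)) (speed2 s)).
assert (Hp := horizontal_pointwise).
assert (Io : open I) by apply cyc.
assert (S0 : smooth_curve_on I C) by apply cyc.
assert (Sr : smooth_on I r) by apply cyc.
destruct (smooth_curve_derive I C 1 s S0 Hs) as (Hx & Hy & Hz).
destruct (smooth_curve_derive I C 2 s S0 Hs) as (Hx' & Hy' & Hz').
assert (Dr := smooth_on_derive I r 0 s Sr Hs). assert (Dr1 := smooth_on_derive I r 1 s Sr Hs).
assert (Dr2 := smooth_on_derive I r 2 s Sr Hs).
assert (K : forall T : R -> R, continuous T s ->
   (forall x, I x -> T x <> 0 -> px (C1 x) = 0 /\ py (C1 x) = 0 /\ r1 x = 0) ->
   (px (C1 s) = 0 -> px (C2 s) = 0 -> py (C1 s) = 0 -> py (C2 s) = 0 -> r1 s = 0 -> r2 s = 0 -> T s = 0) ->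
   T s = 0).
{ intros T CT HT HZ; destruct (Req_dec (T s) 0) as [|N]; [assumption|].
  assert (L : locally s (fun x => px (C1 x) = 0 /\ py (C1 x) = 0 /\ r1 x = 0)).
  { apply filter_imp with (2 := filter_and _ _ (Io s Hs) (continuous_nonzero T s CT N)).
    intros x [Ix Nx]; now apply HT. }
  assert (Z : forall f l, is_derive f s l -> locally s (fun x => f x = 0) -> l = 0).
  { intros f l Hf Lf; apply is_derive_unique in Hf; rewrite <- Hf.
    apply is_derive_unique, (is_derive_ext_loc (fun _ => 0)).
    - apply filter_imp with (2 := Lf); now intros.
    - apply is_derive_cst. }
  destruct (locally_singleton _ _ L) as (E1 & E2 & E3).
  apply HZ; try assumption.
  - apply (Z _ _ Hx); apply filter_imp with (2 := L); tauto.
  - apply (Z _ _ Hy); apply filter_imp with (2 := L); tauto.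
  - apply (Z _ _ Dr1); apply filter_imp with (2 := L); tauto. }
split; [|split].
- apply (K T1).
  + apply (ex_derive_continuous (K := R_AbsRing) (V := R_NormedModule) T1), (ex_derive_center_equation (fun s => px (C1 s)) (fun s => px (C2 s))
      (fun s => pz (C1 s)) (fun s => pz (C2 s)) r r1); eexists; eassumption.
  + intros x Ix N; destruct (Hp x Ix) as [|(E & _)]; [assumption|now elim N].
  + unfold T1, center_equation; intros -> -> _ _ _ _; ring.
- apply (K T2).
  + apply (ex_derive_continuous (K := R_AbsRing) (V := R_NormedModule) T2), (ex_derive_center_equation (fun s => py (C1 s)) (fun s => py (C2 s))
      (fun s => pz (C1 s)) (fun s => pz (C2 s)) r r1); eexists; eassumption.
  + intros x Ix N; destruct (Hp x Ix) as [|(_ & E & _)]; [assumption|now elim N].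
  + unfold T2, center_equation; intros _ _ -> -> _ _; ring.
- apply (K T3).
  + apply (ex_derive_continuous (K := R_AbsRing) (V := R_NormedModule) T3), (ex_derive_radius_equation r r1 r2
      (fun s => pz (C1 s)) (fun s => pz (C2 s)) (fun s => px (C1 s)) (fun s => py (C1 s)));
      eexists; eassumption.
  + intros x Ix N; destruct (Hp x Ix) as [|(_ & _ & E)]; [assumption|now elim N].
  + unfold T3, radius_equation, speed2; intros -> _ -> _ -> ->; ring.
Qed.


Lemma horizontal_speed_nonzero s : I s -> speed2 s + pz (C1 s) ^ 2 <> 0.
Proof.
intros Hs F; unfold speed2 in F.
assert (Hx : px (C1 s) = 0) by nra. assert (Hy : py (C1 s) = 0) by nra.
assert (Hr : r1 s = 0) by nra. assert (Hz : pz (C1 s) = 0) by nra.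
destruct cyc as (_ & S0 & S1 & S2 & Sr & _ & Imm).
apply (Imm s 0 Hs); rewrite (normal_field_circles C e1 e2 r I) by assumption.
destruct (circ_parallel I C e1 e2 r cyc mini s 0 Hs) as [E _]; cbv beta in E.
fold C1 r1 in E; rewrite E, Hr; replace (C1 s) with (zero : R3) by (apply R3_ext; now symmetry).
generalize (lin (e1 s) (e2 s) 0) (cross (e1 s) (e2 s)); intros; apply R3_ext; r3_ring.
Qed.

Lemma horizontal_flat_or_steep :
  (forall s, I s -> pz (C1 s) = 0) \/ (forall s, I s -> pz (C1 s) <> 0).
Proof.
set (h := fun s => pz (C1 s) ^ 2 / (px (C1 s) ^ 2 + py (C1 s) ^ 2 + r1 s ^ 2 + pz (C1 s) ^ 2)).
set (k := fun s => slope_rate (px (C1 s)) (py (C1 s)) (r1 s) (pz (C1 s)) (r s)).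
assert (Int : nonempty_open_interval I) by apply cyc.
assert (S0 : smooth_curve_on I C) by apply cyc.
assert (Sr : smooth_on I r) by apply cyc.
assert (r0 : forall s, I s -> r s <> 0).
{ intros s Hs; apply Rgt_not_eq, cyc; exact Hs. }
assert (Hh : forall s, I s -> is_derive h s (k s * h s)).
{ intros s Hs; destruct (smooth_curve_derive I C 1 s S0 Hs) as (Hx & Hy & Hz).
  destruct (horizontal_equations s Hs) as (E1 & E2 & E3).
  apply (is_derive_slope (fun s => px (C1 s)) (fun s => py (C1 s)) r1 (fun s => pz (C1 s)) s _ _ _ _ (r s)
    Hx Hy (smooth_on_derive I r 1 s Sr Hs) Hz (r0 s Hs) (horizontal_speed_nonzero s Hs) E1 E2 E3). }
assert (Hk : forall s, I s -> continuous k s).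
{ intros s Hs; destruct (smooth_curve_derive I C 1 s S0 Hs) as (Hx & Hy & Hz).
  assert (P : forall a b c z q : R -> R, ex_derive a s -> ex_derive b s -> ex_derive c s ->
    ex_derive z s -> ex_derive q s -> q s * (a s ^ 2 + b s ^ 2 + c s ^ 2 + z s ^ 2) <> 0 ->
    ex_derive (fun s => slope_rate (a s) (b s) (c s) (z s) (q s)) s).
  { intros; unfold slope_rate; auto_derive; tauto. }
  apply (ex_derive_continuous (K := R_AbsRing) (V := R_NormedModule) k),
    (P (fun s => px (C1 s)) (fun s => py (C1 s)) r1 (fun s => pz (C1 s)) r); try (eexists; eassumption).
  - eexists; exact (smooth_on_derive I r 1 s Sr Hs).
  - eexists; exact (smooth_on_derive I r 0 s Sr Hs).
  - apply Rmult_integral_contrapositive; split; [now apply r0|exact (horizontal_speed_nonzero s Hs)]. }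
destruct (proj1 Int) as [s0 Hs0].
assert (Z : forall s, I s -> h s = 0 -> pz (C1 s) = 0).
{ intros s Hs Z; assert (N := horizontal_speed_nonzero s Hs); unfold speed2 in N; unfold h in Z.
  apply Rmult_integral in Z; destruct Z as [Z|Z]; [nra|].
  exfalso; revert Z; now apply Rinv_neq_0_compat. }
assert (Z' : forall s, pz (C1 s) = 0 -> h s = 0).
{ intros s E; unfold h; rewrite E; unfold Rdiv; ring. }
destruct (Req_dec (pz (C1 s0)) 0) as [E|E]; [left|right]; intros s Hs.
- apply Z; [assumption|]. apply (linear_ode_zero I h k Int Hk Hh s0 s Hs0 Hs), Z', E.
- intros F; apply E, Z; [assumption|]. apply (linear_ode_zero I h k Int Hk Hh s s0 Hs Hs0), Z', F.
Qed.

End Horizontal.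

(** * Integration of the profile equation *)

Lemma sqrt_sum_pos la mu : la ^ 2 + mu ^ 2 <> 0 ->
  0 < sqrt (la ^ 2 + mu ^ 2) /\ sqrt (la ^ 2 + mu ^ 2) ^ 2 = la ^ 2 + mu ^ 2.
Proof.
intros H; assert (0 <= la ^ 2) by apply pow2_ge_0; assert (0 <= mu ^ 2) by apply pow2_ge_0.
split; [apply sqrt_lt_R0; lra|apply pow2_sqrt; lra].
Qed.

(** The first integral [a' / (z' r^2) = la] in the case [z' = 1]: one formula covers the three types
    and identifies the centers. *)
Lemma is_derive_family_a k c la mu s :
  la ^ 2 + mu ^ 2 <> 0 -> family_domain k c la mu s ->
  is_derive (family_a k c la mu) s (la * family_r k c la mu s ^ 2).
Proof.
intros HL D; destruct (sqrt_sum_pos la mu HL) as [l0 l2].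
destruct k; unfold family_a, family_r, family_domain, coth in *; set (l := sqrt (la ^ 2 + mu ^ 2)) in *.
- rewrite <- l2. apply (is_derive_ext (fun s => c * la * (sin (c * s) / cos (c * s)) / l ^ 2)); [reflexivity|].
  auto_derive; [tauto|].
  assert (T := sin2_cos2 (c * s)); unfold Rsqr in T.
  transitivity (c * la * c * (sin (c * s) * sin (c * s) + cos (c * s) * cos (c * s)) / (cos (c * s) ^ 2 * l ^ 2)).
  + field; split; lra.
  + rewrite T; field; split; lra.
- rewrite <- l2.
  assert (N : l ^ 2 * s + c * l <> 0).
  { replace (l ^ 2 * s + c * l) with (l * (l * s + c)) by ring.
    apply Rmult_integral_contrapositive; split; lra. }
  auto_derive; [simpl in N; tauto|].
  simpl in N; field; split; [exact D|]. intros F; apply N; rewrite <- F; ring.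
- rewrite <- l2.
  auto_derive; [tauto|].
  assert (T : cosh (c * s) ^ 2 - sinh (c * s) ^ 2 = 1).
  { unfold cosh, sinh. assert (E : exp (c * s) * exp (- (c * s)) = 1) by (rewrite <- exp_plus, Rplus_opp_r; apply exp_0).
    transitivity (exp (c * s) * exp (- (c * s))); [field|exact E]. }
  transitivity (c * la * c * (cosh (c * s) ^ 2 - sinh (c * s) ^ 2) / (sinh (c * s) ^ 2 * l ^ 2)).
  + field; split; lra.
  + rewrite T; field; split; lra.
Qed.

Lemma family_b_swap k c la mu s : family_b k c la mu s = family_a k c mu la s.
Proof. destruct k; unfold family_b, family_a; now rewrite (Rplus_comm (la ^ 2)). Qed.

Lemma family_r_swap k c la mu s : family_r k c la mu s = family_r k c mu la s.
Proof. destruct k; unfold family_r; now rewrite (Rplus_comm (la ^ 2)). Qed.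

Lemma family_domain_swap k c la mu s : family_domain k c la mu s -> family_domain k c mu la s.
Proof. destruct k; unfold family_domain; now rewrite ?(Rplus_comm (la ^ 2)). Qed.

(* [y = 1 / r] and its derivative [w] with respect to the height [z] satisfy
   [dy/dz = w], [dw/dz = k y] and [w ^ 2 - k y ^ 2 = la ^ 2 + mu ^ 2]; the sign of [k]
   selects the type. *)
Lemma profile_classification (I : R -> Prop) (y w z z1 : R -> R) (k la mu : R) :
  nonempty_open_interval I -> la ^ 2 + mu ^ 2 <> 0 ->
  (forall s, I s -> is_derive z s (z1 s) /\ is_derive y s (w s * z1 s) /\
     is_derive w s (k * y s * z1 s) /\ y s <> 0 /\ w s ^ 2 = la ^ 2 + mu ^ 2 + k * y s ^ 2) ->
  exists T c h, c <> 0 /\ forall s, I s ->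
    family_domain T c la mu (z s - h) /\ family_r T c la mu (z s - h) ^ 2 = (/ y s) ^ 2.
Proof.
intros Int HL H.
destruct (sqrt_sum_pos la mu HL) as [l0 l2].
destruct (proj1 Int) as [s0 Hs0].
set (l := sqrt (la ^ 2 + mu ^ 2)) in *; rewrite <- l2 in H.
assert (Cst : forall f : R -> R, (forall s, I s -> is_derive f s 0) -> forall s, I s -> f s = f s0).
{ intros f Hf s Hs; now apply (interval_derive_0 I). }
destruct (Rtotal_order k 0) as [Hk|[Hk|Hk]].
- set (c := sqrt (- k)).
  assert (c0 : 0 < c) by (apply sqrt_lt_R0; lra).
  assert (c2 : c ^ 2 = - k) by (apply pow2_sqrt; lra).
  replace k with (- c ^ 2) in H by lra; clearbody c; clear Hk c2.
  (* The pair [(y, w / c)] rotates with angle [c z]. Undoing the rotation gives the two constants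
     [al] and [be] of [y = al cos (c z) + be sin (c z)]. *)
  assert (A : forall s, I s -> is_derive (fun s => y s * cos (c * z s) - w s / c * sin (c * z s)) s 0).
  { intros s Hs; destruct (H s Hs) as (Hz & Hy & Hw & _).
    auto_derive; [repeat split; eexists; eassumption|].
    rewrite (is_derive_unique (fun s : R => z s) _ _ Hz), (is_derive_unique (fun s : R => y s) _ _ Hy),
      (is_derive_unique (fun s : R => w s) _ _ Hw); field; lra. }
  assert (B : forall s, I s -> is_derive (fun s => y s * sin (c * z s) + w s / c * cos (c * z s)) s 0).
  { intros s Hs; destruct (H s Hs) as (Hz & Hy & Hw & _).
    auto_derive; [repeat split; eexists; eassumption|].
    rewrite (is_derive_unique (fun s : R => z s) _ _ Hz), (is_derive_unique (fun s : R => y s) _ _ Hy),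
      (is_derive_unique (fun s : R => w s) _ _ Hw); field; lra. }
  assert (A' := Cst _ A). assert (B' := Cst _ B). cbv beta in A', B'. clear A B.
  set (al := y s0 * cos (c * z s0) - w s0 / c * sin (c * z s0)) in *.
  set (be := y s0 * sin (c * z s0) + w s0 / c * cos (c * z s0)) in *.
  assert (AB : al ^ 2 + be ^ 2 = (l / c) ^ 2).
  { destruct (H s0 Hs0) as (_ & _ & _ & _ & E).
    assert (T := sin2_cos2 (c * z s0)); unfold Rsqr in T.
    transitivity ((y s0 ^ 2 + w s0 ^ 2 / c ^ 2) * (sin (c * z s0) * sin (c * z s0) + cos (c * z s0) * cos (c * z s0))).
    - unfold al, be; field; lra.
    - rewrite T, E; field; lra. }
  (* Amplitude and phase form; the amplitude is fixed by the energy relation and the phase becomes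
     the vertical translation. *)
  destruct (angle_exists al be (l / c)) as (ph & E1 & E2); [apply Rdiv_lt_0_compat; lra|exact AB|].
  exists TypeI, c, (ph / c); split; [lra|intros s Hs].
  assert (Y : y s = l / c * cos (c * (z s - ph / c))).
  { replace (c * (z s - ph / c)) with (c * z s - ph) by (field; lra).
    rewrite cos_minus.
    transitivity (al * cos (c * z s) + be * sin (c * z s)); [|rewrite E1, E2; ring].
    rewrite <- (A' s Hs), <- (B' s Hs).
    assert (T := sin2_cos2 (c * z s)); unfold Rsqr in T.
    transitivity (y s * (sin (c * z s) * sin (c * z s) + cos (c * z s) * cos (c * z s))); [rewrite T; ring|ring]. }
  destruct (H s Hs) as (_ & _ & _ & y0 & _).
  assert (D : cos (c * (z s - ph / c)) <> 0) by (intros F; apply y0; rewrite Y, F; ring).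
  split; [exact D|]. rewrite Y; unfold family_r; fold l; field; repeat split; lra.
- subst k.
  assert (A : forall s, I s -> is_derive w s 0).
  { intros s Hs; destruct (H s Hs) as (_ & _ & Hw & _); now replace 0 with (0 * y s * z1 s) by ring. }
  assert (A' := Cst _ A).
  assert (B : forall s, I s -> is_derive (fun s => y s - w s0 * z s) s 0).
  { intros s Hs; destruct (H s Hs) as (Hz & Hy & Hw & _).
    auto_derive; [repeat split; eexists; eassumption|].
    rewrite (is_derive_unique (fun s : R => z s) _ _ Hz), (is_derive_unique (fun s : R => y s) _ _ Hy).
    rewrite (A' s Hs); ring. }
  assert (B' := Cst _ B); cbv beta in B'.
  set (d := y s0 - w s0 * z s0) in *.
  assert (W : w s0 ^ 2 = l ^ 2) by (destruct (H s0 Hs0) as (_ & _ & _ & _ & E); lra).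
  assert (w0 : w s0 <> 0) by (intros F; rewrite F in W; nra).
  (* The constant of type II can be changed by a vertical translation, so the nonzero value 1 is
     chosen; the shift makes the denominator equal to [(l / w) y], where [l / w] is 1 or -1. *)
  exists TypeII, 1, (- d / w s0 + 1 / l); split; [lra|intros s Hs].
  destruct (H s Hs) as (_ & _ & _ & y0 & _).
  assert (Y : l * (z s - (- d / w s0 + 1 / l)) + 1 = l / w s0 * y s).
  { replace (y s) with (w s0 * z s + d) by (rewrite <- (B' s Hs); ring). field; split; lra. }
  assert (D : l / w s0 * y s <> 0).
  { apply Rmult_integral_contrapositive; split; [|exact y0].
    apply Rmult_integral_contrapositive; split; [lra|now apply Rinv_neq_0_compat]. }
  split.
  + unfold family_domain; fold l; now rewrite Y.
  + unfold family_r; fold l; rewrite Y.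
    transitivity (w s0 ^ 2 / l ^ 2 * (/ y s) ^ 2); [field; repeat split; lra|].
    rewrite W; field; split; lra.
- set (c := sqrt k).
  assert (c0 : 0 < c) by (apply sqrt_lt_R0; lra).
  assert (c2 : c ^ 2 = k) by (apply pow2_sqrt; lra).
  rewrite <- c2 in H; clearbody c; clear Hk c2.
  (* The combinations [w + c y] and [w - c y] diagonalize the system. The product of the resulting
     constants is [l^2 > 0], so they have the same sign. *)
  assert (A : forall s, I s -> is_derive (fun s => (w s + c * y s) * exp (- (c * z s))) s 0).
  { intros s Hs; destruct (H s Hs) as (Hz & Hy & Hw & _).
    auto_derive; [repeat split; eexists; eassumption|].
    rewrite (is_derive_unique (fun s : R => z s) _ _ Hz), (is_derive_unique (fun s : R => y s) _ _ Hy),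
      (is_derive_unique (fun s : R => w s) _ _ Hw); ring. }
  assert (B : forall s, I s -> is_derive (fun s => (w s - c * y s) * exp (c * z s)) s 0).
  { intros s Hs; destruct (H s Hs) as (Hz & Hy & Hw & _).
    auto_derive; [repeat split; eexists; eassumption|].
    rewrite (is_derive_unique (fun s : R => z s) _ _ Hz), (is_derive_unique (fun s : R => y s) _ _ Hy),
      (is_derive_unique (fun s : R => w s) _ _ Hw); ring. }
  assert (A' := Cst _ A). assert (B' := Cst _ B). cbv beta in A', B'. clear A B.
  set (al := (w s0 + c * y s0) * exp (- (c * z s0))) in *.
  set (be := (w s0 - c * y s0) * exp (c * z s0)) in *.
  assert (X : forall x, exp x * exp (- x) = 1) by (intros x; rewrite <- exp_plus, Rplus_opp_r; apply exp_0).
  assert (AB : al * be = l ^ 2).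
  { destruct (H s0 Hs0) as (_ & _ & _ & _ & E).
    transitivity ((w s0 ^ 2 - c ^ 2 * y s0 ^ 2) * (exp (c * z s0) * exp (- (c * z s0)))); [unfold al, be; ring|].
    rewrite X, E; ring. }
  assert (al0 : al <> 0) by (intros F; rewrite F in AB; nra).
  (* This translation gives both constants the same modulus [l] once the exponentials are shifted,
     so that their difference is a hyperbolic sine; the common sign [eps] disappears in the square
     of the radius. *)
  set (h := - ln (Rabs al / l) / c).
  assert (G : exp (- (c * h)) = Rabs al / l).
  { unfold h. replace (- (c * (- ln (Rabs al / l) / c))) with (ln (Rabs al / l)) by (field; lra).
    apply exp_ln, Rdiv_lt_0_compat; [now apply Rabs_pos_lt|assumption]. }
  assert (Eps : exists eps, eps ^ 2 = 1 /\ al = eps * Rabs al).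
  { destruct (Rle_lt_dec 0 al); [exists 1|exists (-1)]; (split; [ring|]).
    - rewrite Rabs_pos_eq by assumption; ring.
    - rewrite Rabs_left by assumption; ring. }
  destruct Eps as (eps & eps2 & Ea).
  assert (Al : al = eps * l * exp (- (c * h))) by (rewrite G, Ea at 1; field; lra).
  assert (Be : be = eps * l * exp (c * h)).
  { apply (Rmult_eq_reg_l al); [|assumption]. rewrite AB, Al.
    transitivity (eps ^ 2 * l ^ 2 * (exp (c * h) * exp (- (c * h)))); [rewrite X, eps2; ring|ring]. }
  exists TypeIII, c, h; split; [lra|intros s Hs].
  destruct (H s Hs) as (_ & _ & _ & y0 & _).
  assert (Y : y s = eps * l / c * sinh (c * (z s - h))).
  { unfold sinh. replace (c * (z s - h)) with (c * z s + - (c * h)) by ring.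
    rewrite Ropp_plus_distr, Ropp_involutive, !exp_plus.
    transitivity ((al * exp (c * z s) - be * exp (- (c * z s))) / (2 * c)); [|rewrite Al, Be; field; lra].
    rewrite <- (A' s Hs), <- (B' s Hs).
    transitivity ((w s + c * y s - (w s - c * y s)) * (exp (c * z s) * exp (- (c * z s))) / (2 * c));
      [rewrite X; field; lra|field; lra]. }
  assert (D : sinh (c * (z s - h)) <> 0) by (intros F; apply y0; rewrite Y, F; ring).
  split; [exact D|].
  assert (e0 : eps <> 0) by (intros F; rewrite F in eps2; lra).
  rewrite Y; unfold family_r; fold l.
  transitivity (c ^ 2 / (l * sinh (c * (z s - h))) ^ 2); [field; repeat split; lra|].
  transitivity (c ^ 2 / (eps ^ 2 * (l * sinh (c * (z s - h))) ^ 2)); [rewrite eps2; field|field]; repeat split; lra.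
Qed.

Lemma center_first_integral (I : R -> Prop) (c c1 c2 z1 z2 r r1 : R -> R) :
  nonempty_open_interval I ->
  (forall s, I s -> is_derive c1 s (c2 s) /\ is_derive z1 s (z2 s) /\ is_derive r s (r1 s) /\
     z1 s <> 0 /\ r s <> 0 /\ center_equation (c1 s) (c2 s) (z1 s) (z2 s) (r s) (r1 s) = 0) ->
  exists la, forall s, I s -> c1 s = la * z1 s * r s ^ 2.
Proof.
intros Int H; destruct (proj1 Int) as [s0 Hs0].
assert (D : forall s, I s -> is_derive (fun s => c1 s / (z1 s * r s ^ 2)) s 0).
{ intros s Hs; destruct (H s Hs) as (Hc & Hz & Hr & z0 & r0 & E).
  auto_derive.
  - repeat split; try (eexists; eassumption).
    apply Rmult_integral_contrapositive; split; [assumption|nra].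
  - rewrite (is_derive_unique (fun s : R => c1 s) _ _ Hc), (is_derive_unique (fun s : R => z1 s) _ _ Hz),
      (is_derive_unique (fun s : R => r s) _ _ Hr).
    transitivity (- center_equation (c1 s) (c2 s) (z1 s) (z2 s) (r s) (r1 s) / (z1 s ^ 2 * r s ^ 3)).
    + unfold center_equation; field; split; assumption.
    + rewrite E; field; split; assumption. }
exists (c1 s0 / (z1 s0 * r s0 ^ 2)); intros s Hs.
rewrite <- (interval_derive_0 I _ Int D s s0 Hs Hs0).
destruct (H s Hs) as (_ & _ & _ & z0 & r0 & _); field; split; assumption.
Qed.

(** The function [w] is the derivative of [1 / r] with respect to the height. The radius equation
    becomes [w' = (w^2 - L) r z'], so [(w^2 - L) r^2] is constant; this constant is the [k] of
    [profile_classification]. *)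
Lemma radius_first_integral (I : R -> Prop) (z z1 z2 r r1 r2 : R -> R) (la mu : R) :
  nonempty_open_interval I -> la ^ 2 + mu ^ 2 <> 0 ->
  (forall s, I s -> is_derive z s (z1 s) /\ is_derive z1 s (z2 s) /\
     is_derive r s (r1 s) /\ is_derive r1 s (r2 s) /\ z1 s <> 0 /\ r s <> 0 /\
     radius_equation (r s) (r1 s) (r2 s) (z1 s) (z2 s)
       ((la * z1 s * r s ^ 2) ^ 2 + (mu * z1 s * r s ^ 2) ^ 2 + r1 s ^ 2) = 0) ->
  exists T c h, c <> 0 /\ forall s, I s ->
    family_domain T c la mu (z s - h) /\ family_r T c la mu (z s - h) ^ 2 = r s ^ 2.
Proof.
intros Int HL H; destruct (proj1 Int) as [s0 Hs0].
set (L := la ^ 2 + mu ^ 2) in *.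
set (w := fun s => - r1 s / (z1 s * r s ^ 2)).
assert (Dw : forall s, I s -> is_derive w s ((w s ^ 2 - L) * r s * z1 s)).
{ intros s Hs; destruct (H s Hs) as (Hz & Hz1 & Hr & Hr1 & z0 & r0 & E).
  unfold w; auto_derive.
  - repeat split; try (eexists; eassumption).
    apply Rmult_integral_contrapositive; split; [assumption|nra].
  - rewrite (is_derive_unique (fun s : R => r1 s) _ _ Hr1), (is_derive_unique (fun s : R => z1 s) _ _ Hz1),
      (is_derive_unique (fun s : R => r s) _ _ Hr).
    (* The two sides differ by a multiple of the radius equation, which is added here in the place
       of 0. *)
    rewrite <- (Rplus_0_r ((_ - L) * _ * _)).
    replace 0 with (radius_equation (r s) (r1 s) (r2 s) (z1 s) (z2 s)
       ((la * z1 s * r s ^ 2) ^ 2 + (mu * z1 s * r s ^ 2) ^ 2 + r1 s ^ 2) / (z1 s ^ 2 * r s ^ 3))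
      by (rewrite E; field; split; assumption).
    unfold radius_equation, L; field; split; assumption. }
assert (Dk : forall s, I s -> is_derive (fun s => (w s ^ 2 - L) * r s ^ 2) s 0).
{ intros s Hs; destruct (H s Hs) as (Hz & Hz1 & Hr & Hr1 & z0 & r0 & _).
  assert (Hw := Dw s Hs).
  assert (E : r1 s = - w s * z1 s * r s ^ 2) by (unfold w; field; split; assumption).
  clearbody w; auto_derive; [repeat split; eexists; eassumption|].
  rewrite (is_derive_unique (fun s : R => w s) _ _ Hw), (is_derive_unique (fun s : R => r s) _ _ Hr), E; ring. }
set (k := (w s0 ^ 2 - L) * r s0 ^ 2).
assert (K : forall s, I s -> (w s ^ 2 - L) * r s ^ 2 = k).
{ intros s Hs; exact (interval_derive_0 I _ Int Dk s s0 Hs Hs0). }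
destruct (profile_classification I (fun s => / r s) w z z1 k la mu Int HL) as (T & c & h & c0 & P).
- intros s Hs; destruct (H s Hs) as (Hz & Hz1 & Hr & Hr1 & z0 & r0 & _).
  split; [exact Hz|split; [|split; [|split]]].
  + replace (w s * z1 s) with (- r1 s / r s ^ 2) by (unfold w; field; split; assumption).
    now apply is_derive_inv.
  + replace (k * / r s * z1 s) with ((w s ^ 2 - L) * r s * z1 s)
      by (rewrite <- (K s Hs); field; assumption).
    now apply Dw.
  + now apply Rinv_neq_0_compat.
  + rewrite <- (K s Hs); unfold L; field; assumption.
- exists T, c, h; split; [exact c0|intros s Hs].
  destruct (P s Hs) as [D R]; split; [exact D|]. rewrite R, Rinv_inv; reflexivity.
Qed.

Lemma interval_image (I : R -> Prop) (z z1 : R -> R) (h : R) :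
  nonempty_open_interval I ->
  (forall s, I s -> is_derive z s (z1 s) /\ continuous z1 s /\ z1 s <> 0) ->
  nonempty_open_interval (fun x => exists s, I s /\ x = z s - h).
Proof.
intros Int H; assert (Int' := Int); destruct Int' as ((s0 & Hs0) & Io & Iv).
assert (Ivt : forall a b x, I a -> I b -> z a < x < z b -> exists s, I s /\ x = z s).
{ intros a b x Ha Hb Hx.
  assert (Cz : forall s, I s -> continuous z s).
  { intros s Hs; apply (ex_derive_continuous (K := R_AbsRing) (V := R_NormedModule)).
    destruct (H s Hs) as [Hz _]; eexists; exact Hz. }
  destruct (Rtotal_order a b) as [L|[E|L]]; [|subst b; lra|].
  - destruct (IVT_interv (fun s => z s - x) a b) as (c & Hc & Zc); [|assumption|lra|lra|].
    + intros c Hc; apply continuity_pt_minus; [|apply continuity_pt_const; now intros ? ?].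
      apply continuity_pt_filterlim, Cz; now apply Iv with a b.
    + exists c; split; [now apply Iv with a b|lra].
  - destruct (IVT_interv (fun s => x - z s) b a) as (c & Hc & Zc); [|assumption|lra|lra|].
    + intros c Hc; apply continuity_pt_minus; [apply continuity_pt_const; now intros ? ?|].
      apply continuity_pt_filterlim, Cz; now apply Iv with b a.
    + exists c; split; [now apply Iv with b a|lra]. }
split; [exists (z s0 - h), s0; now split|split].
- intros x (s & Hs & ->).
  destruct (Io s Hs) as [eps He].
  assert (B : forall d, Rabs d < eps -> I (s + d)).
  { intros d Hd; apply He; unfold ball; simpl; unfold AbsRing_ball, abs, minus, plus, opp; simpl.
    now replace (s + d + - s) with d by ring. }
  (* The height may increase or decrease along the family; the constant sign of [z1] decides which
     neighbor of [s] lies above, and the intermediate values between the two give openness. *)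
  assert (Nb : exists a b, I a /\ I b /\ z a < z s < z b).
  { destruct (H s Hs) as (Hz & _ & z0).
    set (e := eps / 2). assert (e0 : 0 < e) by (unfold e; destruct eps; simpl; lra).
    assert (Ep : e < eps) by (unfold e; destruct eps; simpl in *; lra).
    assert (Hm : I (s - e)) by (apply B; rewrite Rabs_left; lra).
    assert (Hp : I (s + e)) by (apply B; rewrite Rabs_pos_eq; lra).
    assert (Mvt : forall a b, I a -> I b -> a < b -> exists c, I c /\ z b - z a = z1 c * (b - a)).
    { intros a b Ha Hb Lab; destruct (MVT_gen z a b z1) as (c & Hc & E).
      - intros x Hx; rewrite Rmin_left, Rmax_right in Hx by lra; apply H, (Iv a x b); auto; lra.
      - intros x Hx; rewrite Rmin_left, Rmax_right in Hx by lra.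
        apply continuity_pt_filterlim.
        apply (ex_derive_continuous (K := R_AbsRing) (V := R_NormedModule)).
        assert (Ix : I x) by now apply (Iv a x b).
        destruct (H x Ix) as [Hx' _]; eexists; exact Hx'.
      - rewrite Rmin_left, Rmax_right in Hc by lra.
        exists c; split; [now apply (Iv a c b)|exact E]. }
    destruct (Mvt (s - e) s Hm Hs) as (c & Ic & Ec); [lra|].
    destruct (Mvt s (s + e) Hs Hp) as (d & Id & Ed); [lra|].
    assert (Sg : forall a b, I a -> I b -> 0 < z1 a -> 0 < z1 b).
    { apply interval_constant_sign; [exact Int|apply H|apply H]. }
    destruct (Rlt_le_dec 0 (z1 s)) as [P|P].
    - assert (0 < z1 c) by now apply (Sg s). assert (0 < z1 d) by now apply (Sg s).
      exists (s - e), (s + e); repeat split; try assumption; nra.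
    - assert (z1 c < 0).
      { destruct (H c Ic) as (_ & _ & Nc). destruct (Rlt_le_dec 0 (z1 c)) as [Q|Q]; [|lra].
        assert (0 < z1 s) by now apply (Sg c). lra. }
      assert (z1 d < 0).
      { destruct (H d Id) as (_ & _ & Nd). destruct (Rlt_le_dec 0 (z1 d)) as [Q|Q]; [|lra].
        assert (0 < z1 s) by now apply (Sg d). lra. }
      exists (s + e), (s - e); repeat split; try assumption; nra. }
  destruct Nb as (a & b & Ha & Hb & Hab).
  assert (m0 : 0 < Rmin (z s - z a) (z b - z s)) by (apply Rmin_pos; lra).
  exists (mkposreal _ m0); intros x Hx.
  revert Hx; unfold ball; simpl; unfold AbsRing_ball, abs, minus, plus, opp; simpl; intros Hx.
  apply Rabs_def2 in Hx.
  assert (M1 := Rmin_l (z s - z a) (z b - z s)). assert (M2 := Rmin_r (z s - z a) (z b - z s)).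
  destruct (Ivt a b (x + h) Ha Hb) as (c & Ic & Ec); [lra|].
  exists c; split; [exact Ic|lra].
- intros x y x' (a & Ha & ->) (b & Hb & ->) [L1 L2].
  destruct (Req_dec y (z a - h)) as [->|N1]; [exists a; now split|].
  destruct (Req_dec y (z b - h)) as [->|N2]; [exists b; now split|].
  destruct (Ivt a b (y + h) Ha Hb) as (c & Ic & Ec); [lra|].
  exists c; split; [exact Ic|lra].
Qed.

(** * Comparison of horizontal circles as point sets *)

Definition on_circle (x0 y0 z0 rho : R) (p : R3) : Prop :=
  pz p = z0 /\ (px p - x0) ^ 2 + (py p - y0) ^ 2 = rho ^ 2.

Lemma family_circle T c la mu s v p :
  family_r T c la mu s <> 0 ->
  (exists t, p = plus v (family_X T c la mu s t)) <->
  on_circle (px v + family_a T c la mu s) (py v + family_b T c la mu s) (pz v + s) (family_r T c la mu s) p.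
Proof.
unfold family_X; set (a := family_a T c la mu s); set (b := family_b T c la mu s).
set (rho := family_r T c la mu s); clearbody a b rho; intros rho0; unfold on_circle.
split.
- intros [t ->]; autorewrite with r3.
  assert (E := sin2_cos2 t); unfold Rsqr in E.
  unfold px, py, pz; simpl fst; simpl snd; split; [ring|].
  transitivity (rho ^ 2 * (sin t * sin t + cos t * cos t)); [ring|rewrite E; ring].
- intros [Hz Hxy].
  assert (P : exists t, px p - (px v + a) = rho * cos t /\ py p - (py v + b) = rho * sin t).
  { destruct (Rlt_le_dec 0 rho) as [L|L].
    - now apply angle_exists.
    (* A negative [rho] parametrizes the same circle from the antipodal point. *)
    - destruct (angle_exists (- (px p - (px v + a))) (- (py p - (py v + b))) (- rho)) as (t & E1 & E2);
        [lra|lra|exists t; split; lra]. }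
  destruct P as (t & E1 & E2); exists t.
  apply R3_ext; autorewrite with r3; unfold px, py, pz in *; simpl fst; simpl snd; lra.
Qed.

(** This forgets the frame, which may rotate with [s] or have either orientation, whereas the family
    uses the standard one. *)
Lemma horizontal_circle (C e1 e2 : R -> R3) (r : R -> R) s p :
  0 < r s -> dot (e1 s) (e1 s) = 1 -> dot (e2 s) (e2 s) = 1 -> dot (e1 s) (e2 s) = 0 ->
  pz (e1 s) = 0 -> pz (e2 s) = 0 ->
  (exists t, p = circles C e1 e2 r s t) <-> on_circle (px (C s)) (py (C s)) (pz (C s)) (r s) p.
Proof.
unfold circles, on_circle; generalize (C s) (e1 s) (e2 s) (r s).
intros c a b rho rho0 Ha Hb Hab az bz; split.
- intros [t ->]; autorewrite with r3; rewrite az, bz; split; [ring|].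
  assert (E := sin2_cos2 t); unfold Rsqr in E.
  transitivity (rho ^ 2 * (cos t ^ 2 * (dot a a) + 2 * cos t * sin t * dot a b + sin t ^ 2 * dot b b)).
  + unfold dot; rewrite az, bz; ring.
  + rewrite Ha, Hb, Hab; transitivity (rho ^ 2 * (sin t * sin t + cos t * cos t)); [ring|rewrite E; ring].
- intros [Hz Hxy].
  destruct (orthonormal_cross a b Ha Hb Hab) as (Nn & _ & _ & Ex).
  set (q := minus p c) in *.
  assert (qz : pz q = 0) by (unfold q; autorewrite with r3; lra).
  assert (qn : dot q (cross a b) = 0) by (unfold dot; autorewrite with r3; rewrite az, bz, qz; ring).
  assert (Q : dot q a ^ 2 + dot q b ^ 2 = rho ^ 2).
  { rewrite <- Hxy. transitivity (dot q (plus (plus (scal (dot q a) a) (scal (dot q b) b))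
       (scal (dot q (cross a b)) (cross a b)))).
    - assert (X : forall al be ga m, dot q (plus (plus (scal al a) (scal be b)) (scal ga m))
        = al * dot q a + be * dot q b + ga * dot q m) by r3_ring.
      rewrite X, qn; ring.
    - rewrite <- Ex; unfold dot; rewrite qz; unfold q; autorewrite with r3; ring. }
  destruct (angle_exists _ _ rho rho0 Q) as (t & E1 & E2); exists t.
  assert (F := Ex q); rewrite qn, E1, E2 in F.
  transitivity (plus c q); [unfold q; apply R3_ext; r3_ring|].
  rewrite F; generalize (cross a b); intros; apply R3_ext; r3_ring.
Qed.

Lemma fixed_center_revolution (I : R -> Prop) (C e1 e2 : R -> R3) (r : R -> R) (x0 y0 : R) :
  (forall s, I s -> px (C s) = x0 /\ py (C s) = y0) ->
  (forall s p, I s -> (exists t, p = circles C e1 e2 r s t) <->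
     on_circle (px (C s)) (py (C s)) (pz (C s)) (r s) p) ->
  revolution_about_vertical_axis (surface I (circles C e1 e2 r)).
Proof.
intros H0 Hc; exists x0, y0; intros t p (s & t' & Hs & Hp).
assert (On : on_circle (px (C s)) (py (C s)) (pz (C s)) (r s) (rotation_z x0 y0 t p)).
{ destruct (proj1 (Hc s p Hs) (ex_intro _ t' Hp)) as [Hz Hxy].
  destruct (H0 s Hs) as [E1 E2]; rewrite E1, E2 in *.
  split; [exact Hz|rewrite <- Hxy].
  assert (E := sin2_cos2 t); unfold Rsqr in E.
  unfold rotation_z; set (x := px p); set (y := py p); unfold px, py; simpl fst; simpl snd.
  transitivity ((sin t * sin t + cos t * cos t) * ((x - x0) ^ 2 + (y - y0) ^ 2)); [ring|rewrite E; ring]. }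
destruct (proj2 (Hc s _ Hs) On) as [t'' E]; now exists s, t''.
Qed.

Lemma on_circle_sq x0 y0 z0 rho rho' p : rho ^ 2 = rho' ^ 2 ->
  on_circle x0 y0 z0 rho p <-> on_circle x0 y0 z0 rho' p.
Proof. unfold on_circle; now intros ->. Qed.

(** Both coordinates move with the speed [la z' r^2], so the center stays at a fixed horizontal
    displacement from that of the family. *)
Lemma family_center_drift T c la mu h (x z : R -> R) (s z' r : R) :
  la ^ 2 + mu ^ 2 <> 0 -> family_domain T c la mu (z s - h) ->
  family_r T c la mu (z s - h) ^ 2 = r ^ 2 ->
  is_derive z s z' -> is_derive x s (la * z' * r ^ 2) ->
  is_derive (fun s => x s - family_a T c la mu (z s - h)) s 0.
Proof.
intros HL D E Hz Hx.
assert (Ha := is_derive_family_a T c la mu _ HL D); rewrite E in Ha.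
assert (Hz' : is_derive (fun s => z s - h) s z').
{ replace z' with (z' - 0) by ring.
  apply (is_derive_minus (V := R_NormedModule) z (fun _ => h)); [exact Hz|apply is_derive_cst]. }
replace 0 with (la * z' * r ^ 2 - z' * (la * r ^ 2)) by ring.
apply (is_derive_minus (V := R_NormedModule) x (fun s => family_a T c la mu (z s - h))); [exact Hx|].
exact (is_derive_comp (V := R_NormedModule) (family_a T c la mu) (fun s => z s - h) s _ _ Ha Hz').
Qed.

(** Planar surfaces are set apart because a plane with [nu_3 <> 0] has zero anisotropic mean
    curvature and carries many families of circles; a piece of a tilted plane fits neither
    alternative. *)
Theorem corollary1p4 :
  forall (I : R -> Prop) (C e1 e2 : R -> R3) (r : R -> R),
    cyclic I C e1 e2 r ->
    dirichlet_minimal_on I (circles C e1 e2 r) ->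
    ~ planar (surface I (circles C e1 e2 r)) ->
    revolution_about_vertical_axis (surface I (circles C e1 e2 r)) \/
    exists (k : family_type) (c la mu : R) (J : R -> Prop) (v : R3),
      c <> 0 /\ la ^ 2 + mu ^ 2 <> 0 /\
      nonempty_open_interval J /\ (forall s, J s -> family_domain k c la mu s) /\
      (forall p : R3,
         surface I (circles C e1 e2 r) p <->
         surface J (fun s t => plus v (family_X k c la mu s t)) p).
Proof.
intros I C e1 e2 r cyc mini Np.
assert (Int : nonempty_open_interval I) by apply cyc.
assert (SC : smooth_curve_on I C) by apply cyc.
assert (Sr : smooth_on I r) by apply cyc.
assert (On : forall s, I s -> 0 < r s /\ dot (e1 s) (e1 s) = 1 /\ dot (e2 s) (e2 s) = 1 /\ dot (e1 s) (e2 s) = 0)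
  by apply cyc.
destruct (proj1 Int) as [s0 Hs0].
(* One parameter decides for all, since the height of the normal of the planes is constant. *)
destruct (Req_dec (pz (cross (e1 s0) (e2 s0)) ^ 2) 1) as [Hn|Hn].
2:{ elim Np; now apply (tilted_planar I C e1 e2 r cyc mini s0). }
assert (hor : forall s, I s -> pz (e1 s) = 0 /\ pz (e2 s) = 0).
{ intros s Hs; assert (F := frame_height I C e1 e2 r cyc s Hs); cbv beta in F.
  assert (E := nrm_pz_const I C e1 e2 r cyc mini s s0 Hs Hs0); cbv beta in E.
  rewrite E, Hn in F; split; nra. }
assert (Hc : forall s p, I s -> (exists t, p = circles C e1 e2 r s t) <->
     on_circle (px (C s)) (py (C s)) (pz (C s)) (r s) p).
{ intros s p Hs; destruct (On s Hs) as (? & ? & ? & ?), (hor s Hs) as [? ?].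
  now apply horizontal_circle. }
assert (Eq := horizontal_equations I C e1 e2 r cyc mini hor).
destruct (horizontal_flat_or_steep I C e1 e2 r cyc mini hor) as [Z|Z].
{ elim Np; apply (planar_of_vanishing_speed I C e1 e2 r cyc (cross (e1 s0) (e2 s0))).
  - intros F; rewrite F in Hn; rewrite pz_zero in Hn; lra.
  - intros s Hs; split; [exact (nrm_const I C e1 e2 r cyc mini s s0 Hs Hs0)|].
    destruct (horizontal_normal I C e1 e2 r cyc hor s0 Hs0) as (eps & _ & E); rewrite E.
    unfold dot; rewrite (Z s Hs); unfold px, py, pz; simpl; ring. }
assert (Dr : forall s, I s -> is_derive r s (Derive_n r 1 s)).
{ intros s Hs; exact (smooth_on_derive I r 0 s Sr Hs). }
assert (r0 : forall s, I s -> r s <> 0).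
{ intros s Hs; destruct (On s Hs) as [r0 _]; lra. }
destruct (center_first_integral I (fun s => px (C s)) (fun s => px (D3 C 1 s)) (fun s => px (D3 C 2 s))
  (fun s => pz (D3 C 1 s)) (fun s => pz (D3 C 2 s)) r (Derive_n r 1) Int) as [la La].
{ intros s Hs; destruct (smooth_curve_derive I C 1 s SC Hs) as (Hx & Hy & Hz).
  repeat (split; [now auto|]). apply Eq, Hs. }
destruct (center_first_integral I (fun s => py (C s)) (fun s => py (D3 C 1 s)) (fun s => py (D3 C 2 s))
  (fun s => pz (D3 C 1 s)) (fun s => pz (D3 C 2 s)) r (Derive_n r 1) Int) as [mu Mu].
{ intros s Hs; destruct (smooth_curve_derive I C 1 s SC Hs) as (Hx & Hy & Hz).
  repeat (split; [now auto|]). apply Eq, Hs. }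
assert (DC : forall s, I s -> is_derive3 C s (D3 C 1 s)).
{ intros s Hs; now apply smooth_curve_derive_0 with I. }
destruct (Req_dec (la ^ 2 + mu ^ 2) 0) as [HL|HL].
{ left; assert (la = 0) by nra. assert (mu = 0) by nra. subst la mu.
  apply (fixed_center_revolution I C e1 e2 r (px (C s0)) (py (C s0))); [|exact Hc].
  intros s Hs; split.
  - apply (interval_derive_0 I (fun s => px (C s)) Int); [|assumption|assumption].
    intros x Hx; destruct (DC x Hx) as (D & _ & _).
    rewrite (La x Hx) in D; now rewrite !Rmult_0_l in D.
  - apply (interval_derive_0 I (fun s => py (C s)) Int); [|assumption|assumption].
    intros x Hx; destruct (DC x Hx) as (_ & D & _).
    rewrite (Mu x Hx) in D; now rewrite !Rmult_0_l in D. }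
right.
destruct (radius_first_integral I (fun s => pz (C s)) (fun s => pz (D3 C 1 s)) (fun s => pz (D3 C 2 s))
  r (Derive_n r 1) (Derive_n r 2) la mu Int HL) as (T & c & h & c0 & P).
{ intros s Hs; destruct (smooth_curve_derive I C 1 s SC Hs) as (_ & _ & Hz1).
  destruct (DC s Hs) as (_ & _ & Hz).
  split; [exact Hz|split; [exact Hz1|split; [now apply Dr|split]]].
  - exact (smooth_on_derive I r 1 s Sr Hs).
  - split; [now apply Z|split; [now apply r0|]].
    rewrite <- (La s Hs), <- (Mu s Hs); now apply Eq. }
assert (Cx : forall s, I s -> px (C s) - family_a T c la mu (pz (C s) - h)
  = px (C s0) - family_a T c la mu (pz (C s0) - h)).
{ intros s Hs; apply (interval_derive_0 I (fun s => px (C s) - family_a T c la mu (pz (C s) - h)) Int);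
    [|assumption|assumption].
  intros x Hx; destruct (DC x Hx) as (Dx & _ & Dz), (P x Hx) as [Dom E].
  rewrite (La x Hx) in Dx.
  exact (family_center_drift T c la mu h (fun s => px (C s)) _ x _ _ HL Dom E Dz Dx). }
assert (Cy : forall s, I s -> py (C s) - family_b T c la mu (pz (C s) - h)
  = py (C s0) - family_b T c la mu (pz (C s0) - h)).
{ intros s Hs; rewrite !family_b_swap.
  apply (interval_derive_0 I (fun s => py (C s) - family_a T c mu la (pz (C s) - h)) Int);
    [|assumption|assumption].
  intros x Hx; destruct (DC x Hx) as (_ & Dy & Dz), (P x Hx) as [Dom E].
  rewrite (Mu x Hx) in Dy; apply family_domain_swap in Dom; rewrite family_r_swap in E.
  rewrite Rplus_comm in HL.
  exact (family_center_drift T c mu la h (fun s => py (C s)) _ x _ _ HL Dom E Dz Dy). }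
(* The horizontal part is the constant displacement between the two centers, read off at [s0]; the
   vertical part is the shift of the profile. *)
set (v := (px (C s0) - family_a T c la mu (pz (C s0) - h),
  py (C s0) - family_b T c la mu (pz (C s0) - h), h) : R3).
exists T, c, la, mu, (fun x => exists s, I s /\ x = pz (C s) - h), v.
split; [exact c0|split; [exact HL|split; [|split]]].
- apply (interval_image I (fun s => pz (C s)) (fun s => pz (D3 C 1 s)) h Int).
  intros s Hs; destruct (smooth_curve_derive I C 1 s SC Hs) as (_ & _ & Hz1).
  destruct (DC s Hs) as (_ & _ & Hz); split; [exact Hz|split; [|now apply Z]].
  apply (ex_derive_continuous (K := R_AbsRing) (V := R_NormedModule)); eexists; exact Hz1.
- intros x (s & Hs & ->); now apply P.
- assert (Fam : forall s p, I s ->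
    (exists t, p = circles C e1 e2 r s t) <->
    (exists t, p = plus v (family_X T c la mu (pz (C s) - h) t))).
  { intros s p Hs; destruct (P s Hs) as [Dom R].
    rewrite family_circle.
    - rewrite (Hc s p Hs).
      replace (px v + family_a T c la mu (pz (C s) - h)) with (px (C s))
        by (change (px v) with (px (C s0) - family_a T c la mu (pz (C s0) - h)); rewrite <- (Cx s Hs); ring).
      replace (py v + family_b T c la mu (pz (C s) - h)) with (py (C s))
        by (change (py v) with (py (C s0) - family_b T c la mu (pz (C s0) - h)); rewrite <- (Cy s Hs); ring).
      replace (pz v + (pz (C s) - h)) with (pz (C s)) by (change (pz v) with h; ring).
      now apply on_circle_sq.
    - intros F; rewrite F in R; assert (N := r0 s Hs); nra. }
  intros p; split.
  + intros (s & t & Hs & Hp).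
    destruct (proj1 (Fam s p Hs) (ex_intro _ t Hp)) as [t' Hp'].
    exists (pz (C s) - h), t'; split; [now exists s|exact Hp'].
  + intros (x & t & (s & Hs & ->) & Hp).
    destruct (proj2 (Fam s p Hs) (ex_intro _ t Hp)) as [t' Hp'].
    now exists s, t'.
Qed.
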